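(* Let $1\le s \le r\le 2$. Then there exists a constant $C=C(r,s)>0$ such that for all $n\geq m$ satisfying \[ \log m + \frac{r'}{r}(\log m)^{r(\frac1{s}-\frac1{r})} \le \log n\,, \] and for all sequences $(J_m)$ of index sets, each with degree at most $m$, the following estimates hold: \[ \chi_{\mathrm{mon}}\big(\mathcal P_{J_m}( \ell_{r,s}^n)\big) \le C^m \left(\frac{n}{m} \right)^{\frac{m-1}{r'}} \quad \text{and}\quad \lambda\big(\mathcal P_{J_m}(\ell_{r,s}^n)\big) \le C^m \left(\frac{n}{m} \right)^{\frac{m}{r'}}\,. \] Moreover, these estimates are optimal for all $n$ and $m$ with $\Lambda_T(m) \subset J_m$ (without restricting to the condition $\log m + \frac{r'}{r}(\log m)^{r(\frac1{s}-\frac1{r})} \le \log n$), in the sense that the reverse estimates hold up to a factor $C^m$; in particular, the two-sided estimates hold whenever $m^{1+\delta} \leq C n$ for some $\delta>0$ in the case $(r,s)\ne(2,1)$, or $m^{2} \leq C n$ in the case $(r,s)=(2,1)$.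
   Context: For $1\le r,s\le\infty$, $\ell_{r,s}^n$ denotes $\mathbb{C}^n$ with the Lorentz (quasi-)norm $\|z\|_{\ell_{r,s}}=\|(z_k^* k^{1/r-1/s})_k\|_{\ell_s}$, $z^*$ the decreasing rearrangement of $|z|$; $r'$ is the conjugate exponent of $r$. An index set is a subset of the set of finitely supported multi-indices $\alpha\in\mathbb{N}_0^{(\mathbb{N})}$; it has degree at most $m$ if $|\alpha|=\sum\alpha_i\le m$ for all its elements. $\Lambda_T(m)$ is the set of tetrahedral multi-indices (entries $0$ or $1$) with $|\alpha|=m$. For an index set $J$ and a Banach space $X_n=(\mathbb{C}^n,\|\cdot\|)$, $\mathcal{P}_J(X_n)$ is the space of polynomials $\sum_{\alpha\in J\cap\mathbb{N}_0^n}c_\alpha z^\alpha$ with the supremum norm on the unit ball of $X_n$. $\lambda(\cdot)$ denotes the (absolute) projection constant of a Banach space, and $\chi_{\mathrm{mon}}(\mathcal{P}_J(X_n))$ denotes the unconditional basis constant of the monomial basis $(z^\alpha)_{\alpha\in J}$ of $\mathcal{P}_J(X_n)$. *)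

(* Defs.v *)
From HB Require Import structures.
From mathcomp Require Import all_boot all_order all_algebra.
From mathcomp Require Import all_classical all_reals all_analysis.
From mathcomp Require Import complex.
Set Implicit Arguments. Unset Strict Implicit. Unset Printing Implicit Defensive.
Import Order.TTheory GRing.Theory Num.Theory.
Import numFieldNormedType.Exports.
Local Open Scope ring_scope.
Local Open Scope classical_set_scope.

Definition cabs (R : realType) (z : R[i]) : R := Normc.normc z.

Definition drearr (R : realType) (n : nat) (z : 'I_n -> R[i]) : seq R :=
  sort (fun x y : R => y <= x) [seq cabs (z i) | i <- enum 'I_n].

(* Lorentz norm on C^n, for finite 1 <= r, s:
   ||z||_{r,s} = ( sum_{k=1}^n (z^*_k)^s k^{s/r - 1} )^{1/s}
              = || (z^*_k k^{1/r-1/s})_k ||_{l_s} *)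
Definition lorentz_norm (R : realType) (r s : R) (n : nat) (z : 'I_n -> R[i]) : R :=
  (\sum_(k < n) (nth 0 (drearr z) k) `^ s * (k.+1)%:R `^ (s / r - 1)) `^ s^-1.

Definition lorentz_ball (R : realType) (r s : R) (n : nat) : set ('I_n -> R[i]) :=
  [set z | lorentz_norm r s z <= 1].

(* A multi-index alpha in N_0^(N) is a function nat -> nat (finite support is
   part of the degree condition below). An index set is a set of those. *)
Definition mdeg_le (m : nat) (a : nat -> nat) : Prop :=
  exists N : nat, (forall i, (N <= i)%N -> a i = 0%N) /\ (\sum_(i < N) a i <= m)%N.

Definition index_set_deg_le (J : set (nat -> nat)) (m : nat) : Prop :=
  forall a, J a -> mdeg_le m a.

Definition tetra (m : nat) : set (nat -> nat) :=
  [set a | (forall i, (a i <= 1)%N) /\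
           exists N : nat, (forall i, (N <= i)%N -> a i = 0%N) /\ (\sum_(i < N) a i = m)%N].

Definition mi (n d : nat) := {ffun 'I_n -> 'I_d.+1}.

Definition ext (n d : nat) (a : mi n d) : nat -> nat :=
  fun i => match (insub i : option 'I_n) with Some j => nat_of_ord (a j) | None => 0%N end.

Definition coefs (R : realType) (n d : nat) := {ffun mi n d -> R[i]}.

Definition inPJ (R : realType) (J : set (nat -> nat)) (n d : nat) (c : coefs R n d) : Prop :=
  forall a : mi n d, ~ J (ext a) -> c a = 0.

Definition peval (R : realType) (n d : nat) (c : coefs R n d) (z : 'I_n -> R[i]) : R[i] :=
  \sum_(a : mi n d) c a * \prod_(i < n) z i ^+ (a i).

Definition pnorm (R : realType) (r s : R) (n d : nat) (c : coefs R n d) : R :=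
  sup [set cabs (peval c z) | z in @lorentz_ball R r s n].

(* chi_mon(P_J(l_{r,s}^n)) : unconditional basis constant of the monomials, i.e. the
   best K with || sum eps_a c_a z^a || <= K || sum c_a z^a || for all unimodular eps.
   (d is an upper bound for the entries of multi-indices of J; we use d = m.) *)
Definition chi_mon (R : realType) (r s : R) (n d : nat) (J : set (nat -> nat)) : R :=
  inf [set K : R | 0 <= K /\
        forall c eps : coefs R n d, inPJ J c -> (forall a, cabs (eps a) = 1) ->
          pnorm r s [ffun a => eps a * c a] <= K * pnorm r s c].

Definition relproj (R : realType) (n d : nat) (J : set (nat -> nat))
    (Y : normedModType R[i]) (V : coefs R n d -> Y) : R :=
  inf [set K : R | 0 <= K /\
        exists P : Y -> Y,
          (forall (a : R[i]) (x y : Y), P (a *: x + y) = a *: P x + P y) /\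
          (forall y, exists2 c, inPJ J c & P y = V c) /\
          (forall c, inPJ J c -> P (V c) = V c) /\
          (forall y, `|P y| <= (K%:C)%C * `|y|)].

Definition projconst (R : realType) (r s : R) (n d : nat) (J : set (nat -> nat)) : R :=
  sup [set l : R | exists (Y : completeNormedModType R[i]) (V : coefs R n d -> Y),
         (forall (a : R[i]) (x y : coefs R n d), V (a *: x + y) = a *: V x + V y) /\
         (forall c, inPJ J c -> `|V c| = ((pnorm r s c)%:C)%C) /\
         l = relproj J V].

(* Main.v *)
Require Import Defs.
From HB Require Import structures.
From mathcomp Require Import all_boot all_order all_algebra.
From mathcomp Require Import all_classical all_reals all_analysis.
From mathcomp Require Import fingroup perm cyclic complex ring lra zify.
From mathcomp Require separable cyclotomic.
Import Order.TTheory GRing.Theory Num.Theory.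
Import numFieldNormedType.Exports.
Local Open Scope ring_scope.
Local Open Scope classical_set_scope.

(** Monomial coefficients are controlled by Cauchy estimates at points adapted to
    the multi-index: for |b| <= m the point with entries
    m^(-1/r) max(1, (b_i - 1)^(1/r) / (2 + log m)^(1/s - 1/r)) on the support of b lies
    in a fixed multiple of the unit ball of l_{r,s}, and its b-th monomial is at least,
    up to C^m, to (b! / m^|b|)^(1/r) divided by a power of the logarithm; the
    logarithmic condition absorbs that power into (n/m)^(1 - 1/r).  Hoelder's inequality
    then bounds the sum of |c_a| |z^a| over |a| <= m.  Extending the coefficient
    functionals by Hahn-Banach yields the bound on the projection constant.  For chi_mon
    one factor is gained by writing z^a = z^b z_k and estimating the sum over k at once,
    through a point which is the adapted one on the support of b and z elsewhere.

    For the lower bound on chi_mon, random roots of unity eps_a make the sum of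
    eps_a z^a over tetrahedral a small: its k-th power, k = n / m, has coefficients of
    small second moment.  For the projection constant, P_J is embedded in the bounded
    functions on the ball; the L2-L1 comparison on the torus and Hahn-Banach represent
    the tetrahedral part of P(z) as an average of P over a torus against a bounded
    kernel, and applying a projection to that kernel computes the trace of its
    restriction to the tetrahedral part. *)

Section Cabs.
Context {R : realType}.
Implicit Types (x y z : R[i]) (a : R).

Lemma cabsE z : (cabs z)%:C%C = `|z|.
Proof. by case: z. Qed.

Lemma cabs_ge0 z : 0 <= cabs z.
Proof. by have := normr_ge0 z; rewrite -cabsE lecR. Qed.

Lemma cabs0 : cabs (0 : R[i]) = 0. Proof. exact: Normc.normc0. Qed.

Lemma cabs1 : cabs (1 : R[i]) = 1. Proof. exact: Normc.normc1. Qed.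

Lemma cabsM x y : cabs (x * y) = cabs x * cabs y.
Proof. exact: Normc.normcM. Qed.

Lemma cabsV x : cabs x^-1 = (cabs x)^-1.
Proof. exact: Normc.normcV. Qed.

Lemma cabs_eq0 x : (cabs x == 0) = (x == 0).
Proof. by apply/eqP/eqP => [/Normc.eq0_normc|->]; rewrite ?cabs0. Qed.

Lemma cabsD x y : cabs (x + y) <= cabs x + cabs y.
Proof. by have := ler_normD x y; rewrite -!cabsE -rmorphD lecR. Qed.

Lemma cabsN x : cabs (- x) = cabs x.
Proof. by apply/complexI; rewrite !cabsE normrN. Qed.

Lemma cabsX x k : cabs (x ^+ k) = cabs x ^+ k.
Proof. by apply/complexI; rewrite rmorphXn /= !cabsE normrX. Qed.

Lemma cabs_conj x : cabs x^*%C = cabs x.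
Proof. by case: x => a b; rewrite /cabs /= sqrrN. Qed.

Lemma cabs_real a : cabs a%:C%C = `|a|.
Proof. by rewrite /cabs /= expr0n /= addr0 sqrtr_sqr. Qed.

Lemma cabs_nat k : cabs (k%:R : R[i]) = k%:R.
Proof. by rewrite -[k%:R in LHS](rmorph_nat (real_complex R)) cabs_real ger0_norm. Qed.

Lemma cabs_prod (I : finType) (f : I -> R[i]) :
  cabs (\prod_i f i) = \prod_i cabs (f i).
Proof. exact: (big_morph _ cabsM cabs1). Qed.

Lemma cabs_sum (I : Type) (r : seq I) (P : pred I) (f : I -> R[i]) :
  cabs (\sum_(i <- r | P i) f i) <= \sum_(i <- r | P i) cabs (f i).
Proof.
elim/big_ind2: _ => [|x1 x2 y1 y2 h1 h2|//]; first by rewrite cabs0.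
by apply: (le_trans (cabsD _ _)); apply: lerD.
Qed.

Lemma mulr_conj z : z * z^*%C = (cabs z ^+ 2)%:C%C.
Proof. by rewrite -sqr_normc rmorphXn /= cabsE. Qed.

Lemma Re_le_cabs z : complex.Re z <= cabs z.
Proof.
have := normc_ge_Re z; rewrite -cabsE lecR; apply: le_trans; exact: ler_norm.
Qed.

Lemma Re_realM a z : complex.Re (a%:C%C * z) = a * complex.Re z.
Proof. by case: z => u v /=; rewrite mul0r subr0. Qed.

Lemma phase_exists z : exists2 u : R[i], cabs u = 1 & u * z = (cabs z)%:C%C.
Proof.
have [->|z0] := eqVneq z 0; first by exists 1; rewrite ?cabs1// cabs0 mulr0.
exists ((cabs z)%:C%C / z); last by rewrite divfK.
by rewrite cabsM cabsV cabs_real ger0_norm ?cabs_ge0// divff// cabs_eq0.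
Qed.

Lemma prim_root_exists N : (0 < N)%N -> {z : R[i] | N.-primitive_root z}.
Proof.
pose p : {poly R[i]} := 'X^N - 1; have [r Dp] := closed_field_poly_normal p.
move=> N_gt0; apply/sigW; rewrite (monicP _) ?monicXnsubC // scale1r in Dp.
have rn1: all N.-unity_root r by apply/allP=> z; rewrite -root_prod_XsubC -Dp.
have sz_r: (N < (size r).+1)%N by rewrite -(size_prod_XsubC r id) -Dp size_XnsubC.
have [|z] := hasP (has_prim_root N_gt0 rn1 _ sz_r); last by exists z.
by rewrite -separable.separable_prod_XsubC -Dp cyclotomic.separable_Xn_sub_1 // pnatr_eq0 -lt0n.
Qed.

Lemma cabs_prim_root N (z : R[i]) : N.-primitive_root z -> cabs z = 1.
Proof.
move=> zp; have N0 := prim_order_gt0 zp.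
have /eqP : cabs z ^+ N = 1 by rewrite -cabsX (prim_expr_order zp) cabs1.
by rewrite pexpr_eq1 ?cabs_ge0// => /eqP.
Qed.

End Cabs.

(** * Discrete tori *)

Section Torus.
Context {R : realType} {I : finType} {N : nat}.
Variable zeta : R[i].
Hypothesis zetaP : N.-primitive_root zeta.
Let W := {ffun I -> 'I_N}.
Implicit Types (w : W) (p q : I -> nat).

Definition chr w p : R[i] := \prod_i zeta ^+ (w i * p i).

Lemma chr_cabs w p : cabs (chr w p) = 1.
Proof.
rewrite cabs_prod big1 // => i _; rewrite cabsX (cabs_prim_root _ _ zetaP) expr1n //.
Qed.

Lemma chrE w p : chr w p = \prod_i (zeta ^+ w i) ^+ p i.
Proof. by apply: eq_bigr => i _; rewrite exprM. Qed.

Lemma chrD w p q : chr w (fun i => p i + q i)%N = chr w p * chr w q.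
Proof. by rewrite -big_split; apply: eq_bigr => i _ /=; rewrite mulnDr exprD. Qed.

Lemma chr_orth p q : (forall i, p i < N)%N -> (forall i, q i < N)%N ->
  \sum_w chr w p * (chr w q)^*%C = if [forall i, p i == q i] then #|W|%:R else 0.
Proof.
move=> pN qN.
pose xi i := zeta ^+ p i * (zeta^-1) ^+ q i.
have z0 : zeta != 0 by rewrite -cabs_eq0 (cabs_prim_root _ _ zetaP) oner_eq0.
have zc : zeta^*%C = zeta^-1.
  apply: (mulfI z0); rewrite divff// mulr_conj (cabs_prim_root _ _ zetaP) expr1n //.
transitivity (\sum_(w : W) \prod_i xi i ^+ w i).
  apply: eq_bigr => w _; rewrite rmorph_prod -big_split; apply: eq_bigr => i _ /=.
  by rewrite rmorphXn /= zc exprMn -!exprM ![(_ * w i)%N]mulnC.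
rewrite -(bigA_distr_bigA (fun i (j : 'I_N) => xi i ^+ j)).
case: ifPn => [/forallP h|].
  rewrite (eq_bigr (fun=> N%:R)); last first.
    move=> i _; rewrite /xi (eqP (h i)) -exprMn divff// expr1n.
    by under eq_bigr do rewrite expr1n; rewrite sumr_const card_ord.
  by rewrite prodr_const card_ffun card_ord natrX.
rewrite negb_forall => /existsP [i pq]; rewrite (bigD1 i)//=.
suff -> : \sum_(j < N) xi i ^+ j = 0 by rewrite mul0r.
have xi1 : xi i != 1.
  apply: contra pq => /eqP e.
  have : zeta ^+ p i = zeta ^+ q i.
    by rewrite -[RHS]mul1r -e -mulrA -exprMn mulVf// expr1n mulr1.
  by move/eqP; rewrite (eq_prim_root_expr zetaP) !modn_small.
have : (xi i - 1) * \sum_(j < N) xi i ^+ j = 0.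
  rewrite -subrX1 exprMn -!exprM ![(_ * N)%N]mulnC !exprM.
  by rewrite exprVn !(prim_expr_order zetaP) invr1 !expr1n mulr1 subrr.
by move/eqP; rewrite mulf_eq0 subr_eq0 (negPf xi1) /= => /eqP.
Qed.

Lemma card_torus_gt0 : (0 < #|W|)%N.
Proof. by rewrite card_ffun card_ord expn_gt0 (prim_order_gt0 zetaP). Qed.

Section Poly.
Context {X : finType} (e : X -> I -> nat) (b : X -> R[i]).
Hypothesis eN : forall x i, (e x i < N)%N.
Let F w := \sum_x b x * chr w (e x).

Lemma torus_coef q : (forall i, q i < N)%N ->
  \sum_w F w * (chr w q)^*%C = #|W|%:R * \sum_(x | [forall i, e x i == q i]) b x.
Proof.
move=> qN; under eq_bigr do rewrite /F mulr_suml.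
rewrite exchange_big mulr_sumr [RHS]big_mkcond; apply: eq_bigr => x _ /=.
under eq_bigr do rewrite -mulrA; rewrite -mulr_sumr (chr_orth _ _ (eN x) qN).
by case: ifP => _; rewrite ?mulr0// mulrC.
Qed.

Lemma torus_cauchy q M : (forall i, q i < N)%N -> (forall w, cabs (F w) <= M) ->
  cabs (\sum_(x | [forall i, e x i == q i]) b x) <= M.
Proof.
move=> qN FM; have W0 : 0 < #|W|%:R :> R by rewrite ltr0n card_torus_gt0.
rewrite -(ler_pM2l W0) -cabs_nat -cabsM -torus_coef// cabs_nat.
apply: (le_trans (cabs_sum _ _ _ _)); rewrite mulr_natl -sumr_const.
by apply: ler_sum => w _; rewrite cabsM cabs_conj chr_cabs mulr1.
Qed.

Lemma torus_parseval :
  (\sum_w cabs (F w) ^+ 2)%:C%C =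
  #|W|%:R * \sum_x \sum_(y | [forall i, e y i == e x i]) b y * (b x)^*%C.
Proof.
rewrite rmorph_sum /=.
under eq_bigr => w _.
  rewrite -mulr_conj {2}/F rmorph_sum mulr_sumr.
  under eq_bigr => x _ do rewrite rmorphM /= mulrCA mulrC.
  over.
rewrite exchange_big mulr_sumr; apply: eq_bigr => x _ /=.
rewrite -mulr_suml torus_coef ?mulr_suml -?mulrA; last exact: eN.
by rewrite mulr_suml.
Qed.

Lemma torus_parseval_inj : (forall x y, (forall i, e x i = e y i) -> x = y) ->
  \sum_w cabs (F w) ^+ 2 = #|W|%:R * \sum_x cabs (b x) ^+ 2.
Proof.
move=> inj; apply/complexI; rewrite torus_parseval rmorphM rmorph_nat rmorph_sum.
congr (_ * _); apply: eq_bigr => x _; rewrite -[RHS]/((cabs (b x) ^+ 2)%:C%C).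
rewrite -mulr_conj (big_pred1 x) // => y /=.
apply/forallP/eqP => [h|->//]; apply: inj => i; exact/eqP.
Qed.

Lemma torus_parseval_le M :
  (forall x, b x != 0 -> (#|[pred y | [forall i, e y i == e x i]]| <= M)%N) ->
  \sum_w cabs (F w) ^+ 2 <= #|W|%:R * (M%:R * \sum_x cabs (b x) ^+ 2).
Proof.
move=> eM; set S := \sum_w _.
pose r x y := [forall i, e y i == e x i].
have rC x y : r x y = r y x by apply: eq_forallb => i; rewrite eq_sym.
have -> : S = complex.Re S%:C%C by [].
rewrite torus_parseval -(rmorph_nat (real_complex R)) Re_realM.
apply: ler_wpM2l; first exact: ler0n.
apply: (@le_trans _ _ (\sum_x \sum_(y | r x y) (cabs (b y) ^+ 2 + cabs (b x) ^+ 2) / 2)).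
  rewrite raddf_sum; apply: ler_sum => x _; rewrite raddf_sum; apply: ler_sum => y _.
  apply: (le_trans (Re_le_cabs _)); rewrite cabsM cabs_conj ler_pdivlMr//.
  by have := sqr_ge0 (cabs (b y) - cabs (b x)); lra.
under eq_bigr do rewrite -mulr_suml big_split /=.
rewrite -mulr_suml big_split /=.
have -> : \sum_x \sum_(y | r x y) cabs (b y) ^+ 2 = \sum_x \sum_(y | r x y) cabs (b x) ^+ 2.
  rewrite (exchange_big_dep xpredT) //=; apply: eq_bigr => x _.
  by apply: eq_bigl => y; rewrite rC.
rewrite mulrDl -splitr mulr_sumr; apply: ler_sum => x _.
have [->|bx] := eqVneq (b x) 0.
  by rewrite cabs0 expr0n /= mulr0 big1.
rewrite sumr_const -[X in X <= _]mulr_natl ler_wpM2r ?sqr_ge0//.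
by rewrite ler_nat; exact: eM.
Qed.

End Poly.
End Torus.
(** * Monomial sums *)

Section Holder.
Context {R : realType}.

Lemma powR_young (a b t : R) : 0 <= a -> 0 <= b -> 0 < t < 1 ->
  a `^ t * b `^ (1 - t) <= t * a + (1 - t) * b.
Proof.
move=> a0 b0 /andP[t0 t1]; have u0 : 0 < 1 - t by rewrite subr_gt0.
have := @conjugate_powR R (a `^ t) (b `^ (1 - t)) t^-1 (1 - t)^-1
  (powR_ge0 _ _) (powR_ge0 _ _).
rewrite !invr_gt0 !invrK -!powRrM !divff ?gt_eqF// !powRr1// => /(_ t0 u0).
rewrite addrC subrK => /(_ erefl); lra.
Qed.

Lemma holder_sum {I : finType} (P : pred I) (A B : I -> R) (t : R) :
  (forall i, 0 <= A i) -> (forall i, 0 <= B i) -> 0 <= t <= 1 ->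
  \sum_(i | P i) A i `^ t * B i `^ (1 - t) <=
  (\sum_(i | P i) A i) `^ t * (\sum_(i | P i) B i) `^ (1 - t).
Proof.
move=> A0 B0 /andP[]; rewrite le_eqVlt => /predU1P[<- _|t0].
  rewrite subr0 powRr0 mul1r powRr1 ?sumr_ge0//.
  by apply: ler_sum => i _; rewrite powRr0 mul1r powRr1.
rewrite le_eqVlt => /predU1P[->|t1].
  rewrite subrr powRr0 mulr1 powRr1 ?sumr_ge0//.
  by apply: ler_sum => i _; rewrite powRr0 mulr1 powRr1.
have u0 : 0 < 1 - t by rewrite subr_gt0.
set SA := \sum_(i | P i) A i; set SB := \sum_(i | P i) B i.
have SA0 : 0 <= SA by apply: sumr_ge0.
have SB0 : 0 <= SB by apply: sumr_ge0.
have zero_l i : P i -> SA = 0 -> A i = 0.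
  move=> Pi /eqP; rewrite psumr_eq0 // => /allP /(_ i (mem_index_enum _)).
  by rewrite Pi => /eqP.
have zero_r i : P i -> SB = 0 -> B i = 0.
  move=> Pi /eqP; rewrite psumr_eq0 // => /allP /(_ i (mem_index_enum _)).
  by rewrite Pi => /eqP.
have [SAz|SAn] := eqVneq SA 0.
  rewrite big1 ?mulr_ge0 ?powR_ge0// => i Pi.
  by rewrite (zero_l _ Pi SAz) powR0 ?mul0r ?gt_eqF.
have [SBz|SBn] := eqVneq SB 0.
  rewrite big1 ?mulr_ge0 ?powR_ge0// => i Pi.
  by rewrite (zero_r _ Pi SBz) [0 `^ _]powR0 ?mulr0 // gt_eqF.
have SAp : 0 < SA by rewrite lt_def SAn.
have SBp : 0 < SB by rewrite lt_def SBn.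
have E : \sum_(i | P i) (t * (A i / SA) + (1 - t) * (B i / SB)) = 1.
  by rewrite big_split /= -!mulr_sumr -!mulr_suml !divff// !mulr1 addrC subrK.
rewrite -[X in _ <= X]mulr1 -[X in _ <= _ * X]E mulr_sumr; apply: ler_sum => i Pi.
have -> : A i `^ t * B i `^ (1 - t) =
   SA `^ t * SB `^ (1 - t) * ((A i / SA) `^ t * (B i / SB) `^ (1 - t)).
  rewrite mulrACA -!powRM ?divr_ge0 // mulrCA divff // mulr1.
  by rewrite mulrCA divff // mulr1.
apply: ler_wpM2l; first by rewrite mulr_ge0 ?powR_ge0.
by apply: powR_young; rewrite ?divr_ge0// t0.
Qed.

Lemma prod_powR {I : finType} (f : I -> R) (t : R) : (forall i, 0 <= f i) ->
  (\prod_i f i) `^ t = \prod_i f i `^ t.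
Proof.
move=> f0; suff [//] : (\prod_i f i) `^ t = \prod_i f i `^ t /\ 0 <= \prod_i f i.
elim/big_ind2: _ => [|x x' y y' [h1 x0] [h2 y0]|//]; first by rewrite powR1.
  by rewrite powRM// h1 h2; split=> //; rewrite mulr_ge0.
Qed.

Lemma exprn_powR (x t : R) k : 0 <= x -> (x ^+ k) `^ t = (x `^ t) ^+ k.
Proof.
move=> x0; rewrite -(@powR_mulrn _ x k x0) -(@powR_mulrn _ (x `^ t) k (powR_ge0 x t)).
by rewrite -[LHS]powRrM -[RHS]powRrM mulrC.
Qed.

Lemma invr_powR (x t : R) : 0 <= x -> x^-1 `^ t = x `^ (- t).
Proof. by move=> x0; rewrite -(@powR_inv1 _ x x0) -[LHS]powRrM mulN1r. Qed.

Lemma sum_le_expR (x : R) d : 0 <= x -> \sum_(j < d) x ^+ j / j`!%:R <= expR x.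
Proof.
move=> x0; rewrite -(big_mkord xpredT (fun j => x ^+ j / j`!%:R)).
apply: (@nondecreasing_cvgn_le R (series (exp_coeff x)) _ (is_cvg_series_exp_coeff x) d).
apply: nondecreasing_series => k _ _.
exact: exp_coeff_ge0.
Qed.

Lemma le_expR_prod {I : finType} (x : I -> R) (M : R) :
  (forall i, 0 <= x i) -> \sum_i x i <= M -> \prod_i (1 + x i) <= expR M.
Proof.
move=> x0 xM; apply: (@le_trans _ _ (expR (\sum_i x i))); last by rewrite ler_expR.
rewrite expR_sum; apply: ler_prod => i _; rewrite addr_ge0//=.
exact: expR_ge1Dx.
Qed.

End Holder.

Definition mon {A : comPzRingType} {n d} (x : 'I_n -> A) (a : mi n d) : A :=
  \prod_(i < n) x i ^+ a i.

Definition mdeg {n d} (a : mi n d) : nat := (\sum_(i < n) a i)%N.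

Definition mfact {n d} (a : mi n d) : nat := (\prod_(i < n) (a i)`!)%N.

(* The excess |a| - #supp a. *)
Definition mexc {n d} (a : mi n d) : nat := (\sum_(i < n) (a i).-1)%N.

Definition tet {n d} (m : nat) (a : mi n d) : bool :=
  [forall i, a i <= 1]%N && (mdeg a == m).

Section Monomials.
Context {R : realType} {n d : nat}.
Implicit Types (x y : 'I_n -> R) (a b : mi n d).

Lemma mon_ge0 x a : (forall i, 0 <= x i) -> 0 <= mon x a.
Proof. by move=> x0; apply: prodr_ge0 => i _; apply: exprn_ge0. Qed.

Lemma mon_gt0 x a : (forall i, 0 < x i) -> 0 < mon x a.
Proof. by move=> x0; apply: prodr_gt0 => i _; apply: exprn_gt0. Qed.

Lemma cabs_mon (z : 'I_n -> R[i]) a : cabs (mon z a) = mon (fun i => cabs (z i)) a.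
Proof. by rewrite cabs_prod; apply: eq_bigr => i _; rewrite cabsX. Qed.

Lemma monM {A : comPzRingType} (x y : 'I_n -> A) a :
  mon (fun i => x i * y i) a = mon x a * mon y a.
Proof. by rewrite -big_split; apply: eq_bigr => i _ /=; rewrite exprMn. Qed.

Lemma mon_const {A : comPzRingType} (c : A) a : mon (fun=> c) a = c ^+ mdeg a.
Proof. exact: prodrXr. Qed.

Lemma powR_mon x a t : (forall i, 0 <= x i) -> mon x a `^ t = mon (fun i => x i `^ t) a.
Proof.
move=> x0; rewrite prod_powR => [|i]; last exact: exprn_ge0.
by apply: eq_bigr => i _; rewrite exprn_powR.
Qed.

Lemma mfact_gt0 a : (0 < mfact a)%N.
Proof. by apply: prodn_gt0 => i; apply: fact_gt0. Qed.

Lemma mon_expR_sum x m : (forall i, 0 <= x i) -> \sum_i x i <= 1 ->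
  \sum_(a : mi n d) mon x a * (m%:R ^+ mdeg a / (mfact a)%:R) <= expR (m%:R : R).
Proof.
move=> x0 x1; apply: (@le_trans _ _ (\prod_i expR (m%:R * x i))); last first.
  by rewrite -expR_sum ler_expR -mulr_sumr ler_piMr.
rewrite (eq_bigr (fun a => \prod_i ((m%:R * x i) ^+ a i / (a i)`!%:R))); last first.
  move=> a _; rewrite big_split /= prodfV -natr_prod -/(mfact a) mulrA; congr (_ / _).
  by rewrite -mon_const -monM; apply: eq_bigr => i _; rewrite mulrC.
rewrite -(bigA_distr_bigA (fun i (j : 'I_d.+1) => (m%:R * x i) ^+ j / j`!%:R)).
apply: ler_prod => i _; rewrite sum_le_expR ?mulr_ge0// andbT.
by apply: sumr_ge0 => j _; rewrite divr_ge0 ?exprn_ge0 ?mulr_ge0.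
Qed.

Lemma mexc_sum (nu : R) j m : 1 <= nu -> n%:R <= m%:R * nu ->
  \sum_(a : mi n d | (mdeg a <= j)%N) nu ^+ mexc a <= (2 * nu) ^+ j * expR m%:R.
Proof.
move=> nu1 nm; have nu0 : 0 < nu by apply: lt_le_trans nu1.
pose h k : R := (2^-1) ^+ k * (if k is 0 then 1 else nu^-1).
have h0 k : 0 <= h k.
  by rewrite mulr_ge0 ?exprn_ge0//; case: k => // k; rewrite invr_ge0 ltW.
apply: (@le_trans _ _ (\sum_(a : mi n d) (2 * nu) ^+ j * \prod_i h (a i))).
  rewrite big_mkcond; apply: ler_sum => a _; case: ifP => [aj|_]; last first.
    by rewrite mulr_ge0 ?exprn_ge0 ?mulr_ge0 ?prodr_ge0// ltW.
  apply: (@le_trans _ _ ((2 * nu) ^+ mdeg a * \prod_i h (a i))); last first.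
    apply: ler_wpM2r; first exact: prodr_ge0.
    by apply: ler_weXn2l => //; lra.
  rewrite -mon_const -big_split -prodrXr; apply: ler_prod => i _.
  rewrite exprn_ge0 ?(ltW nu0)//= /h; case: (nat_of_ord (a i)) => [|k] /=.
    by rewrite !expr0 !mulr1.
  rewrite mulrA -exprMn mulrAC divff// mul1r exprSr mulfK//.
  by rewrite gt_eqF.
rewrite -mulr_sumr; apply: ler_wpM2l; first by rewrite exprn_ge0 ?mulr_ge0 ?ltW.
rewrite -(bigA_distr_bigA (fun i (k : 'I_d.+1) => h k)).
apply: (@le_trans _ _ (\prod_(i < n) (1 + nu^-1))).
  apply: ler_prod => i _; rewrite sumr_ge0//=.
  suff -> : \sum_(k < d.+1) h k = 1 + nu^-1 * (1 - (2^-1) ^+ d).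
    rewrite lerD2l ler_piMr ?invr_ge0 ?ltW// gerBl exprn_ge0//.
  elim: (d) => [|e IH]; first by rewrite big_ord1 /h /= !expr0; ring.
  rewrite big_ord_recr /= IH /h /= exprS; field.
  by rewrite gt_eqF.
apply: le_expR_prod => [i|]; first by rewrite invr_ge0 ltW.
by rewrite sumr_const card_ord -[X in X <= _]mulr_natl ler_pdivrMr.
Qed.

Lemma weighted_monomial_sum (r nu : R) x j m : 1 <= r -> (forall i, 0 <= x i) ->
  \sum_i x i `^ r <= 1 -> (j <= m)%N -> 1 <= nu -> n%:R <= m%:R * nu ->
  \sum_(a : mi n d | (mdeg a <= j)%N)
     mon x a * ((nu `^ (1 - r^-1)) ^+ mexc a * (m%:R ^+ mdeg a / (mfact a)%:R) `^ r^-1)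
  <= (2 * expR 1 ^+ 2) ^+ m * (nu `^ (1 - r^-1)) ^+ j.
Proof.
move=> r1 x0 xr jm nu1 nm; have r0 : 0 < r by apply: lt_le_trans r1.
have nu0 : 0 < nu by apply: lt_le_trans nu1.
have ri : 0 <= r^-1 <= 1 by rewrite invr_ge0 ltW//= invf_le1.
have ri' : 0 <= 1 - r^-1 <= 1 by lra.
pose A a := mon (fun i => x i `^ r) a * (m%:R ^+ mdeg a / (mfact a)%:R).
have A0 a : 0 <= A a.
  by rewrite mulr_ge0 ?divr_ge0 ?exprn_ge0// mon_ge0// => i; apply: powR_ge0.
pose B a := nu ^+ mexc a.
have B0 a : 0 <= B a by rewrite exprn_ge0// ltW.
rewrite (eq_bigr (fun a => A a `^ r^-1 * B a `^ (1 - r^-1))); last first.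
  move=> a _; rewrite /A /B [X in _ = X * _]powRM ?divr_ge0 ?exprn_ge0//; last first.
    by apply: mon_ge0 => i; apply: powR_ge0.
  rewrite powR_mon => [|i]; last exact: powR_ge0.
  rewrite -mulrA exprn_powR ?ltW//; congr (_ * _); last by rewrite mulrC.
  by apply: eq_bigr => i _; rewrite -powRrM divff ?gt_eqF// powRr1.
have e1 : 1 <= expR (1 : R) by rewrite ltW// expR_gt1.
have em : expR (m%:R : R) = expR 1 ^+ m by rewrite -expRM_natl mulr1.
apply: (le_trans (holder_sum _ _ _ _ A0 B0 ri)).
have -> : (2 * expR 1 ^+ 2) ^+ m * (nu `^ (1 - r^-1)) ^+ j =
  expR (m%:R) * ((2 ^+ m * expR m%:R) * (nu ^+ j) `^ (1 - r^-1)) :> R.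
  rewrite exprn_powR ?ltW// em exprMn -exprM mulnC exprM expr2; ring.
have em1 : 1 <= expR (m%:R : R) by rewrite em exprn_ege1.
have EA : \sum_(a : mi n d | (mdeg a <= j)%N) A a <= expR m%:R.
  apply: le_trans (mon_expR_sum (fun i => x i `^ r) m _ xr); last first.
    by move=> i; apply: powR_ge0.
  by rewrite big_mkcond; apply: ler_sum => a _; case: ifP => // _; apply: A0.
have EB := mexc_sum nu j m nu1 nm.
apply: ler_pM; rewrite ?powR_ge0//.
  apply: (@le_trans _ _ (expR m%:R `^ r^-1)); last by apply: ler1_powR; case/andP: ri.
  apply: ge0_ler_powR; rewrite ?nnegrE ?expR_ge0 ?sumr_ge0//; by case/andP: ri.
apply: (@le_trans _ _ (((2 * nu) ^+ j * expR m%:R) `^ (1 - r^-1))).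
  apply: ge0_ler_powR; rewrite ?nnegrE ?mulr_ge0 ?expR_ge0 ?exprn_ge0 ?mulr_ge0 ?sumr_ge0//.
  - by case/andP: ri'.
  - by rewrite ltW.
rewrite exprMn mulrAC powRM ?mulr_ge0 ?exprn_ge0 ?expR_ge0 ?(ltW nu0)//.
apply: ler_wpM2r; first exact: powR_ge0.
apply: (@le_trans _ _ (2 ^+ j * expR m%:R)).
  apply: ler1_powR; last by case/andP: ri'.
  by rewrite mulr_ege1// exprn_ege1// ler1n.
apply: ler_wpM2r; first exact: expR_ge0.
by apply: ler_weXn2l; rewrite ?ler1n.
Qed.

End Monomials.
(** * The Lorentz ball *)

Section Weights.
Context {R : realType}.

Lemma powR_le1 (x t : R) : 0 <= x -> 0 <= t -> x <= 1 -> x `^ t <= 1.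
Proof.
move=> x0 t0 x1; have : x `^ t <= 1 `^ t by apply: ge0_ler_powR; rewrite ?nnegrE.
by rewrite powR1.
Qed.

Lemma powR_le1_inv (x t : R) : 0 <= x -> 0 < t -> x `^ t <= 1 -> x <= 1.
Proof.
move=> x0 t0 h; rewrite [X in X <= _](_ : x = (x `^ t) `^ t^-1).
  by apply: powR_le1; rewrite ?powR_ge0 ?invr_ge0 ?(ltW t0).
by rewrite -powRrM divff ?gt_eqF// powRr1.
Qed.

Lemma sum_inv_sqrt m : \sum_(k < m) (Num.sqrt (k.+1%:R : R))^-1 <= 2 * Num.sqrt m%:R.
Proof.
elim: m => [|m IH]; first by rewrite big_ord0 sqrtr0 mulr0.
rewrite big_ord_recr /=; apply: (le_trans (lerD IH (lexx _))).
set u := Num.sqrt m%:R; set v := Num.sqrt m.+1%:R.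
have v0 : 0 < v by rewrite sqrtr_gt0.
have u0 : 0 <= u by rewrite sqrtr_ge0.
have uv : v ^+ 2 = u ^+ 2 + 1 by rewrite !sqr_sqrtr// -[m.+1]addn1 natrD.
rewrite -(ler_pM2r v0) mulrDl mulVf ?gt_eqF//.
have := sqr_ge0 (u - v); rewrite expr2 in uv; nra.
Qed.

Lemma sum_powR_le m (t : R) : 2^-1 <= t -> t <= 1 ->
  \sum_(k < m) (k.+1%:R : R) `^ (t - 1) <= 2 * m%:R `^ t.
Proof.
move=> t2 t1; case: m => [|m]; first by rewrite big_ord0 mulr_ge0 ?powR_ge0.
apply: (@le_trans _ _ (\sum_(k < m.+1) m.+1%:R `^ (t - 2^-1) * (Num.sqrt (k.+1%:R : R))^-1)).
  apply: ler_sum => k _.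
  have -> : t - 1 = (t - 2^-1) - 2^-1 by lra.
  rewrite powRB ?pnatr_eq0 ?implybT// powR12_sqrt//.
  apply: ler_wpM2r; first by rewrite invr_ge0 sqrtr_ge0.
  by apply: ge0_ler_powR; rewrite ?nnegrE ?ler_nat//; lra.
rewrite -mulr_sumr; apply: (le_trans (ler_wpM2l _ (sum_inv_sqrt m.+1))).
  exact: powR_ge0.
rewrite mulrCA -powR12_sqrt// -powRD ?subrK//.
by apply/implyP => _; rewrite pnatr_eq0.
Qed.

Lemma sum_inv_le m : (0 < m)%N -> \sum_(k < m) (k.+1%:R : R)^-1 <= 1 + ln m%:R.
Proof.
case: m => // m _; elim: m => [|m IH]; first by rewrite big_ord1 ln1 invr1 addr0.
rewrite big_ord_recr /=; apply: (le_trans (lerD IH (lexx _))).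
rewrite -addrA lerD2l; set x : R := m.+2%:R^-1.
have x0 : 0 < x by rewrite invr_gt0.
have x1 : x < 1 by rewrite invf_lt1// ltr1n.
have -> : ln (m.+1%:R : R) = ln m.+2%:R + ln (1 - x).
  rewrite -lnM ?posrE ?subr_gt0//; congr ln; rewrite mulrBr mulr1 divff ?pnatr_eq0//.
  by rewrite -[m.+2]addn1 natrD addrK.
have := @le_ln1Dx R (- x); rewrite ltrN2 => /(_ x1); lra.
Qed.

Lemma sum_noninc_pred n m (P : pred 'I_n) (f : nat -> R) : (0 < m <= n)%N ->
  (#|P| <= m)%N -> (forall k, 0 <= f k) -> (forall k l, (k <= l)%N -> f l <= f k) ->
  \sum_(k < n | P k) f k <= \sum_(k < m) f k + m%:R * f m.-1.
Proof.
move=> /andP[m0 mn] Pm f0 fni; rewrite (bigID (fun k : 'I_n => (k < m)%N)) /=.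
apply: lerD.
  rewrite (big_ord_widen n f mn) big_mkcond [X in _ <= X]big_mkcond.
  by apply: ler_sum => k _; case: (P k); case: (k < m)%N => /=.
apply: (@le_trans _ _ (\sum_(k < n | P k) f m.-1)).
  rewrite big_mkcond [X in _ <= X]big_mkcond; apply: ler_sum => k _.
  case: (P k) => //=; case: ltnP => //= mk.
  by apply: fni; rewrite (leq_trans _ mk)// leq_pred.
rewrite sumr_const -[X in X <= _]mulr_natl; apply: ler_wpM2r; first exact: f0.
by rewrite ler_nat.
Qed.

Lemma sum_powR_pred n m (P : pred 'I_n) (t : R) : (0 < m <= n)%N -> (#|P| <= m)%N ->
  2^-1 <= t -> t <= 1 -> \sum_(k < n | P k) (k.+1%:R : R) `^ (t - 1) <= 3 * m%:R `^ t.
Proof.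
move=> mn Pm t2 t1.
apply: (le_trans (sum_noninc_pred n m P (fun k => k.+1%:R `^ (t - 1)) mn Pm _ _)).
- by move=> k; apply: powR_ge0.
- move=> k l kl; rewrite -(opprB 1 t) !powRN lef_pV2 ?posrE ?powR_gt0//.
  by apply: ge0_ler_powR; rewrite ?nnegrE ?ler_nat ?ltnS//; lra.
have m0 : (0 < m)%N by case/andP: mn.
rewrite prednK// mulr_powRB1//; last by lra.
have := sum_powR_le m t t2 t1; lra.
Qed.

Lemma sum_inv_pred n m (P : pred 'I_n) : (0 < m <= n)%N -> (#|P| <= m)%N ->
  \sum_(k < n | P k) (k.+1%:R : R)^-1 <= 2 + ln m%:R.
Proof.
move=> mn Pm.
apply: (le_trans (sum_noninc_pred n m P (fun k => k.+1%:R^-1) mn Pm _ _)).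
- by move=> k; rewrite invr_ge0.
- by move=> k l kl; rewrite lef_pV2 ?posrE// ler_nat.
have m0 : (0 < m)%N by case/andP: mn.
rewrite prednK// divff; last by rewrite pnatr_eq0 -lt0n.
have := sum_inv_le m m0; lra.
Qed.

Lemma rearrangement n (A w : nat -> R) (tau : {perm 'I_n}) :
  (forall k l, (k <= l)%N -> (l < n)%N -> A l <= A k) ->
  (forall k l, (k <= l)%N -> w l <= w k) -> (forall k, 0 <= w k) ->
  \sum_(k < n) A (tau k) * w k <= \sum_(k < n) A k * w k.
Proof.
move=> Ani wni w0.
pose W k := if (k < n)%N then w k else 0.
have Wni k : W k.+1 <= W k.
  rewrite /W; case: ifP => [kn|_]; last by case: ifP => // _; apply: w0.
  by rewrite (ltnW kn); apply: wni.
have Wsum (k : 'I_n) : w k = \sum_(j < n | (k <= j)%N) (W j - W j.+1).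
  transitivity (\sum_(k <= j < n) (W j - W j.+1)); last by rewrite big_geq_mkord.
  have -> : \sum_(k <= j < n) (W j - W j.+1) = - \sum_(k <= j < n) (W j.+1 - W j).
    by rewrite -sumrN; apply: eq_bigr => j _; rewrite opprB.
  rewrite telescope_sumr; last exact/ltnW.
  by rewrite opprB /W ltn_ord ltnn subr0.
have Abel (B : 'I_n -> R) : \sum_(k < n) B k * w k =
    \sum_(j < n) (W j - W j.+1) * \sum_(k < n | (k <= j)%N) B k.
  under eq_bigr do rewrite Wsum mulr_sumr.
  rewrite (exchange_big_dep xpredT) //=; apply: eq_bigr => j _.
  by rewrite mulr_sumr; apply: eq_bigr => k _; rewrite mulrC.
rewrite !Abel; apply: ler_sum => j _; apply: ler_wpM2l; first by rewrite subr_ge0.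
have key : \sum_(k < n | (k <= j)%N) (A (tau k) - A j) <=
           \sum_(k < n | (k <= j)%N) (A k - A j).
  apply: (@le_trans _ _ (\sum_(k < n) Num.max 0 (A (tau k) - A j))).
    rewrite big_mkcond; apply: ler_sum => k _; case: ifP => _; rewrite le_max lexx//.
    by rewrite orbT.
  have -> : \sum_(k < n) Num.max 0 (A (tau k) - A j) = \sum_(k < n) Num.max 0 (A k - A j).
    by rewrite [RHS](reindex_inj (@perm_inj _ tau)).
  rewrite [X in _ <= X]big_mkcond; apply: ler_sum => k _.
  case: leqP => kj; rewrite ge_max ?lexx /=.
    by rewrite subr_ge0 andbT; apply: Ani.
  by rewrite subr_le0; apply: Ani => //; apply: ltnW.
by move: key; rewrite !sumrB lerD2r.
Qed.

End Weights.

Section Lorentz.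
Context {R : realType} {r s : R}.
Hypotheses (s1 : 1 <= s) (sr : s <= r) (r2 : r <= 2).
Let r0 : 0 < r. Proof. by move: s1 sr => ? ?; lra. Qed.
Let s0 : 0 < s. Proof. by move: s1 sr => ? ?; lra. Qed.
Let sr_half : 2^-1 <= s / r.
Proof. by rewrite ler_pdivlMr//; move: s1 sr r2 => ? ? ?; lra. Qed.
Let sr_le1 : s / r <= 1.
Proof. by rewrite ler_pdivrMr// mul1r. Qed.

Definition lorentz_weight (k : nat) : R := k.+1%:R `^ (s / r - 1).

Lemma lorentz_weight_gt0 k : 0 < lorentz_weight k.
Proof. exact: powR_gt0. Qed.

Lemma lorentz_weight_noninc k l : (k <= l)%N -> lorentz_weight l <= lorentz_weight k.
Proof.
move=> kl; rewrite /lorentz_weight -(opprB 1 (s / r)) !powRN.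
rewrite lef_pV2 ?posrE ?powR_gt0//.
by apply: ge0_ler_powR; rewrite ?nnegrE ?ler_nat ?ltnS// subr_ge0.
Qed.

Lemma drearr_perm n (z : 'I_n -> R[i]) : exists sigma : {perm 'I_n},
  forall k : 'I_n, nth 0 (drearr z) k = cabs (z (sigma k)).
Proof.
pose t := [tuple cabs (z i) | i < n].
have /tuple_permP [p Hp] : perm_eq (drearr z) t.
  by rewrite /drearr perm_sort.
exists p => k; rewrite Hp -tnth_nth !tnth_mktuple //.
Qed.

Lemma drearr_noninc n (z : 'I_n -> R[i]) k l : (k <= l)%N -> (l < n)%N ->
  nth 0 (drearr z) l <= nth 0 (drearr z) k.
Proof.
move=> kl ln.
have trans : transitive (fun x y : R => y <= x) by move=> y x w xy yw; apply: le_trans xy.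
have sz : size (drearr z) = n by rewrite size_sort size_map size_enum_ord.
apply: (sorted_leq_nth trans (fun x => lexx x) 0 _ k l) => //; rewrite ?inE ?sz//.
- by apply: sort_sorted => x y; apply: le_total.
- exact: leq_ltn_trans ln.
Qed.

Lemma lorentz_ball_sorted n (z : 'I_n -> R[i]) : lorentz_ball r s z <->
  \sum_(k < n) nth 0 (drearr z) k `^ s * lorentz_weight k <= 1.
Proof.
rewrite /lorentz_ball /lorentz_norm /=; set S := \sum_(k < n) _.
have S0 : 0 <= S by apply: sumr_ge0 => k _; rewrite mulr_ge0 ?powR_ge0.
have si0 : 0 < s^-1 by rewrite invr_gt0.
by split=> h; [exact: powR_le1_inv h | exact/powR_le1/h/ltW].
Qed.

Lemma lorentz_ballP n (z : 'I_n -> R[i]) : lorentz_ball r s z <->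
  forall sigma : {perm 'I_n},
    \sum_(k < n) cabs (z (sigma k)) `^ s * lorentz_weight k <= 1.
Proof.
have [p Hp] := drearr_perm n z; split.
  move=> /lorentz_ball_sorted h tau; apply: le_trans h.
  rewrite (eq_bigr (fun k : 'I_n =>
      nth 0 (drearr z) ((tau * p^-1)%g k) `^ s * lorentz_weight k)); last first.
    by move=> k _; rewrite Hp permM permKV.
  apply: (rearrangement n (fun k => nth 0 (drearr z) k `^ s)).
  - move=> k l kl ln; apply: ge0_ler_powR; rewrite ?nnegrE ?(ltW s0)//.
    + by rewrite (Hp (Ordinal ln)) cabs_ge0.
    + by rewrite (Hp (Ordinal (leq_ltn_trans kl ln))) cabs_ge0.
    + exact: drearr_noninc.
  - exact: lorentz_weight_noninc.
  - by move=> k; rewrite ltW// lorentz_weight_gt0.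
move=> h; apply/lorentz_ball_sorted; apply: le_trans (h p).
by apply: ler_sum => k _; rewrite Hp.
Qed.

Lemma lorentz_ball_mono n (y z : 'I_n -> R[i]) :
  (forall i, cabs (y i) <= cabs (z i)) -> lorentz_ball r s z -> lorentz_ball r s y.
Proof.
move=> yz /lorentz_ballP h; apply/lorentz_ballP => p; apply: le_trans (h p).
apply: ler_sum => k _; apply: ler_wpM2r; first by rewrite ltW// lorentz_weight_gt0.
by apply: ge0_ler_powR; rewrite ?nnegrE ?cabs_ge0 ?(ltW s0).
Qed.

Lemma lorentz_ball_lr n (z : 'I_n -> R[i]) : lorentz_ball r s z ->
  \sum_i cabs (z i) `^ r <= 1.
Proof.
move=> /lorentz_ball_sorted h; have [p Hp] := drearr_perm n z.
rewrite (reindex_inj (@perm_inj _ p)) /=.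
under eq_bigr do rewrite -Hp.
set a := nth 0 (drearr z) in h *; apply: le_trans (h); apply: ler_sum => k _.
have a0 (j : 'I_n) : 0 <= a j by rewrite /a Hp cabs_ge0.
have -> : r = s + (r - s) by rewrite addrC subrK.
rewrite powRD; last by rewrite addrC subrK gt_eqF.
apply: ler_wpM2l; first exact: powR_ge0.
rewrite /lorentz_weight.
have K : a k `^ s * k.+1%:R `^ (s / r) <= 1.
  apply: le_trans h.
  apply: (@le_trans _ _ (\sum_(j < n | (j <= k)%N) a k `^ s * lorentz_weight k)).
    rewrite sumr_const.
    have -> : #|[pred i : 'I_n | (i <= k)%N]| = k.+1.
      rewrite -sum1_card -[RHS]card_ord -[RHS]sum1_card.
      by rewrite (big_ord_widen n (fun=> 1%N) (ltn_ord k)).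
    rewrite -[X in _ <= X]mulr_natl mulrCA /lorentz_weight.
    by rewrite mulr_powRB1// divr_gt0.
  rewrite big_mkcond; apply: ler_sum => j _; case: ifP => jk; last first.
    by rewrite mulr_ge0 ?powR_ge0// ltW// lorentz_weight_gt0.
  apply: ler_pM; rewrite ?powR_ge0 ?(ltW (lorentz_weight_gt0 _))//.
    apply: ge0_ler_powR; rewrite ?nnegrE ?(ltW s0) ?a0//; exact: drearr_noninc.
  exact: lorentz_weight_noninc.
have : (a k `^ s * k.+1%:R `^ (s / r)) `^ ((r - s) / s) <= 1 `^ ((r - s) / s).
  apply: ge0_ler_powR; rewrite ?nnegrE ?mulr_ge0 ?powR_ge0//.
    by rewrite subr_ge0.
  by rewrite invr_ge0 ltW.
rewrite powR1 powRM ?powR_ge0// -!powRrM.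
have -> : s * ((r - s) / s) = r - s by rewrite mulrCA divff ?gt_eqF// mulr1.
have -> : s / r * ((r - s) / s) = 1 - s / r.
  by field; rewrite !gt_eqF.
rewrite -ler_pdivlMr ?powR_gt0// mul1r -powRN opprB//.
Qed.

Lemma lorentz_ball_le1 n (z : 'I_n -> R[i]) i : lorentz_ball r s z -> cabs (z i) <= 1.
Proof.
move=> /lorentz_ball_lr h; have : cabs (z i) `^ r <= 1.
  apply: le_trans h; rewrite (bigD1 i) //= lerDl sumr_ge0// => j _; exact: powR_ge0.
by apply: powR_le1_inv; rewrite ?cabs_ge0.
Qed.

Definition ball_const (n : nat) : R := n%:R `^ (- r^-1) / 3.

Lemma ball_const_gt0 n : (0 < n)%N -> 0 < ball_const n.
Proof. by move=> n0; rewrite divr_gt0// powR_gt0// ltr0n. Qed.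

Lemma ball_constP n : (0 < n)%N ->
  @lorentz_ball R r s n (fun=> (ball_const n)%:C%C).
Proof.
move=> n0; apply/lorentz_ballP => p; rewrite -mulr_sumr cabs_real.
rewrite ger0_norm ?(ltW (ball_const_gt0 _ n0))//.
have n0' : 0 < n%:R :> R by rewrite ltr0n.
have := sum_powR_pred n n xpredT (s / r) _ _ sr_half sr_le1.
rewrite n0 leqnn card_ord leqnn => /(_ isT isT) h.
apply: (le_trans (ler_wpM2l (powR_ge0 _ _) h)).
rewrite /ball_const powRM ?powR_ge0// -powRrM.
have e : n%:R `^ (- r^-1 * s) * n%:R `^ (s / r) = 1 :> R.
  have -> : - r^-1 * s = - (s / r) by rewrite mulNr mulrC.
  by rewrite powRN mulVf// gt_eqF// powR_gt0.
have le3 : (3^-1 : R) `^ s <= 3^-1 by apply: ge1r_powR => //; rewrite invr_gt0 ltr0n invf_le1// ler1n.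
by rewrite [3 * _]mulrC mulrACA e mul1r -ler_pdivlMr// mul1r.
Qed.

End Lorentz.
(** * Test points *)

Lemma fact_le_expn g : (g.+1`! <= 2 ^ g.+1 * g ^ g)%N.
Proof.
have h k : (k <= g -> k`! <= g ^ k)%N.
  elim: k => // k IH kg; rewrite factS expnS leq_mul// IH//; exact: ltnW.
rewrite factS leq_mul ?h//; exact/ltnW/ltn_expl.
Qed.

Section TestPoint.
Context {R : realType} {r s : R}.
Hypotheses (s1 : 1 <= s) (sr : s <= r) (r2 : r <= 2).
Let r0 : 0 < r. Proof. by move: s1 sr => ? ?; lra. Qed.
Let s0 : 0 < s. Proof. by move: s1 => ?; lra. Qed.
Let ri0 : 0 < r^-1. Proof. by rewrite invr_gt0. Qed.
Let sr_half : 2^-1 <= s / r.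
Proof. by rewrite ler_pdivlMr//; move: s1 sr r2 => ? ? ?; lra. Qed.
Let sr_le1 : s / r <= 1.
Proof. by rewrite ler_pdivrMr// mul1r. Qed.

Definition logfactor (r s : R) (m : nat) : R := (2 + ln m%:R) `^ (s^-1 - r^-1).

Definition test_point (r s : R) (m : nat) {n d} (b : mi n d) (i : 'I_n) : R :=
  if (0 < b i)%N then
    m%:R `^ (- r^-1) * Num.max 1 ((b i).-1%:R `^ r^-1 / logfactor r s m)
  else 0.

Definition test_weight (r s : R) (m : nat) {n d} (b : mi n d) : R :=
  logfactor r s m ^+ mexc b * (m%:R ^+ mdeg b / (mfact b)%:R) `^ r^-1.

Section Fixed.
Variables (n d m : nat) (b : mi n d).
Hypotheses (m0 : (0 < m)%N) (mn : (m <= n)%N) (bm : (mdeg b <= m)%N).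
Let Lam := logfactor r s m.

Let lnm0 : 0 <= ln (m%:R : R). Proof. by rewrite ln_ge0// ler1n. Qed.

Lemma logfactor_gt0 : 0 < Lam.
Proof. by apply: powR_gt0; have := lnm0; lra. Qed.

Lemma test_point_ge0 i : 0 <= test_point r s m b i.
Proof.
by rewrite /test_point; case: ifP => // _; rewrite mulr_ge0 ?powR_ge0// le_max ler01.
Qed.

Lemma test_weight_gt0 : 0 < test_weight r s m b.
Proof.
rewrite mulr_gt0 ?exprn_gt0 ?logfactor_gt0// powR_gt0// divr_gt0 ?exprn_gt0//.
  by rewrite ltr0n.
by rewrite ltr0n mfact_gt0.
Qed.

Lemma test_point_sum (sigma : {perm 'I_n}) :
  \sum_(k < n) test_point r s m b (sigma k) `^ s * lorentz_weight (r := r) (s := s) k <= 4.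
Proof.
pose P : pred 'I_n := fun k => (0 < b (sigma k))%N.
have Pm : (#|P| <= m)%N.
  apply: leq_trans bm; rewrite -sum1_card /mdeg.
  rewrite [X in (_ <= X)%N](reindex_inj (@perm_inj _ sigma)) /= big_mkcond /=.
  by apply: leq_sum => k _; rewrite unfold_in /P; case: ifP.
have mm : (0 < m <= n)%N by rewrite m0.
have L0 := logfactor_gt0.
pose g k : R := (b (sigma k)).-1%:R.
have g0 k : 0 <= g k by [].
pose M : R := m%:R `^ (- (s / r)).
apply: (@le_trans _ _ (M * (\sum_(k < n | P k) k.+1%:R `^ (s / r - 1) +
   Lam `^ (- s) * \sum_(k < n | P k) g k `^ (s / r) * (k.+1%:R^-1) `^ (1 - s / r)))).
  rewrite [X in _ * (_ + X)]mulr_sumr -big_split mulr_sumr [X in _ <= X]big_mkcond /=.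
  apply: ler_sum => k _; rewrite /test_point -/(P k); case: ifP => Pk; last first.
    by rewrite powR0 ?mul0r// gt_eqF.
  have -> : (k.+1%:R^-1 : R) `^ (1 - s / r) = k.+1%:R `^ (s / r - 1).
    by rewrite -powR_inv1// -powRrM mulN1r opprB.
  rewrite powRM ?powR_ge0 ?le_max ?ler01// -powRrM -/(g k).
  have -> : - r^-1 * s = - (s / r) by rewrite mulNr mulrC.
  rewrite -/M -mulrA; apply: ler_wpM2l; first exact: powR_ge0.
  rewrite mulrA -[X in _ <= X + _]mul1r -mulrDl.
  apply: ler_wpM2r; first exact: powR_ge0.
  have -> : Lam `^ (- s) * g k `^ (s / r) = (g k `^ r^-1 / Lam) `^ s.
    have Li0 : 0 <= Lam^-1 by rewrite invr_ge0; exact: ltW.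
    rewrite (@powRM _ _ _ s (powR_ge0 _ _) Li0) (invr_powR Lam s (ltW L0)) [LHS]mulrC.
    congr (_ * _).
    by rewrite -[RHS]powRrM [r^-1 * s]mulrC.
  rewrite maxEge; case: ifP => _; first by rewrite powR1 lerDl powR_ge0.
  by rewrite lerDr.
have M0 : 0 < m%:R `^ (s / r) :> R by rewrite powR_gt0// ltr0n.
rewrite /M powRN mulrC ler_pdivrMr// [4](_ : _ = 3 + 1 :> R); last by ring.
rewrite mulrDl mul1r; apply: lerD; first exact: sum_powR_pred.
rewrite powRN mulrC ler_pdivrMr; last exact: powR_gt0.
have h := holder_sum P g (fun k : 'I_n => k.+1%:R^-1) (s / r) g0.
apply: (le_trans (h _ _)).
- by move=> k; rewrite invr_ge0.
- by rewrite sr_le1 andbT; apply: le_trans sr_half; rewrite invr_ge0.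
apply: ler_pM; rewrite ?powR_ge0//.
  apply: ge0_ler_powR; rewrite ?nnegrE ?sumr_ge0// ?divr_ge0 ?(ltW s0) ?(ltW r0)//.
  rewrite -natr_sum ler_nat; apply: leq_trans bm; rewrite /mdeg.
  rewrite [X in (_ <= X)%N](reindex_inj (@perm_inj _ sigma)) /= big_mkcond /=.
  by apply: leq_sum => k _; case: ifP => // _; apply: leq_pred.
have -> : Lam `^ s = (2 + ln m%:R) `^ (1 - s / r).
  rewrite /Lam /logfactor -powRrM mulrBl mulVf ?gt_eqF//.
  by rewrite [r^-1 * s]mulrC.
apply: ge0_ler_powR; rewrite ?nnegrE ?subr_ge0//.
- by apply: sumr_ge0 => k _; rewrite invr_ge0.
- by rewrite addr_ge0.
- exact: sum_inv_pred.
Qed.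

Lemma test_point_ball (u w : 'I_n -> R[i]) : lorentz_ball r s w ->
  (forall i, (0 < b i)%N -> cabs (u i) <= test_point r s m b i / 5) ->
  (forall i, b i = 0%N :> nat -> cabs (u i) <= cabs (w i) / 5) ->
  lorentz_ball r s u.
Proof.
move=> /(lorentz_ballP s1 sr) hw hb hw'; apply/(lorentz_ballP s1 sr) => p.
apply: (@le_trans _ _ (5^-1 `^ s * (\sum_(k < n) test_point r s m b (p k) `^ s *
   lorentz_weight (r := r) (s := s) k +
   \sum_(k < n) cabs (w (p k)) `^ s * lorentz_weight (r := r) (s := s) k))).
  rewrite -big_split mulr_sumr; apply: ler_sum => k _ /=.
  rewrite -mulrDl mulrA; apply: ler_wpM2r; first exact/ltW/lorentz_weight_gt0.
  have H (x : R) : 0 <= x -> cabs (u (p k)) <= x / 5 ->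
      cabs (u (p k)) `^ s <= 5^-1 `^ s * x `^ s.
    move=> x0 ux; rewrite mulrC -powRM// ; apply: ge0_ler_powR;
      by rewrite ?nnegrE ?cabs_ge0 ?divr_ge0 ?(ltW s0).
  have [b0|b0] := posnP (b (p k)).
    apply: (le_trans (H _ (cabs_ge0 _) (hw' _ b0))).
    by apply: ler_wpM2l; rewrite ?powR_ge0// lerDr powR_ge0.
  apply: (le_trans (H _ (test_point_ge0 _) (hb _ b0))).
  by apply: ler_wpM2l; rewrite ?powR_ge0// lerDl powR_ge0.
have h5 : (5^-1 : R) `^ s <= 5^-1.
  by apply: ge1r_powR => //; rewrite invr_gt0 ltr0n invf_le1// ler1n.
apply: (@le_trans _ _ (5^-1 * (4 + 1))); last by lra.
apply: ler_pM; rewrite ?powR_ge0 ?addr_ge0//.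
- by apply: sumr_ge0 => k _; rewrite mulr_ge0 ?powR_ge0.
- by apply: sumr_ge0 => k _; rewrite mulr_ge0 ?powR_ge0.
- by apply: lerD; [exact: test_point_sum | exact: hw].
Qed.

Lemma test_point_mon :
  1 <= 10 ^+ m * test_weight r s m b * mon (fun i => test_point r s m b i / 5) b.
Proof.
have L0 := logfactor_gt0.
have m0' : 0 < m%:R :> R by rewrite ltr0n.
pose f i : R := 10 ^+ b i * (Lam ^+ (b i).-1 * (m%:R ^+ b i / (b i)`!%:R) `^ r^-1) *
  (test_point r s m b i / 5) ^+ b i.
have -> : 10 ^+ m * test_weight r s m b * mon (fun i => test_point r s m b i / 5) b =
    10 ^+ (m - mdeg b) * \prod_i f i.
  rewrite !big_split /= -prod_powR => [|i]; last by rewrite divr_ge0 ?exprn_ge0.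
  rewrite big_split /= !prodrXr prodfV -natr_prod -/(mdeg b) -/(mexc b) -/(mfact b).
  by rewrite !mulrA -exprD subnK.
apply: mulr_ege1; first by rewrite exprn_ege1// ler1n.
suff f1 i : 1 <= f i.
  by elim/big_ind: _ => // x y x1 y1; apply: mulr_ege1.
rewrite /f /test_point; case: (nat_of_ord (b i)) => [|g] /=.
  by rewrite !expr0 fact0 divr1 powR1 !mulr1.
set X := Num.max 1 _; set M : R := m%:R `^ (- r^-1).
have X1 : 1 <= X by rewrite le_max lexx.
have Xg : g%:R `^ r^-1 / Lam <= X by rewrite le_max lexx orbT.
have Me : (m%:R ^+ g.+1) `^ r^-1 * M ^+ g.+1 = 1.
  rewrite exprn_powR ?(ltW m0')// -exprMn /M powRN mulfV ?expr1n//.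
  by rewrite gt_eqF// powR_gt0.
have -> : 10 ^+ g.+1 * (Lam ^+ g * (m%:R ^+ g.+1 / (g.+1)`!%:R) `^ r^-1) *
    (M * X / 5) ^+ g.+1 =
    2 ^+ g.+1 * X * (Lam * X) ^+ g * ((g.+1)`!%:R^-1) `^ r^-1 *
    ((m%:R ^+ g.+1) `^ r^-1 * M ^+ g.+1).
  rewrite powRM ?exprn_ge0 ?invr_ge0 ?(ltW m0')//.
  have -> : 10 ^+ g.+1 = 2 ^+ g.+1 * 5 ^+ g.+1 :> R.
    by rewrite -exprMn; congr (_ ^+ _); ring.
  rewrite 2![in LHS]exprMn exprVn [X ^+ g.+1]exprS [(Lam * X) ^+ g]exprMn.
  have : 5 ^+ g.+1 != 0 :> R by rewrite expf_neq0// pnatr_eq0.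
  move: (5 ^+ g.+1) (2 ^+ g.+1) (_ `^ _) (_ `^ _) (M ^+ _) => v5 *; field.
  done.
rewrite Me mulr1.
apply: (@le_trans _ _ (2 ^+ g.+1 * (g%:R `^ r^-1) ^+ g * ((g.+1)`!%:R^-1) `^ r^-1)); last first.
  apply: ler_wpM2r; first exact: powR_ge0.
  rewrite -mulrA; apply: ler_wpM2l; first exact: exprn_ge0.
  rewrite -[X in X <= _]mul1r; apply: ler_pM; rewrite ?exprn_ge0 ?powR_ge0//.
  apply: lerXn2r; rewrite ?nnegrE ?powR_ge0 ?mulr_ge0 ?(ltW L0)//.
    by apply: le_trans X1.
  by rewrite mulrC -ler_pdivrMr.
rewrite -exprn_powR//.
apply: (@le_trans _ _ ((2 ^+ g.+1 * g%:R ^+ g / (g.+1)`!%:R) `^ r^-1)).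
  have : 1 `^ r^-1 <= (2 ^+ g.+1 * g%:R ^+ g / (g.+1)`!%:R : R) `^ r^-1; last by rewrite powR1.
  apply: ge0_ler_powR; rewrite ?nnegrE ?divr_ge0 ?mulr_ge0 ?exprn_ge0 ?(ltW ri0)//.
  rewrite ler_pdivlMr ?ltr0n ?fact_gt0// mul1r -!natrX -natrM ler_nat.
  exact: fact_le_expn.
rewrite !powRM ?mulr_ge0 ?exprn_ge0 ?invr_ge0//.
apply: ler_wpM2r; first exact: powR_ge0.
apply: ler_wpM2r; first exact: powR_ge0.
apply: ler1_powR; first by rewrite exprn_ege1// ler1n.
by rewrite invf_le1//; apply: le_trans sr.
Qed.

End Fixed.
End TestPoint.
(** * Polynomials on the Lorentz ball *)

Section Pnorm.
Context {R : realType} {r s : R}.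
Hypotheses (s1 : 1 <= s) (sr : s <= r) (r2 : r <= 2).
Context {n d : nat}.
Hypothesis n0 : (0 < n)%N.
Implicit Types (c : coefs R n d) (z : 'I_n -> R[i]) (a b : mi n d).

Lemma pevalE c z : peval c z = \sum_(a : mi n d) c a * mon z a.
Proof. by []. Qed.

Lemma mon_le1 (x : 'I_n -> R) a : (forall i, 0 <= x i <= 1) -> mon x a <= 1.
Proof.
move=> x01; apply: (@le_trans _ _ (\prod_(i < n) 1)); last by rewrite big1.
apply: ler_prod => i _.
by have /andP[x0 x1] := x01 i; rewrite exprn_ge0//= exprn_ile1.
Qed.

Lemma cabs_peval_le c z : lorentz_ball r s z -> cabs (peval c z) <= \sum_a cabs (c a).
Proof.
move=> zB; apply: (le_trans (cabs_sum _ _ _ _)); apply: ler_sum => a _.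
rewrite cabsM ler_piMr ?cabs_ge0// cabs_mon mon_le1// => i.
by rewrite cabs_ge0 (lorentz_ball_le1 s1 sr).
Qed.

Lemma cabs_peval_le_pnorm c z : lorentz_ball r s z -> cabs (peval c z) <= pnorm r s c.
Proof.
move=> zB; apply: ub_le_sup; last by exists z.
by exists (\sum_a cabs (c a)) => _ [w wB <-]; apply: cabs_peval_le.
Qed.

Lemma pnorm_le c M : (forall z, lorentz_ball r s z -> cabs (peval c z) <= M) ->
  pnorm r s c <= M.
Proof.
move=> h; apply: ge_sup => [|_ [w wB <-]]; last exact: h.
by exists (cabs (peval c (fun=> (ball_const (r := r) n)%:C%C))), (fun=> (ball_const (r := r) n)%:C%C) => //;
  exact: (ball_constP s1 sr r2).
Qed.

Lemma pnorm_ge0 c : 0 <= pnorm r s c.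
Proof.
apply: le_trans (cabs_peval_le_pnorm _ _ (ball_constP s1 sr r2 _ n0)).
exact: cabs_ge0.
Qed.

Lemma rotate_mon {I : finType} (k : 'I_n -> I) {N} (zeta : R[i]) (w : {ffun I -> 'I_N})
    z a :
  mon (fun i => z i * zeta ^+ w (k i)) a =
  mon z a * chr zeta w (fun j => \sum_(i | k i == j) a i)%N.
Proof.
rewrite monM; congr (_ * _).
rewrite /mon (partition_big k xpredT) //=; apply: eq_bigr => j _.
rewrite big_distrr /= -prodrXr; apply: eq_bigr => i /eqP ->.
by rewrite exprM.
Qed.

Lemma cauchy_estimate {I : finType} (k : 'I_n -> I) (q : I -> nat) c z :
  lorentz_ball r s z ->
  cabs (\sum_(a : mi n d | [forall j, (\sum_(i | k i == j) a i)%N == q j]) c a * mon z a)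
    <= pnorm r s c.
Proof.
move=> zB.
pose e a (j : I) := (\sum_(i | k i == j) a i)%N.
have [N [N0 eN qN]] : exists N, [/\ (0 < N)%N, forall a j, (e a j < N)%N
    & forall j, (q j < N)%N].
  exists (\sum_(j : I) q j + \sum_(i < n) d).+1; split=> // [a|] j; rewrite ltnS.
    apply: (@leq_trans (\sum_(i < n) d)); last exact: leq_addl.
    rewrite /e big_mkcond; apply: leq_sum => i _; case: ifP => // _.
    by rewrite -ltnS.
  by apply: leq_trans (leq_addr _ _); rewrite (bigD1 j) //= leq_addr.
have [zeta zetaP] := prim_root_exists (R := R) N N0.
apply: (torus_cauchy zeta zetaP e (fun a => c a * mon z a) eN q _ qN) => w.
under eq_bigr do rewrite -mulrA -rotate_mon.
apply: cabs_peval_le_pnorm; apply: lorentz_ball_mono zB => // i.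
by rewrite cabsM cabsX (cabs_prim_root _ _ zetaP) expr1n mulr1.
Qed.

Lemma coef_estimate c z a : lorentz_ball r s z ->
  cabs (c a) * mon (fun i => cabs (z i)) a <= pnorm r s c.
Proof.
move=> zB; have := cauchy_estimate id (fun i => a i) c z zB.
rewrite (big_pred1 a) ?cabsM ?cabs_mon// => b /=.
have e (b' : mi n d) j : (\sum_(i | id i == j) b' i)%N = b' j.
  by rewrite (big_pred1 j) // => i; rewrite /= eq_sym.
apply/forallP/eqP => [h|->] => [|j]; last by rewrite e.
by apply/ffunP => j; apply/val_inj; rewrite /= -(e b); exact/eqP/h.
Qed.

Lemma coef_bound_ex : exists2 M : R, 0 < M &
  forall c a, cabs (c a) <= M * pnorm r s c.
Proof.
pose w a : R := mon (fun=> ball_const (r := r) n) a.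
have b0 := ball_const_gt0 (R := R) (r := r) n n0.
have w0 a : 0 < w a by apply: mon_gt0.
exists (\sum_a (w a)^-1).
  rewrite (bigD1 [ffun=> ord0]) //= ltr_pwDl ?invr_gt0// sumr_ge0// => a _.
  by rewrite invr_ge0 ltW.
move=> c a; have := coef_estimate c (fun=> (ball_const (r := r) n)%:C%C) a (ball_constP s1 sr r2 _ n0).
under [X in mon X _]eq_fun do rewrite cabs_real ger0_norm ?(ltW b0)//.
rewrite -ler_pdivlMr// => /le_trans; apply; rewrite mulrC.
apply: ler_wpM2r; first exact: pnorm_ge0.
by rewrite (bigD1 a) //= lerDl sumr_ge0// => x _; rewrite invr_ge0 ltW.
Qed.

End Pnorm.
(** * Absolute sums of polynomials *)

Section AddOne.
Context {n d : nat}.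
Implicit Types (a b : mi n d) (k : 'I_n).

Definition addk b k : mi n d := [ffun i => inord (b i + (i == k))%N].

Lemma addkE b k i : (mdeg b < d)%N -> addk b k i = (b i + (i == k))%N :> nat.
Proof.
move=> bd; rewrite ffunE inordK//; have : (b i <= mdeg b)%N.
  by rewrite /mdeg (bigD1 i)//= leq_addr.
by case: (i == k); lia.
Qed.

Lemma mon_addk {A : comPzRingType} (x : 'I_n -> A) b k : (mdeg b < d)%N ->
  mon x (addk b k) = mon x b * x k.
Proof.
move=> bd; transitivity (\prod_(i < n) (x i ^+ b i * x i ^+ (i == k))).
  by apply: eq_bigr => i _; rewrite addkE// exprD.
rewrite big_split /=; congr (_ * _); rewrite (bigD1 k)//= eqxx big1 ?mulr1// => i.
by move=> /negPf ->.
Qed.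

Lemma mdeg0 a : mdeg a = 0%N -> a = [ffun=> ord0].
Proof.
move=> /eqP; rewrite sum_nat_eq0 => /forallP h; apply/ffunP => i.
by apply/val_inj; rewrite ffunE; apply/eqP; have := h i.
Qed.

Lemma addk_surj a : (0 < mdeg a <= d)%N ->
  exists b k, (mdeg b < mdeg a)%N /\ addk b k = a.
Proof.
move=> /andP[a0 ad].
have [k ak] : exists k, (0 < a k)%N.
  apply/existsP; move: a0; apply: contraTT => /existsPn h.
  rewrite -eqn0Ngt; apply/eqP/big1 => i _; apply/eqP.
  by have := h i; rewrite lt0n negbK.
pose b : mi n d := [ffun i => inord (a i - (i == k))%N].
have bE i : b i = (a i - (i == k))%N :> nat.
  by rewrite ffunE inordK// ltnS (leq_trans (leq_subr _ _))// -ltnS.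
have ba : (mdeg b).+1 = mdeg a.
  rewrite /mdeg (bigD1 k)//= [RHS](bigD1 k)//= bE eqxx.
  rewrite -addSn subn1 prednK//; congr (_ + _)%N; apply: eq_bigr => i /negPf ik.
  by rewrite bE ik subn0.
exists b, k; split; first by rewrite -ba.
apply/ffunP => i; apply/val_inj; rewrite /= addkE ?bE; last by rewrite ba.
by case: eqP => [->|]; lia.
Qed.

Lemma sum_addk_le {R : realType} (F : mi n d -> R) : (forall a, 0 <= F a) ->
  (forall a, (d < mdeg a)%N -> F a = 0) ->
  \sum_a F a <= F [ffun=> ord0] + \sum_(b : mi n d | (mdeg b < d)%N) \sum_k F (addk b k).
Proof.
move=> F0 Fd; rewrite (bigD1 [ffun=> ord0])//= lerD2l.
have -> : \sum_(b : mi n d | (mdeg b < d)%N) \sum_k F (addk b k) =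
    \sum_a \sum_(b : mi n d | (mdeg b < d)%N) \sum_(k | addk b k == a) F a.
  rewrite [RHS]exchange_big /=; apply: eq_bigr => b _.
  rewrite (exchange_big_dep xpredT)//=; apply: eq_bigr => k _.
  by rewrite (big_pred1 (addk b k))// => a; rewrite /= eq_sym.
rewrite big_mkcond; apply: ler_sum => a _.
have S0 b : 0 <= \sum_(k | addk b k == a) F a by apply: sumr_ge0.
case: ifPn => [a0|_]; last exact: sumr_ge0.
have [ad|ad] := ltnP d (mdeg a); first by rewrite [X in X <= _]Fd//; apply: sumr_ge0.
have [|b [k [ba bk]]] := addk_surj a.
  rewrite ad andbT lt0n; apply: contra a0 => /eqP /mdeg0 ->; exact: eqxx.
rewrite (bigD1 b) /=; last exact: leq_trans ba ad.
rewrite (bigD1 k) /= ?bk//.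
rewrite -addrA lerDl addr_ge0// ?sumr_ge0//.
Qed.

Lemma card_supp_le b : (\sum_(k | 0 < b k) 1 <= mdeg b)%N.
Proof. by rewrite big_mkcond; apply: leq_sum => k _; case: ifP. Qed.

Lemma mexc_le b : (mexc b <= mdeg b)%N.
Proof. by apply: leq_sum => i _; apply: leq_pred. Qed.

End AddOne.

Section AbsoluteSums.
Context {R : realType} {r s : R}.
Hypotheses (s1 : 1 <= s) (sr : s <= r) (r2 : r <= 2).
Context {n m : nat}.
Hypotheses (m0 : (0 < m)%N) (mn : (m <= n)%N).
Let n0 : (0 < n)%N. Proof. exact: leq_trans mn. Qed.
Let m0' : 0 < m%:R :> R. Proof. by rewrite ltr0n. Qed.
Let r1 : 1 <= r. Proof. exact: le_trans sr. Qed.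
Let r0 : 0 < r. Proof. exact: lt_le_trans r1. Qed.
Implicit Types (c : coefs R n m) (z : 'I_n -> R[i]) (a b : mi n m).

Definition cpoint b : 'I_n -> R[i] := fun i => (test_point r s m b i / 5)%:C%C.

Lemma cabs_cpoint b i : cabs (cpoint b i) = test_point r s m b i / 5.
Proof. by rewrite cabs_real ger0_norm// divr_ge0 ?test_point_ge0. Qed.

Let zeroB : lorentz_ball r s (fun=> 0 : R[i]) (n := n).
Proof.
apply: (lorentz_ball_mono s1 sr) (ball_constP s1 sr r2 n n0) => i.
by rewrite cabs0 cabs_ge0.
Qed.

Lemma cpoint_ball b : (mdeg b <= m)%N -> lorentz_ball r s (cpoint b).
Proof.
move=> bm; apply: (test_point_ball s1 sr r2 _ _ _ b m0 mn bm _ (fun=> 0)) => //.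
  by move=> i _; rewrite cabs_cpoint.
by move=> i bi; rewrite cabs_cpoint /test_point bi ltnn cabs0 !mul0r.
Qed.

Lemma coef_test_weight c b : (mdeg b <= m)%N ->
  cabs (c b) <= 10 ^+ m * test_weight r s m b * pnorm r s c.
Proof.
move=> bm; have h := test_point_mon s1 sr _ _ _ b m0 bm.
have := coef_estimate s1 sr c (cpoint b) b (cpoint_ball b bm).
under [X in mon X _]eq_fun do rewrite cabs_cpoint.
set M := mon _ b in h * => cM; set W := 10 ^+ m * _ in h *.
have W0 : 0 <= W by rewrite mulr_ge0 ?exprn_ge0 ?(ltW (test_weight_gt0 _ _ _ b m0 )).
apply: (@le_trans _ _ (cabs (c b) * (W * M))).
  by rewrite ler_peMr ?cabs_ge0.
by rewrite mulrCA; apply: ler_wpM2l.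
Qed.

Lemma sum_test_weight (A : R) z j : 1 <= A ->
  logfactor r s m <= A * (n%:R / m%:R) `^ (1 - r^-1) ->
  lorentz_ball r s z -> (j <= m)%N ->
  \sum_(b : mi n m | (mdeg b <= j)%N) mon (fun i => cabs (z i)) b * test_weight r s m b
  <= (A * (2 * expR 1 ^+ 2)) ^+ m * ((n%:R / m%:R) `^ (1 - r^-1)) ^+ j.
Proof.
move=> A1 hL zB jm; set t := _ `^ _ in hL *.
have := weighted_monomial_sum (d := m) r (n%:R / m%:R) (fun i => cabs (z i)) j m
  r1 (fun i => cabs_ge0 _) (lorentz_ball_lr s1 sr _ z zB) jm.
rewrite ler_pdivlMr// mul1r ler_nat mn mulrCA mulfV ?gt_eqF// mulr1 lexx -/t.
move=> /(_ isT isT) h.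
rewrite exprMn -mulrA; apply: le_trans (ler_wpM2l _ h); last first.
  by rewrite exprn_ge0//; apply: le_trans A1.
rewrite mulr_sumr; apply: ler_sum => b bj; rewrite /test_weight.
rewrite [X in _ <= X]mulrCA; apply: ler_wpM2l.
  by apply: mon_ge0 => i; apply: cabs_ge0.
rewrite mulrA; apply: ler_wpM2r; first exact: powR_ge0.
apply: (@le_trans _ _ ((A * t) ^+ mexc b)).
  apply: lerXn2r => //; rewrite nnegrE ?powR_ge0// mulr_ge0 ?powR_ge0//.
  by apply: le_trans A1.
rewrite exprMn; apply: ler_wpM2r; first by rewrite exprn_ge0 ?powR_ge0.
apply: ler_weXn2l => //; apply: leq_trans (mexc_le b) _; exact: leq_trans jm.
Qed.

Section Shift.
Variables (c : coefs R n m) (z : 'I_n -> R[i]) (b : mi n m).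
Hypotheses (zB : lorentz_ball r s z) (bm : (mdeg b < m)%N).
Let W := 10 ^+ m * test_weight r s m b.
Let W0 : 0 < W.
Proof. by rewrite mulr_gt0 ?exprn_gt0 ?(test_weight_gt0 _ _ _ b m0). Qed.
Let V := mon (fun i => test_point r s m b i / 5) b.
Let WV : 1 <= W * V.
Proof. by apply: (test_point_mon s1 sr _ _ _ b m0); apply: ltnW. Qed.

Lemma shift_in k : (0 < b k)%N -> cabs (c (addk b k)) <= 5 * m%:R * W * pnorm r s c.
Proof.
move=> bk.
have := coef_estimate s1 sr c (cpoint b) (addk b k) (cpoint_ball b (ltnW bm)).
under [X in mon X _]eq_fun do rewrite cabs_cpoint.
rewrite mon_addk// -/V => h.
have uk : 1 <= 5 * m%:R * (test_point r s m b k / 5).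
  rewrite mulrAC mulrCA divff// mulr1 /test_point bk.
  rewrite mulrAC -[X in X <= _](@mulr1 R 1); apply: ler_pM => //; last by rewrite le_max lexx.
  rewrite -{2}(powRr1 (ltW m0')) -powRD; last first.
    by apply/implyP => _; rewrite gt_eqF.
  rewrite -[X in X <= _](powRr0 m%:R); apply: ler_powR; first by rewrite ler1n.
  by rewrite addrC subr_ge0 invf_le1.
have c0 := cabs_ge0 (c (addk b k)).
apply: (@le_trans _ _ (cabs (c (addk b k)) * ((W * V) * (5 * m%:R * (test_point r s m b k / 5))))).
  by rewrite ler_peMr// mulr_ege1.
have -> : cabs (c (addk b k)) * ((W * V) * (5 * m%:R * (test_point r s m b k / 5))) =
  5 * m%:R * W * (cabs (c (addk b k)) * (V * (test_point r s m b k / 5))) by ring.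
by apply: ler_wpM2l => //; apply: mulr_ge0; [apply: mulr_ge0 | exact: ltW].
Qed.

Lemma shift_off : \sum_(k | b k == 0%N :> nat) cabs (c (addk b k)) * cabs (z k) <=
  5 * W * pnorm r s c.
Proof.
have [ph ph1 phE] : exists2 ph : 'I_n -> R[i], forall k, cabs (ph k) = 1 &
    forall k, ph k * c (addk b k) = (cabs (c (addk b k)))%:C%C.
  have H k : {u : R[i] | cabs u = 1 & u * c (addk b k) = (cabs (c (addk b k)))%:C%C}.
    by apply: cid2; apply: phase_exists.
  by exists (fun k => s2val (H k)) => k; case: (H k).
pose u i := if (0 < b i)%N then cpoint b i else ph i * (cabs (z i) / 5)%:C%C.
have uB : lorentz_ball r s u.
  apply: (test_point_ball s1 sr r2 _ _ _ b m0 mn (ltnW bm) _ z) => // i bi.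
    by rewrite /u bi cabs_cpoint.
  by rewrite /u bi ltnn cabsM ph1 mul1r cabs_real ger0_norm// divr_ge0 ?cabs_ge0.
pose kap i : option 'I_n := if (0 < b i)%N then Some i else None.
pose q (j : option 'I_n) : nat := if j is Some i then b i else 1%N.
have := cauchy_estimate s1 sr kap q c u uB.
have kS a i : (\sum_(i' | kap i' == Some i) a i' = if 0 < b i then nat_of_ord (a i) else 0)%N.
  rewrite /kap; case: ifPn => bi.
    rewrite (big_pred1 i)// => i' /=; case: ifP => b'; rewrite ?(inj_eq Some_inj)//.
    by apply/esym/negbTE; apply: contraFN b' => /eqP ->.
  rewrite big_pred0// => i'; case: ifP => // b'; rewrite (inj_eq Some_inj).
  by apply/negbTE; apply: contraNneq bi => <-.
have kN a : (\sum_(i' | kap i' == None) a i' = \sum_(i' | b i' == 0%N :> nat) a i')%N.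
  by apply: eq_bigl => i'; rewrite /kap; case: posnP.
have offE k : b k = 0%N :> nat ->
    (\sum_(i | b i == 0%N :> nat) addk b k i)%N = 1%N.
  move=> bk; rewrite (bigD1 k) /= ?bk// addkE// bk eqxx big1// => i /andP[/eqP bi ik].
  by rewrite addkE// bi (negPf ik).
pose pk a : option 'I_n := [pick i | (b i == 0%N :> nat) && (0 < a i)%N].
have pkE k : b k = 0%N :> nat -> pk (addk b k) = Some k.
  move=> bk; rewrite /pk; case: pickP => [i /andP[/eqP bi]|/(_ k)].
    by rewrite addkE// bi; case: eqP => [->|].
  by rewrite bk addkE// bk !eqxx.
pose k0 : 'I_n := Ordinal n0.
rewrite (reindex_onto (addk b) (fun a => odflt k0 (pk a))) /=; last first.
  move=> a /forallP h.
  have aS i : (0 < b i)%N -> a i = b i :> nat.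
    by move=> bi; have /eqP := h (Some i); rewrite kS bi.
  have /eqP := h None; rewrite kN /= => aN.
  have [k /andP[/eqP bk ak]] : exists k, (b k == 0%N :> nat) && (0 < a k)%N.
    apply/existsP; apply: contraT => /existsPn hk.
    move: aN; rewrite big1// => i bi; have := hk i; rewrite bi /= lt0n negbK.
    by move/eqP.
  have aNk : a k = 1%N :> nat /\ forall i, i != k -> b i = 0%N :> nat -> a i = 0%N :> nat.
    move: aN; rewrite (bigD1 k) /= ?bk// => aN; split; first by lia.
    move=> i ik bi; move: aN; rewrite (bigD1 i) /=; last by rewrite bi ik.
    by lia.
  have ea : addk b k = a.
    apply/ffunP => i; apply/val_inj; rewrite /= addkE//.
    have [->|ik] := eqVneq i k; first by rewrite bk (aNk.1).
    have [bi|bi] := posnP (b i); first by rewrite bi (aNk.2 _ ik bi).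
    by rewrite aS// addn0.
  by rewrite -{1}ea pkE.
rewrite (eq_bigl (fun k : 'I_n => b k == 0%N :> nat)); last first.
  move=> k; have [bk|bk] := posnP (b k).
    rewrite pkE//= eqxx andbT; apply/forallP => -[i|]; last first.
      by rewrite kN offE.
    rewrite kS /q; case: ifPn => bi; last by move: bi; rewrite lt0n negbK eq_sym.
    by rewrite addkE// (_ : i == k = false) ?addn0//; apply: contraTF bi => /eqP ->; rewrite bk.
  apply/negbTE; rewrite negb_and; apply/orP; left.
  apply/forallPn; exists (Some k); rewrite kS bk /q addkE// eqxx; lia.
under eq_bigr => k bk.
  rewrite mon_addk// {2}/u (eqP bk) ltnn mulrCA [c _ * _]mulrA [c _ * ph _]mulrC phE.
  rewrite -rmorphM mulrA.
  over.
rewrite -mulr_sumr -rmorph_sum cabsM cabs_real => h.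
have uV : cabs (mon u b) = V.
  rewrite cabs_mon; apply: eq_bigr => i _; rewrite /u.
  by case: posnP => [->//|_]; rewrite cabs_cpoint.
move: h; rewrite uV -mulr_suml ger0_norm; last first.
  by rewrite mulr_ge0// sumr_ge0// => k _; rewrite mulr_ge0 ?cabs_ge0.
set S := \sum_(k | _) _ => h; have S0 : 0 <= S.
  by rewrite sumr_ge0// => k _; rewrite mulr_ge0 ?cabs_ge0.
apply: (@le_trans _ _ (S * (W * V))); first by rewrite ler_peMr.
have -> : S * (W * V) = 5 * W * (V * (S / 5)) by field.
by apply: ler_wpM2l => //; rewrite mulr_ge0 ?(ltW W0).
Qed.

Lemma shift_sum : \sum_k cabs (c (addk b k)) * cabs (z k) <=
  400 ^+ m * test_weight r s m b * pnorm r s c.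
Proof.
rewrite (bigID (fun k => b k == 0%N :> nat)) /=.
have p0 : 0 <= pnorm r s c by apply: pnorm_ge0.
have h1 : \sum_(k | b k != 0%N :> nat) cabs (c (addk b k)) * cabs (z k) <=
    m%:R * (5 * m%:R * W * pnorm r s c).
  apply: (@le_trans _ _ (\sum_(k | b k != 0%N :> nat) 5 * m%:R * W * pnorm r s c)).
    apply: ler_sum => k bk; rewrite -[X in _ <= X]mulr1; apply: ler_pM; rewrite ?cabs_ge0//.
      by apply: shift_in; rewrite lt0n.
    exact: (lorentz_ball_le1 s1 sr).
  rewrite sumr_const -[X in X <= _]mulr_natl; apply: ler_wpM2r.
    by apply: mulr_ge0 => //; apply: mulr_ge0; [apply: mulr_ge0 | exact: ltW].
  rewrite ler_nat -sum1_card; apply: leq_trans (ltnW bm).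
  apply: leq_trans (card_supp_le b); rewrite leq_eqVlt; apply/orP; left; apply/eqP.
  by apply: eq_bigl => k; rewrite unfold_in lt0n.
apply: (le_trans (lerD shift_off h1)).
have -> : 5 * W * pnorm r s c + m%:R * (5 * m%:R * W * pnorm r s c) =
  (5 * (1 + m%:R * m%:R)) * (W * pnorm r s c) by ring.
have -> : 400 ^+ m * test_weight r s m b * pnorm r s c = 40 ^+ m * (W * pnorm r s c).
  have -> : 400 ^+ m = 40 ^+ m * 10 ^+ m :> R.
    by rewrite -exprMn; congr (_ ^+ _); ring.
  by rewrite /W; ring.
apply: ler_wpM2r; first by apply: mulr_ge0 => //; exact: ltW.
have m2 : m%:R <= 2 ^+ m :> R by rewrite -natrX ler_nat ltnW// ltn_expl.
have p2 : 1 <= 2 ^+ m :> R by rewrite exprn_ege1// ler1n.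
have p10 : 10 <= 10 ^+ m :> R by rewrite -[X in X <= _]expr1 ler_weXn2l// ler1n.
have -> : 40 ^+ m = 10 ^+ m * (2 ^+ m * 2 ^+ m) :> R.
  by rewrite -!exprMn; congr (_ ^+ _); ring.
apply: (@le_trans _ _ (10 * (2 ^+ m * 2 ^+ m))); last by apply: ler_wpM2r => //; nra.
have : m%:R * m%:R <= 2 ^+ m * 2 ^+ m :> R by apply: ler_pM.
have : 1 * 1 <= 2 ^+ m * 2 ^+ m :> R by apply: ler_pM.
by move=> *; lra.
Qed.

End Shift.

Lemma abs_sum_le (A : R) c z : 1 <= A ->
  logfactor r s m <= A * (n%:R / m%:R) `^ (1 - r^-1) ->
  lorentz_ball r s z -> (forall a, (m < mdeg a)%N -> c a = 0) ->
  \sum_a cabs (c a) * mon (fun i => cabs (z i)) a <=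
  (2 * (400 * (A * (2 * expR 1 ^+ 2)))) ^+ m * ((n%:R / m%:R) `^ (1 - r^-1)) ^+ m.-1
    * pnorm r s c.
Proof.
move=> A1 hL zB cm; set t := _ `^ _.
have p0 : 0 <= pnorm r s c by apply: pnorm_ge0.
apply: (le_trans (sum_addk_le _ _ _)).
- by move=> a; rewrite mulr_ge0 ?cabs_ge0 ?mon_ge0// => i; apply: cabs_ge0.
- by move=> a am; rewrite cm// cabs0 mul0r.
set K := 400 ^+ m * ((A * (2 * expR 1 ^+ 2)) ^+ m * t ^+ m.-1).
apply: (@le_trans _ _ (pnorm r s c + K * pnorm r s c)).
  apply: lerD; first exact: coef_estimate.
  have -> : K = 400 ^+ m * ((A * (2 * expR 1 ^+ 2)) ^+ m * t ^+ m.-1) by [].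
  have := sum_test_weight A z m.-1 A1 hL zB (leq_pred m).
  set S := \sum_(b | _) _ => hS.
  apply: (@le_trans _ _ (400 ^+ m * S * pnorm r s c)); last first.
    apply: ler_wpM2r; first exact: p0.
    apply: ler_wpM2l hS; apply: exprn_ge0; exact: ler0n.
  rewrite /S mulr_sumr mulr_suml [X in X <= _](eq_bigl (fun b => (mdeg b <= m.-1)%N)); last first.
    by move=> b; rewrite -[RHS]ltnS prednK.
  apply: ler_sum => b bm; have bm' : (mdeg b < m)%N by rewrite -ltnS prednK in bm.
  under eq_bigr => k _ do rewrite mon_addk// mulrCA.
  rewrite -mulr_sumr.
  apply: (le_trans (ler_wpM2l _ (shift_sum c z b zB bm'))).
    by apply: mon_ge0 => i; apply: cabs_ge0.
  by rewrite le_eqVlt; apply/orP; left; apply/eqP; ring.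
have e1 : 1 <= expR (1 : R) by rewrite ltW// expR_gt1.
have K1 : 1 <= K.
  rewrite /K !mulr_ege1// exprn_ege1//.
  - by rewrite ler1n.
  - by rewrite !mulr_ege1 ?exprn_ege1// ler1n.
  - rewrite -(powRr0 (n%:R / m%:R)); apply: ler_powR.
      by rewrite ler_pdivlMr// mul1r ler_nat.
    by rewrite subr_ge0 invf_le1.
have -> : (2 * (400 * (A * (2 * expR 1 ^+ 2)))) ^+ m * t ^+ m.-1 * pnorm r s c =
    2 ^+ m * K * pnorm r s c by rewrite /K !exprMn; ring.
rewrite -[X in X + _]mul1r -mulrDl; apply: ler_wpM2r => //.
have : 2 <= 2 ^+ m :> R by rewrite -[X in X <= _]expr1 ler_weXn2l// ler1n.
by move=> h2; nra.
Qed.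

End AbsoluteSums.
(** * The complex Hahn-Banach theorem *)

Section HahnBanach.
Context {R : realType} {E : lmodType R[i]}.
Variable p : E -> R.
Hypotheses (pD : forall x y, p (x + y) <= p x + p y)
  (pZ : forall (a : R[i]) x, p (a *: x) = cabs a * p x).
Implicit Types (H : set (E * R)).

(* Graphs of partial real-linear functionals dominated by p; domination at 0
   makes such a graph single-valued. *)
Let dominated H := [/\ forall x y s t, H (x, s) -> H (y, t) -> H (x + y, s + t),
  forall (a : R) x s, H (x, s) -> H (a%:C%C *: x, a * s) &
  forall x s, H (x, s) -> s <= p x].

Let p0 : p 0 = 0.
Proof. by rewrite -(scale0r 0) pZ cabs0 mul0r. Qed.

Let dominated_fun H x s t : dominated H -> H (x, s) -> H (x, t) -> s = t.
Proof.
move=> [HD HZ Hp]; suff half u v : H (x, u) -> H (x, v) -> u <= v.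
  by move=> h1 h2; apply/le_anti; rewrite !half.
move=> hu hv; have := HD _ _ _ _ hu (HZ (-1) _ _ hv).
rewrite rmorphN rmorph1 scaleN1r subrr mulN1r => /Hp.
by rewrite p0 subr_le0.
Qed.

Let pN x : p (- x) = p x.
Proof. by rewrite -scaleN1r pZ cabsN cabs1 mul1r. Qed.

Let dominated_extend H x0 : dominated H -> H (0, 0) -> exists c : R,
  dominated [set z | exists y t (a : R), [/\ H (y, t), z.1 = y + a%:C%C *: x0 &
    z.2 = t + a * c]].
Proof.
move=> [HD HZ Hp] H0.
pose L := [set u | exists y t, H (y, t) /\ u = t - p (y - x0)].
have L_ub y t : H (y, t) -> ubound L (p (y + x0) - t).
  move=> hy _ [y' [t' [hy' ->]]]; rewrite lerBlDr addrAC lerBrDr.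
  apply: (le_trans (Hp _ _ (HD _ _ _ _ hy' hy))).
  by have := pD (y + x0) (y' - x0); rewrite addrACA subrr addr0 addrC.
have L_sup : has_sup L.
  by split; [exists (0 - p (0 - x0)), 0, 0 | exists (p (0 + x0) - 0); apply: L_ub].
exists (sup L); have cu y t : H (y, t) -> t + sup L <= p (y + x0).
  move=> hy; rewrite addrC -lerBrDr; apply: ge_sup (L_ub _ _ hy); exact: (L_sup.1).
have cl y t : H (y, t) -> t - sup L <= p (y - x0).
  move=> hy; rewrite lerBlDr addrC -lerBlDr; apply: ub_le_sup; first exact: (L_sup.2).
  by exists y, t.
split.
- move=> _ _ _ _ [y [t [a [hy /= -> ->]]]] [y' [t' [a' [hy' /= -> ->]]]].
  exists (y + y'), (t + t'), (a + a'); split=> /=; first exact: HD.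
  + by rewrite rmorphD scalerDl addrACA.
  + by rewrite mulrDl addrACA.
- move=> b _ _ [y [t [a [hy /= -> ->]]]]; exists (b%:C%C *: y), (b * t), (b * a).
  split=> /=; first exact: HZ.
  + by rewrite rmorphM scalerDr scalerA.
  + by rewrite mulrDr mulrA.
- move=> _ _ [y [t [a [hy /= -> ->]]]] /=.
  have [a0|a0|->] := ltgtP a 0; last by rewrite mul0r rmorph0 scale0r !addr0 Hp.
  + have b0 : 0 < - a by rewrite oppr_gt0.
    have := cl _ _ (HZ (- a)^-1 _ _ hy).
    rewrite -(ler_pM2l b0) mulrBr mulrA divff ?gt_eqF// mul1r mulNr opprK.
    move=> /le_trans; apply; rewrite -{1}[- a]gtr0_norm// -cabs_real -pZ scalerBr scalerA.
    by rewrite -rmorphM divff ?gt_eqF// scale1r rmorphN scaleNr opprK.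
  + have := cu _ _ (HZ a^-1 _ _ hy).
    rewrite -(ler_pM2l a0) mulrDr mulrA divff ?gt_eqF// mul1r.
    move=> /le_trans; apply; rewrite -{1}[a]gtr0_norm// -cabs_real -pZ scalerDr scalerA.
    by rewrite -rmorphM divff ?gt_eqF// scale1r.
Qed.

Let real_extension H0 : dominated H0 -> H0 (0, 0) ->
  exists U : E -> R, [/\ forall x y, U (x + y) = U x + U y,
    forall (a : R) x, U (a%:C%C *: x) = a * U x,
    forall x, U x <= p x & forall x s, H0 (x, s) -> U x = s].
Proof.
move=> dom0 H00.
pose P := [set A : set (E * R) | dominated (A `|` H0)].
have [F FP Ftot|A [PA Amax]] := @Zorn_bigcup _ P.
  have lift x y : (\bigcup_(X in F) X `|` H0) x -> (\bigcup_(X in F) X `|` H0) y ->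
      exists X, [/\ dominated (X `|` H0), (X `|` H0) `<=` (\bigcup_(X in F) X `|` H0),
        (X `|` H0) x & (X `|` H0) y].
    have sub X : F X -> (X `|` H0) `<=` (\bigcup_(X in F) X `|` H0).
      by move=> FX z [Xz|]; [left; exists X | right].
    move=> [[X FX Xx]|hx] [[Y FY Yy]|hy].
    - have [XY|YX] := Ftot X Y FX FY.
        by exists Y; split; [exact: FP | exact: sub | left; exact: XY | left].
      by exists X; split; [exact: FP | exact: sub | left | left; exact: YX].
    - by exists X; split; [exact: FP | exact: sub | left | right].
    - by exists Y; split; [exact: FP | exact: sub | right | left].
    - exists set0; rewrite set0U; split=> //; exact: subsetUr.
  split.
  - move=> x y s t hx hy; have [X [[XD _ _] sub X1 X2]] := lift _ _ hx hy.
    exact/sub/XD.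
  - move=> a x s hx; have [X [[_ XZ _] sub X1 _]] := lift _ _ hx hx.
    exact/sub/XZ.
  - move=> x s hx; have [X [[_ _ Xp] sub X1 _]] := lift _ _ hx hx.
    exact: Xp.
set M := A `|` H0 in PA.
have M00 : M (0, 0) by right.
have tot x : exists s, M (x, s).
  apply: contrapT => nx; have [c Hc] := dominated_extend M x PA M00.
  set B := [set z | _] in Hc.
  have MB : M `<=` B.
    move=> [y t] hy; exists y, t, 0; split=> //=.
      by rewrite scale0r addr0.
    by rewrite mul0r addr0.
  apply: (Amax B).
    split; last first.
      move=> BA; apply: nx; exists c; left; apply: BA.
      by exists 0, 0, 1; split=> //=; rewrite ?scale1r ?mul1r add0r.
    by move=> z Az; apply: MB; left.
  rewrite /P /= (_ : B `|` H0 = B)//; apply/setUidPl => z hz; apply: MB; by right.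
have [U HU] : exists U : E -> R, forall x, M (x, U x).
  by exists (fun x => sval (cid (tot x))) => x; case: (cid (tot x)).
have [MD MZ Mp] := PA.
exists U; split.
- by move=> x y; apply: (dominated_fun M _ _ _ PA (HU _)); apply: (MD _ _ _ _ (HU x) (HU y)).
- by move=> a x; apply: (dominated_fun M _ _ _ PA (HU _)); apply: (MZ _ _ _ (HU x)).
- by move=> x; apply: (Mp _ _ (HU x)).
- by move=> x s hx; apply: (dominated_fun M _ _ _ PA (HU _)); right.
Qed.

Theorem hahn_banach {F : lmodType R[i]} (G : F -> Prop) (iota : F -> E) (phi : F -> R[i]) :
  G 0 -> (forall (a : R[i]) x y, G x -> G y -> G (a *: x + y)) ->
  (forall (a : R[i]) x y, iota (a *: x + y) = a *: iota x + iota y) ->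
  (forall (a : R[i]) x y, phi (a *: x + y) = a * phi x + phi y) ->
  (forall x, G x -> cabs (phi x) <= p (iota x)) ->
  exists psi : E -> R[i], [/\
    forall (a : R[i]) x y, psi (a *: x + y) = a * psi x + psi y,
    forall x, G x -> psi (iota x) = phi x &
    forall x, cabs (psi x) <= p x].
Proof.
move=> G0 GL iL pL pG.
have iota0 : iota 0 = 0.
  by have := iL (-1) 0 0; rewrite scaler0 addr0 scaleN1r addNr.
have phi0 : phi 0 = 0.
  by have := pL (-1) 0 0; rewrite scaler0 addr0 mulN1r addNr.
pose H0 : set (E * R) := [set z | exists2 f, G f & z = (iota f, complex.Re (phi f))].
have [||U [UD UZ Up UH]] := real_extension H0.
- split.
  + move=> _ _ _ _ [f Gf [-> ->]] [g Gg [-> ->]]; exists (f + g).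
      by rewrite -[f]scale1r; apply: GL.
    have := iL 1 f g; have := pL 1 f g; rewrite !scale1r mul1r => -> ->.
    by rewrite raddfD.
  + move=> a _ _ [f Gf [-> ->]]; exists (a%:C%C *: f).
      by rewrite -[_ *: f]addr0; apply: GL.
    have := iL a%:C%C f 0; have := pL a%:C%C f 0; rewrite iota0 phi0 !addr0 => -> ->.
    by rewrite Re_realM.
  + move=> _ _ [f Gf [-> ->]]; apply: le_trans (pG _ Gf); exact: Re_le_cabs.
- by exists 0; rewrite ?iota0 ?phi0.
pose I : R[i] := Complex 0 1.
pose psi x : R[i] := Complex (U x) (- U (I *: x)).
have psiD x y : psi (x + y) = psi x + psi y.
  by rewrite /psi scalerDr !UD opprD.
have psiZ (a : R[i]) x : psi (a *: x) = a * psi x.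
  case: a => a b.
  have E1 : Complex a b *: x = a%:C%C *: x + b%:C%C *: (I *: x).
    rewrite scalerA -scalerDl; congr (_ *: _); apply/eqP; rewrite eq_complex /=.
    by apply/andP; split; apply/eqP; ring.
  have E2 : I *: (Complex a b *: x) = a%:C%C *: (I *: x) + (- b)%:C%C *: x.
    rewrite !scalerA -scalerDl; congr (_ *: _); apply/eqP; rewrite eq_complex /=.
    by apply/andP; split; apply/eqP; ring.
  rewrite /psi E2 E1 !UD !UZ; apply/eqP; rewrite eq_complex /=.
  by apply/andP; split; apply/eqP; ring.
exists psi; split.
- by move=> a x y; rewrite psiD psiZ.
- move=> f Gf.
  have hI : H0 (I *: iota f, complex.Re (I * phi f)).
    exists (I *: f); first by rewrite -[_ *: f]addr0; apply: GL.
    have := iL I f 0; have := pL I f 0; rewrite iota0 phi0 !addr0 => -> ->.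
    by [].
  have hf : H0 (iota f, complex.Re (phi f)) by exists f.
  rewrite /psi (UH _ _ hI) (UH _ _ hf); case: (phi f) => u v /=.
  by congr (Complex _ _); ring.
- move=> x; have [u u1 ux] := phase_exists (psi x).
  have : U (u *: x) = cabs (psi x).
    by rewrite -[LHS]/(complex.Re (psi (u *: x))) psiZ ux.
  by move=> <-; apply: (le_trans (Up _)); rewrite pZ u1 mul1r.
Qed.

End HahnBanach.
(** * Bounded complex functions with the supremum norm *)

Section BoundedFunctions.
Context {R : realType} {S : Type}.

Definition fbounded : {pred S -> R[i]} :=
  fun f => `[< exists M : R, forall x, cabs (f x) <= M >].

Lemma fboundedP (f : S -> R[i]) :
  reflect (exists M : R, forall x, cabs (f x) <= M) (f \in fbounded).
Proof. exact: asboolP. Qed.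

Record bfun := BFun { bfun_val :> S -> R[i]; _ : bfun_val \in fbounded }.

HB.instance Definition _ := [isSub for bfun_val].
HB.instance Definition _ := gen_eqMixin bfun.
HB.instance Definition _ := gen_choiceMixin bfun.

Fact fbounded_submod : submod_closed fbounded.
Proof.
split; first by apply/fboundedP; exists 0 => x; rewrite cabs0.
move=> a f g /fboundedP[M fM] /fboundedP[M' gM]; apply/fboundedP.
exists (cabs a * M + M') => x; apply: le_trans (cabsD _ _) _.
by apply: lerD => //; rewrite cabsM ler_wpM2l ?cabs_ge0.
Qed.
HB.instance Definition _ := GRing.isSubmodClosed.Build _ _ fbounded fbounded_submod.
HB.instance Definition _ := [SubChoice_isSubLmodule of bfun by <:].

Implicit Types f g : bfun.

Definition bnorm f : R := sup (range (fun x => cabs (f x))).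

Lemma bfunP f g : (forall x, f x = g x) -> f = g.
Proof. by move=> fg; apply/val_inj/funext. Qed.

Lemma bfunDE f g x : (f + g) x = f x + g x. Proof. by []. Qed.

Lemma bfunZE a f x : (a *: f) x = a * f x. Proof. by []. Qed.

Lemma bnorm_ge f x : cabs (f x) <= bnorm f.
Proof.
apply: ub_le_sup; last by exists x.
by case: f => f /= /fboundedP[M fM]; exists M => _ [y _ <-].
Qed.

Lemma bnorm_le f M : 0 <= M -> (forall x, cabs (f x) <= M) -> bnorm f <= M.
Proof.
move=> M0 fM; rewrite /bnorm; set A := (X in sup X).
have [A0|/nonemptyPn ->] := pselect (A !=set0); last by rewrite sup0.
by apply: ge_sup => // _ [y _ <-].
Qed.

Lemma bnorm_ge0 f : 0 <= bnorm f.
Proof.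
rewrite /bnorm; set A := (X in sup X).
have [[_ [x _ _]]|/nonemptyPn ->] := pselect (A !=set0); last by rewrite sup0.
exact: le_trans (cabs_ge0 _) (bnorm_ge f x).
Qed.

Let cnorm f : R[i] := (bnorm f)%:C%C.

Let cnormD f g : cnorm (f + g) <= cnorm f + cnorm g.
Proof.
rewrite -rmorphD lecR; apply: bnorm_le => [|x]; first by rewrite addr_ge0 ?bnorm_ge0.
by apply: (le_trans (cabsD _ _)); apply: lerD; apply: bnorm_ge.
Qed.

Lemma bnormZ a f : bnorm (a *: f) = cabs a * bnorm f.
Proof.
have half b h : bnorm (b *: h) <= cabs b * bnorm h.
  apply: bnorm_le => [|x]; first by rewrite mulr_ge0 ?cabs_ge0 ?bnorm_ge0.
  by rewrite bfunZE cabsM ler_wpM2l ?cabs_ge0 ?bnorm_ge.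
apply/le_anti; rewrite half /=.
have [->|a0] := eqVneq a 0; first by rewrite cabs0 mul0r bnorm_ge0.
have ca : 0 < cabs a by rewrite lt_def cabs_eq0 a0 cabs_ge0.
rewrite mulrC -ler_pdivlMr// mulrC -cabsV.
by apply: le_trans (half _ _); rewrite scalerA mulVf// scale1r.
Qed.

Let cnormZ a f : cnorm (a *: f) = `|a| * cnorm f.
Proof. by rewrite -cabsE -rmorphM /cnorm bnormZ. Qed.

Let cnorm0 f : cnorm f = 0 -> f = 0.
Proof.
move=> /complexI f0; apply: bfunP => x; apply/eqP; rewrite -cabs_eq0 eq_le cabs_ge0 andbT.
by rewrite -f0 bnorm_ge.
Qed.

HB.instance Definition _ := Lmodule_isNormed.Build R[i] bfun cnormD cnormZ cnorm0.

Lemma bfun_normE f : `|f| = (bnorm f)%:C%C. Proof. by []. Qed.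

Let lim_of (h : bfun -> R) (F : set_system bfun) : R := sup [set t | F [set f | t <= h f]].

Let lim_ofP (h : bfun -> R) (F : set_system bfun) :
  (forall f g, `|h f - h g| <= bnorm (f - g)) -> ProperFilter F -> cauchy F ->
  forall f0 (e : R), 0 < e -> F (ball f0 e%:C%C) -> `|lim_of h F - h f0| <= e.
Proof.
move=> hL FF Fc f0 e e0 Fe; rewrite ler_distl.
have low (g : bfun) d : F (ball g d%:C%C) -> F [set f | h g - d <= h f].
  apply: filterS => f /=; rewrite -ball_normE /ball_ /= bfun_normE ltcR => /ltW gf.
  by have := le_trans (hL g f) gf; rewrite ler_distl => /andP[]; lra.
have up t : F [set f | t <= h f] -> t <= h f0 + e.
  move=> Ft; have [f [/= tf]] := filter_ex (filterI Ft Fe).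
  rewrite -ball_normE /ball_ /= bfun_normE ltcR => /ltW gf.
  by have := le_trans (hL f0 f) gf; rewrite ler_distl => /andP[]; lra.
have hs : has_sup [set t | F [set f | t <= h f]].
  by split; [exists (h f0 - e); apply: low | exists (h f0 + e) => t; apply: up].
apply/andP; split; first by apply: ub_le_sup (hs.2) _ _; apply: low.
by apply: ge_sup (hs.1) _ => t; apply: up.
Qed.

Let bfun_complete (F : set_system bfun) : ProperFilter F -> cauchy F -> cvg F.
Proof.
move=> FF Fc.
pose re x f := complex.Re (f x); pose im x f := complex.Im (f x).
have Im_le (z : R[i]) : `|complex.Im z| <= cabs z.
  case: z => a b; rewrite /cabs /= -sqrtr_sqr ler_wsqrtr// lerDr sqr_ge0 //.
have Re_le (z : R[i]) : `|complex.Re z| <= cabs z.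
  case: z => a b; rewrite /cabs /= -sqrtr_sqr ler_wsqrtr// lerDl sqr_ge0 //.
have reL x f g : `|re x f - re x g| <= bnorm (f - g).
  apply: le_trans (bnorm_ge (f - g) x); rewrite /re -raddfB; exact: Re_le.
have imL x f g : `|im x f - im x g| <= bnorm (f - g).
  apply: le_trans (bnorm_ge (f - g) x); rewrite /im -raddfB; exact: Im_le.
pose l x : R[i] := Complex (lim_of (re x) F) (lim_of (im x) F).
have lP f0 (e : R) : 0 < e -> F (ball f0 e%:C%C) -> forall x, cabs (l x - f0 x) <= 2 * e.
  move=> e0 Fe x; have h1 := lim_ofP (re x) F (reL x) FF Fc f0 e e0 Fe.
  have h2 := lim_ofP (im x) F (imL x) FF Fc f0 e e0 Fe.
  have -> : l x - f0 x = (lim_of (re x) F - re x f0)%:C%C +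
      Complex 0 1 * (lim_of (im x) F - im x f0)%:C%C.
    rewrite /l /re /im; case: (f0 x) => a b; apply/eqP; rewrite eq_complex /=.
    by apply/andP; split; apply/eqP; ring.
  apply: (le_trans (cabsD _ _)); rewrite cabsM !cabs_real.
  have -> : cabs (Complex 0 1 : R[i]) = 1.
    by rewrite /cabs /= expr0n expr1n add0r sqrtr1.
  by rewrite mul1r mulr2n mulrDl mul1r; apply: lerD.
have Fex (e : R) : 0 < e -> exists f0, F (ball f0 e%:C%C).
  by move=> e0; apply/(cauchyP F).1 => //; rewrite ltcR.
have lb : l \in fbounded.
  have [f0 Ff0] := Fex 1 ltr01; apply/fboundedP; exists (2 * 1 + bnorm f0) => x.
  rewrite -[l x](subrK (f0 x)); apply: (le_trans (cabsD _ _)).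
  by apply: lerD; [apply: lP | apply: bnorm_ge].
apply/cvg_ex; exists (BFun l lb); apply/cvgrPdist_lt => eps eps0.
have epsE : eps = (complex.Re eps)%:C%C.
  by move: eps0; case: (eps) => a b; rewrite ltcE /= => /andP[/eqP -> _].
have e0 : 0 < complex.Re eps by rewrite -ltcR -epsE.
have e4 : 0 < complex.Re eps / 4 by rewrite divr_gt0.
have [f0 Ff0] := Fex _ e4; near=> f.
rewrite bfun_normE epsE ltcR.
have : bnorm (f0 - f) < complex.Re eps / 4.
  have : ball f0 (complex.Re eps / 4)%:C%C f by near: f.
  by rewrite -ball_normE /ball_ /= bfun_normE ltcR.
move=> ff0; apply: (@le_lt_trans _ _ (2 * (complex.Re eps / 4) + bnorm (f0 - f))); last by lra.
apply: bnorm_le => [|x]; first by rewrite addr_ge0 ?bnorm_ge0 ?mulr_ge0 ?ltW.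
change (cabs (l x - f x) <= 2 * (complex.Re eps / 4) + bnorm (f0 - f)).
rewrite -[l x](subrK (f0 x)) -addrA.
apply: (le_trans (cabsD _ _)); apply: lerD; first exact: lP.
exact: (bnorm_ge (f0 - f) x).
Unshelve. all: by end_near. Qed.

HB.instance Definition _ := Uniform_isComplete.Build bfun bfun_complete.

End BoundedFunctions.

Arguments bfun : clear implicits.
(** * Upper bounds *)

Lemma ext_deg_le {n d m} (a : mi n d) : mdeg_le m (ext a) -> (mdeg a <= m)%N.
Proof.
move=> [N [aN sN]]; apply: leq_trans sN.
have -> : mdeg a = (\sum_(0 <= i < n) ext a i)%N.
  by rewrite big_mkord; apply: eq_bigr => i _; rewrite /ext valK.
rewrite -(big_mkord xpredT (ext a)).
have [nN|/ltnW Nn] := leqP n N; first by rewrite (@big_cat_nat _ _ _ n 0%N N)//= leq_addr.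
rewrite (@big_cat_nat _ _ _ N 0%N n)//=.
suff -> : (\sum_(N <= i < n) ext a i = 0)%N by rewrite addn0.
by rewrite big_nat_cond big1// => i /andP[/andP[Ni _] _]; apply: aN.
Qed.

Section Upper.
Context {R : realType} {r s : R}.
Hypotheses (s1 : 1 <= s) (sr : s <= r) (r2 : r <= 2).
Context {n d : nat}.
Hypothesis n0 : (0 < n)%N.
Implicit Types (c : coefs R n d) (z : 'I_n -> R[i]) (J : set (nat -> nat)).

Lemma relproj_exists J (Y : normedModType R[i]) (V : coefs R n d -> Y)
    (w : mi n d -> R) (K : R) :
  (forall (a : R[i]) (x y : coefs R n d), V (a *: x + y) = a *: V x + V y) ->
  (forall c, inPJ J c -> `|V c| = ((pnorm r s c)%:C)%C) ->
  (forall a, J (ext a) -> 0 <= w a) ->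
  (forall c a, inPJ J c -> J (ext a) -> cabs (c a) <= w a * pnorm r s c) ->
  (forall z, lorentz_ball r s z ->
    \sum_(a : mi n d | `[< J (ext a) >]) w a * mon (fun i => cabs (z i)) a <= K) ->
  exists P : Y -> Y,
    (forall (a : R[i]) (x y : Y), P (a *: x + y) = a *: P x + P y) /\
    (forall y, exists2 c, inPJ J c & P y = V c) /\
    (forall c, inPJ J c -> P (V c) = V c) /\
    (forall y, `|P y| <= (K%:C)%C * `|y|).
Proof.
move=> VL Vn w0 wc wK.
pose nrm (y : Y) := complex.Re `|y|.
have nrmE y : (nrm y)%:C%C = `|y|.
  by have := normr_ge0 y; rewrite /nrm; case: `|y| => u v; rewrite lecE /= => /andP[/eqP ->].
have nrm0 y : 0 <= nrm y by have := normr_ge0 y; rewrite -nrmE lecR.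
have ext_psi (a : mi n d) : exists psi : Y -> R[i], [/\
    forall (b : R[i]) x y, psi (b *: x + y) = b * psi x + psi y,
    J (ext a) -> forall c, inPJ J c -> psi (V c) = c a &
    J (ext a) -> forall y, cabs (psi y) <= w a * nrm y].
  have [Ja|nJa] := pselect (J (ext a)); last first.
    by exists (fun=> 0); split => // b _ _; rewrite mulr0 addr0.
  have [|||||||psi [pl pv pb]] := @hahn_banach R Y (fun y => w a * nrm y) _ _ _
     (@inPJ R J n d) V (fun c : coefs R n d => c a).
  - move=> x y; rewrite -mulrDr; apply: ler_wpM2l; first exact: w0.
    by rewrite -lecR rmorphD /= !nrmE ler_normD.
  - move=> b x; rewrite mulrCA; congr (_ * _); apply: complexI.
    by rewrite rmorphM /= !nrmE cabsE normrZ.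
  - by move=> b _; rewrite ffunE.
  - move=> b x y Gx Gy a' Ja'; rewrite ffunE [X in X + _]ffunE Gx// Gy//.
    by rewrite scaler0 addr0.
  - exact: VL.
  - by move=> b x y; rewrite !ffunE.
  - move=> c Gc; have -> : nrm (V c) = pnorm r s c by apply: complexI; rewrite nrmE Vn.
    exact: wc.
  by exists psi; split.
pose psi a := sval (cid (ext_psi a)).
have psiP a : [/\ forall (b : R[i]) x y, psi a (b *: x + y) = b * psi a x + psi a y,
    J (ext a) -> forall c, inPJ J c -> psi a (V c) = c a &
    J (ext a) -> forall y, cabs (psi a y) <= w a * nrm y].
  by rewrite /psi; case: (cid (ext_psi a)).
pose cf y : coefs R n d := [ffun a => if `[< J (ext a) >] then psi a y else 0].
have cfJ y : inPJ J (cf y).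
  by move=> a nJ; rewrite ffunE asboolF.
exists (fun y => V (cf y)); split; [|split; [|split]].
- move=> b x y; rewrite -VL; congr V; apply/ffunP => a.
  rewrite !ffunE; case: asboolP => _; last by rewrite scaler0 addr0.
  by have [-> _ _] := psiP a.
- by move=> y; exists (cf y).
- move=> c Gc; congr V; apply/ffunP => a; rewrite ffunE.
  case: asboolP => [Ja|nJa]; last by rewrite Gc.
  by have [_ -> //] := psiP a.
- move=> y; rewrite Vn// -nrmE -rmorphM lecR.
  apply: (pnorm_le s1 sr r2 n0) => z zB; rewrite pevalE.
  apply: (le_trans (cabs_sum _ _ _ _)).
  apply: le_trans (ler_wpM2r (nrm0 y) (wK z zB)).
  rewrite mulr_suml [X in _ <= X]big_mkcond; apply: ler_sum => a _ /=.
  rewrite cabsM cabs_mon ffunE; case: asboolP => Ja; last by rewrite cabs0 mul0r.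
  rewrite mulrAC; apply: ler_wpM2r; first by apply: mon_ge0 => i; apply: cabs_ge0.
  by have [_ _ h] := psiP a; apply: h.
Qed.

Lemma relproj_le J (Y : normedModType R[i]) (V : coefs R n d -> Y)
    (w : mi n d -> R) (K : R) :
  (forall (a : R[i]) (x y : coefs R n d), V (a *: x + y) = a *: V x + V y) ->
  (forall c, inPJ J c -> `|V c| = ((pnorm r s c)%:C)%C) ->
  (forall a, J (ext a) -> 0 <= w a) ->
  (forall c a, inPJ J c -> J (ext a) -> cabs (c a) <= w a * pnorm r s c) ->
  0 <= K ->
  (forall z, lorentz_ball r s z ->
    \sum_(a : mi n d | `[< J (ext a) >]) w a * mon (fun i => cabs (z i)) a <= K) ->
  relproj J V <= K.
Proof.
move=> VL Vn w0 wc K0 wK; apply: ge_inf; first by exists 0 => x [].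
by split=> //; apply: (relproj_exists J Y V w).
Qed.

Lemma relproj_le_crude J : exists2 K : R, 0 <= K &
  forall (Y : normedModType R[i]) (V : coefs R n d -> Y),
    (forall (a : R[i]) (x y : coefs R n d), V (a *: x + y) = a *: V x + V y) ->
    (forall c, inPJ J c -> `|V c| = ((pnorm r s c)%:C)%C) ->
    relproj J V <= K /\ exists P : Y -> Y,
    (forall (a : R[i]) (x y : Y), P (a *: x + y) = a *: P x + P y) /\
    (forall y, exists2 c, inPJ J c & P y = V c) /\
    (forall c, inPJ J c -> P (V c) = V c) /\
    (forall y, `|P y| <= (K%:C)%C * `|y|).
Proof.
have [M M0 HM] := coef_bound_ex s1 sr r2 (d := d) n0.
exists (\sum_(a : mi n d) M); first by rewrite sumr_ge0// => _ _; exact: ltW.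
move=> Y V VL Vn.
have wK z : lorentz_ball r s z ->
    \sum_(a : mi n d | `[< J (ext a) >]) M * mon (fun i => cabs (z i)) a
      <= \sum_(a : mi n d) M.
  move=> zB; rewrite big_mkcond; apply: ler_sum => a _; case: ifP => _; last exact: ltW.
  rewrite ler_piMr ?(ltW M0)// mon_le1// => i.
  by rewrite cabs_ge0 (lorentz_ball_le1 s1 sr).
split.
  apply: (relproj_le J Y V (fun=> M)) => //; first by move=> *; exact: ltW.
  by rewrite sumr_ge0// => _ _; exact: ltW.
by apply: (relproj_exists J Y V (fun=> M)) => // *; exact: ltW.
Qed.

Lemma projconst_le J (K : R) : 0 <= K ->
  (forall (Y : normedModType R[i]) (V : coefs R n d -> Y),
    (forall (a : R[i]) (x y : coefs R n d), V (a *: x + y) = a *: V x + V y) ->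
    (forall c, inPJ J c -> `|V c| = ((pnorm r s c)%:C)%C) -> relproj J V <= K) ->
  projconst r s n d J <= K.
Proof.
move=> K0 h; rewrite /projconst; set A := (X in sup X).
have [A0|/nonemptyPn ->] := pselect (A !=set0); last by rewrite sup0.
by apply: ge_sup => // _ [Y [V [VL [Vn ->]]]]; apply: h.
Qed.

End Upper.

Section UpperMain.
Context {R : realType} {r s : R}.
Hypotheses (s1 : 1 <= s) (sr : s <= r) (r2 : r <= 2).
Context {n m : nat}.
Hypotheses (m0 : (0 < m)%N) (mn : (m <= n)%N).
Let n0 : (0 < n)%N. Proof. exact: leq_trans mn. Qed.
Variables (A : R) (J : set (nat -> nat)).
Hypotheses (A1 : 1 <= A) (Jm : index_set_deg_le J m).
Let t := (n%:R / m%:R) `^ (1 - r^-1).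
Hypothesis hL : logfactor r s m <= A * t.

Let e1 : 1 <= expR (1 : R). Proof. by rewrite ltW// expR_gt1. Qed.
Let B1 : 1 <= A * (2 * expR 1 ^+ 2).
Proof. by rewrite !mulr_ege1// ?exprn_ege1// ler1n. Qed.
Let t0 : 0 <= t. Proof. exact: powR_ge0. Qed.

Lemma chi_mon_upper :
  chi_mon r s n m J <= (2 * (400 * (A * (2 * expR 1 ^+ 2)))) ^+ m * t ^+ m.-1.
Proof.
set K := _ * _; have K0 : 0 <= K.
  apply: mulr_ge0; last exact: exprn_ge0.
  apply: exprn_ge0; apply: mulr_ge0; first exact: ler0n.
  apply: mulr_ge0; [exact: ler0n | exact: le_trans B1].
apply: ge_inf; first by exists 0 => x [].
split=> // c eps cJ eps1; apply: (pnorm_le s1 sr r2 n0) => z zB.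
have cm a : (m < mdeg a)%N -> c a = 0.
  by move=> am; apply: cJ => /Jm /ext_deg_le; rewrite leqNgt am.
apply: le_trans (abs_sum_le s1 sr r2 m0 mn A c z A1 hL zB cm).
apply: (le_trans (cabs_sum _ _ _ _)); apply: ler_sum => a _.
by rewrite ffunE !cabsM eps1 mul1r -cabs_mon.
Qed.

Lemma projconst_upper :
  projconst r s n m J <= (10 * (A * (2 * expR 1 ^+ 2))) ^+ m * t ^+ m.
Proof.
set K := _ * _; have K0 : 0 <= K.
  apply: mulr_ge0; last exact: exprn_ge0.
  apply: exprn_ge0; apply: mulr_ge0; [exact: ler0n | exact: le_trans B1].
have Jdeg (a : mi n m) : J (ext a) -> (mdeg a <= m)%N by move=> /Jm /ext_deg_le.
apply: (projconst_le (r := r) (s := s)) => // Y V VL Vn.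
apply: (relproj_le s1 sr r2 n0 J Y V (fun a => 10 ^+ m * test_weight r s m a)) => //.
- by move=> a _; rewrite mulr_ge0 ?exprn_ge0// ltW// test_weight_gt0.
- by move=> c a _ Ja; apply: (coef_test_weight s1 sr r2 m0 mn); apply: Jdeg.
- move=> z zB; have := sum_test_weight s1 sr m0 mn A z m A1 hL zB (leqnn m).
  move=> h; have -> : K = 10 ^+ m * ((A * (2 * expR 1 ^+ 2)) ^+ m * t ^+ m).
    by rewrite /K exprMn -[LHS]mulrA.
  apply: le_trans (ler_wpM2l _ h); last by rewrite exprn_ge0 ?ler0n.
  rewrite mulr_sumr big_mkcond [X in _ <= X]big_mkcond; apply: ler_sum => a _.
  have W0 := @test_weight_gt0 R r s _ _ _ a m0.
  have M0 : 0 <= mon (fun i => cabs (z i)) a by apply: mon_ge0 => i; apply: cabs_ge0.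
  case: asboolP => [/Jdeg ->|_].
    by rewrite le_eqVlt; apply/orP; left; apply/eqP; ring.
  case: ifP => // _; apply: mulr_ge0; first by rewrite exprn_ge0 ?ler0n.
  by apply: mulr_ge0 => //; exact: ltW.
Qed.

End UpperMain.
(** * Lower bounds *)

Section Tetrahedral.
Context {R : realType}.

Lemma bin_ge_expn n m : (m <= n)%N -> (n%:R / m%:R : R) ^+ m <= 'C(n, m)%:R.
Proof.
elim: m n => [|m IH] [|n]; rewrite ?bin0 ?expr0// ltnS => mn.
have -> : 'C(n.+1, m.+1)%:R = n.+1%:R / m.+1%:R * 'C(n, m)%:R :> R.
  have := mul_bin_diag n.+1 m; rewrite /=.
  by move/(congr1 (fun k => k%:R : R)); rewrite !natrM mulrAC => ->; rewrite mulrC mulKf ?pnatr_eq0.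
rewrite exprS; apply: ler_wpM2l; first by rewrite divr_ge0.
case: m IH mn => [|m] IH mn; first by rewrite expr0 bin0.
apply: le_trans (IH _ mn); apply: lerXn2r; rewrite ?nnegrE ?divr_ge0//.
rewrite ler_pdivrMr// mulrAC ler_pdivlMr// -!natrM ler_nat.
nia.
Qed.

Context {n m : nat}.
Hypotheses (m0 : (0 < m)%N) (mn : (m <= n)%N).
Implicit Types (a b : mi n m).

Lemma tet_tetra a : tet m a -> tetra m (ext a).
Proof.
move=> /andP[/forallP a1 /eqP am]; split.
  by move=> i; rewrite /ext; case: insubP => [j _ _|//]; apply: a1.
exists n; split; last first.
  by rewrite -[RHS]am; apply: eq_bigr => i _; rewrite /ext valK.
by move=> i ni; rewrite /ext insubN// -leqNgt.
Qed.

Lemma card_tet : (n%:R / m%:R : R) ^+ m <= #|[pred a : mi n m | tet m a]|%:R.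
Proof.
apply: (le_trans (bin_ge_expn n m mn)); rewrite ler_nat.
have := card_draws 'I_n m; rewrite card_ord => <-.
pose f (B : {set 'I_n}) : mi n m := [ffun i => inord (i \in B)].
have fE B i : f B i = (i \in B) :> nat.
  by rewrite ffunE inordK//; case: (i \in B); rewrite // ltnS.
have f_inj : injective f.
  move=> B B' e; apply/setP => i; have := fE B i; rewrite e fE.
  by case: (i \in B); case: (i \in B').
rewrite -(card_imset _ f_inj); apply: subset_leq_card; apply/fintype.subsetP => _ /imsetP[B + ->].
rewrite !inE => /eqP Bm; apply/andP; split.
  by apply/forallP => i; rewrite fE; case: (i \in B).
apply/eqP; transitivity #|B|; last exact: Bm.
rewrite -[RHS]sum1_card [RHS]big_mkcond; apply: eq_bigr => i _.
by rewrite fE; case: (i \in B).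
Qed.

Lemma sum_tet_le (x : 'I_n -> R) : (forall i, 0 <= x i) -> \sum_i x i <= 1 ->
  \sum_(a : mi n m | tet m a) mon x a <= (expR 1 / m%:R) ^+ m.
Proof.
move=> x0 x1; rewrite expr_div_n ler_pdivlMr ?exprn_gt0 ?ltr0n//.
rewrite -expRM_natl mulr1; apply: le_trans (mon_expR_sum (d := m) x m x0 x1).
rewrite mulr_suml big_mkcond; apply: ler_sum => a _; case: ifP => [/andP[/forallP a1 /eqP am]|_].
  rewrite am (_ : mfact a = 1%N) ?divr1// /mfact big1// => i _.
  by have := a1 i; case: (nat_of_ord (a i)) => [|[|]].
by rewrite mulr_ge0 ?mon_ge0// divr_ge0 ?exprn_ge0.
Qed.

End Tetrahedral.

Section RandomPolynomial.
Context {R : realType} {n m : nat}.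
Hypotheses (m0 : (0 < m)%N) (mn : (m <= n)%N).
Let k := (n %/ m)%N.
Let k0 : (0 < k)%N. Proof. by rewrite divn_gt0. Qed.
Let FF := {ffun 'I_k -> mi n m}.
Implicit Types (f : FF) (al : mi n k).

Let count f (a : mi n m) : nat := (\sum_j (f j == a))%N.

Let total f : mi n k := [ffun i => inord (\sum_j f j i)%N].

Let tets f : bool := [forall j, tet m (f j)].

Let totalE f i : tets f -> total f i = (\sum_j f j i)%N :> nat.
Proof.
move=> /forallP ft; rewrite ffunE inordK// ltnS.
apply: (@leq_trans (\sum_(j < k) 1)%N); last by rewrite sum_nat_const card_ord muln1.
by apply: leq_sum => j _; have /andP[/forallP/(_ i)] := ft j.
Qed.

Let mon_total {A : comPzRingType} (x : 'I_n -> A) f : tets f ->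
  \prod_j mon x (f j) = mon x (total f).
Proof.
move=> ft; rewrite exchange_big; apply: eq_bigr => i _.
by rewrite totalE// prodrXr.
Qed.

Let mdeg_total f : tets f -> mdeg (total f) = (m * k)%N.
Proof.
move=> ft; rewrite /mdeg; under eq_bigr do rewrite totalE//.
rewrite exchange_big /= (eq_bigr (fun=> m)); first by rewrite sum_nat_const card_ord mulnC.
by move=> j _; have /andP[_ /eqP] := forallP ft j.
Qed.

Let power_tet {A : comPzRingType} (u : mi n m -> A) :
  (\sum_(a | tet m a) u a) ^+ k = \sum_(f | tets f) \prod_j u (f j).
Proof.
transitivity (\prod_(j < k) \sum_(a | tet m a) u a).
  by rewrite prodr_const card_ord.
rewrite bigA_distr_big; apply: eq_bigl => f.
by apply/ffun_onP/forallP.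
Qed.

Let T al : R := \sum_(f | tets f && (total f == al)) 1.

Let T_ge0 al : 0 <= T al. Proof. exact: sumr_ge0. Qed.

Let sum_T (y : 'I_n -> R) :
  \sum_al T al * mon y al = (\sum_(a : mi n m | tet m a) mon y a) ^+ k.
Proof.
rewrite power_tet (partition_big total xpredT) //=; apply: eq_bigr => al _.
rewrite mulr_suml; apply: eq_bigr => f /andP[ft /eqP <-].
by rewrite mul1r mon_total.
Qed.

Let card_count f : (#|[pred f' | [forall a, count f' a == count f a]]| <= k ^ k)%N.
Proof.
apply: (@leq_trans #|(ffun_on (codom f) : pred FF)|).
  apply: subset_leq_card; apply/fintype.subsetP => f' /forallP h; apply/ffun_onP => j.
  have : (0 < count f (f' j))%N.
    by rewrite -(eqP (h _)) /count (bigD1 j)//= eqxx.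
  apply: contraTT => nc; rewrite -eqn0Ngt sum_nat_eq0; apply/forallP => j' /=.
  by rewrite eqb0; apply: contra nc => /eqP <-; apply: codom_f.
rewrite card_ffun_on card_ord leq_exp2r//.
by apply: leq_trans (card_size _) _; rewrite size_codom card_ord.
Qed.

Let card_T : (#|[pred al : mi n k | mdeg al == (m * k)%N]|%:R : R) <= (8 ^+ m) ^+ k.
Proof.
have nk : (n <= 2 * (m * k))%N.
  have := ltn_ceil n m0; rewrite -/k => h; apply: (leq_trans (ltnW h)).
  by rewrite mulSn mul2n -addnn mulnC leq_add2r -{1}[m]muln1 leq_mul2l k0 orbT.
apply: (@le_trans _ _ (2 ^+ (m * k) * 2 ^+ n)); last first.
  have -> : (8 ^+ m) ^+ k = 2 ^+ (m * k) * 2 ^+ (2 * (m * k)) :> R.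
    have -> : 8 = 2 ^+ 3 :> R by ring.
    by rewrite -!exprM -exprD; congr (_ ^+ _); lia.
  apply: ler_wpM2l; first exact: exprn_ge0.
  by apply: ler_weXn2l => //; rewrite ler1n.
apply: (@le_trans _ _ (2 ^+ (m * k) * \sum_al mon (fun=> 2^-1 : R) al)).
  rewrite -sumr_const mulr_sumr big_mkcond; apply: ler_sum => al _.
  rewrite mon_const; case: ifP => [|_]; last by rewrite mulr_ge0 ?exprn_ge0.
  by rewrite inE => /eqP ->; rewrite -exprMn divff ?expr1n.
apply: ler_wpM2l; first exact: exprn_ge0.
rewrite -(bigA_distr_bigA (fun (i : 'I_n) (j : 'I_k.+1) => (2^-1 : R) ^+ j)).
rewrite -[X in _ <= 2 ^+ X]card_ord -prodr_const; apply: ler_prod => i _.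
rewrite sumr_ge0 /=; last by move=> j _; apply: exprn_ge0.
suff -> : \sum_(j < k.+1) (2^-1 : R) ^+ j = 2 - (2^-1) ^+ k.
  by rewrite gerBl exprn_ge0.
elim: (k) => [|q IH]; first by rewrite big_ord1 !expr0; ring.
by rewrite big_ord_recr /= IH exprS; field.
Qed.

Lemma small_unimodular_tet : exists2 eps : mi n m -> R[i],
  forall a, cabs (eps a) = 1 &
  forall (r : R) (z : 'I_n -> R[i]), 1 <= r -> r <= 2 ->
    \sum_i cabs (z i) `^ r <= 1 ->
    cabs (\sum_(a : mi n m | tet m a) eps a * mon z a) <=
    ((expR 1 / m%:R) ^+ m) `^ r^-1 * (k%:R * 8 ^+ m) `^ (1 - r^-1).
Proof.
have [zeta zetaP] := prim_root_exists (R := R) k.+1 isT.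
pose W := {ffun mi n m -> 'I_k.+1}.
have cN f a : (count f a < k.+1)%N.
  rewrite ltnS; apply: (@leq_trans (\sum_(j < k) 1)%N).
    by apply: leq_sum => j _; exact: leq_b1.
  by rewrite sum_nat_const card_ord muln1.
pose bb al f : R[i] := (tets f && (total f == al))%:R.
pose C al (w : W) := \sum_f bb al f * chr zeta w (count f).
have W0 : 0 < #|{: W}|%:R :> R by rewrite ltr0n (card_torus_gt0 zeta zetaP).
have CT al w : cabs (C al w) <= T al.
  apply: (le_trans (cabs_sum _ _ _ _)); rewrite /T [X in _ <= X]big_mkcond.
  apply: ler_sum => f _; rewrite cabsM (chr_cabs _ zetaP) mulr1 cabs_nat.
  by case: ifP.
have Cmean al : \sum_w cabs (C al w) ^+ 2 / T al <=
    #|{: W}|%:R * (k ^ k)%:R * (mdeg al == (m * k)%N)%:R.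
  have [Tz|Tn] := eqVneq (T al) 0.
    by rewrite Tz invr0 big1 ?mulr_ge0// => w _; rewrite mulr0.
  have -> : mdeg al == (m * k)%N.
    apply: contraNT Tn => nal; rewrite /T big_pred0// => f; apply/negbTE.
    by apply: contra nal => /andP[ft /eqP <-]; rewrite mdeg_total.
  have Tp : 0 < T al by rewrite lt_def Tn T_ge0.
  rewrite mulr1 -mulr_suml ler_pdivrMr// -mulrA.
  have := @torus_parseval_le R _ _ zeta zetaP FF count (bb al) cN (k ^ k) (fun f _ => card_count f).
  move=> h; apply: (le_trans h); apply: ler_wpM2l => //; apply: ler_wpM2l => //.
  rewrite /T [X in _ <= X]big_mkcond; apply: ler_sum => f _.
  by rewrite cabs_nat /bb; case: ifP; rewrite ?expr1n ?expr0n.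
pose H : R := k%:R * 8 ^+ m.
have [w hw] : exists w, \sum_al cabs (C al w) ^+ 2 / T al <= H ^+ k.
  apply: contrapT => /forallNP h.
  have : \sum_(w : W) H ^+ k < \sum_(w : W) \sum_al cabs (C al w) ^+ 2 / T al.
    apply: ltr_sum => [|w _]; last by rewrite ltNge; apply/negP/h.
    by have := W0; rewrite ltr0n => /card_gt0P [w _]; apply/hasP; exists w; rewrite ?mem_index_enum.
  rewrite ltNge => /negP; apply; rewrite exchange_big /=.
  apply: (le_trans (ler_sum _ (fun al _ => Cmean al))).
  rewrite -mulr_sumr sumr_const -[X in _ <= X]mulr_natl -mulrA.
  apply: ler_wpM2l; first exact: ler0n.
  rewrite /H exprMn natrX; apply: ler_wpM2l; first exact: exprn_ge0.
  apply: le_trans card_T; rewrite -natr_sum ler_nat -sum1_card [X in (_ <= X)%N]big_mkcond.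
  by apply: leq_sum => al _; rewrite inE; case: (_ == _).
exists (fun a => zeta ^+ w a) => [a|r z r1 r2 zr].
  by rewrite cabsX (cabs_prim_root _ _ zetaP) expr1n.
have r0 : 0 < r by apply: lt_le_trans r1.
have ri : 0 <= r^-1 <= 1 by rewrite invr_ge0 (ltW r0) invf_le1.
have ri2 : 1 - r^-1 <= r^-1.
  rewrite lerBlDr -mulr2n -mulr_natl ler_pdivlMr ?mul1r//.
have E0 : 0 <= (expR 1 / m%:R : R) by rewrite divr_ge0 ?expR_ge0.
have H0 : 0 <= H by rewrite mulr_ge0 ?exprn_ge0 ?ler0n.
rewrite -(ler_pXn2r k0) ?nnegrE ?cabs_ge0 ?mulr_ge0 ?powR_ge0//.
rewrite -cabsX power_tet exprMn -!exprn_powR ?exprn_ge0//.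
have -> : \sum_(f | tets f) \prod_j (zeta ^+ w (f j) * mon z (f j)) =
    \sum_al C al w * mon z al.
  rewrite (partition_big total xpredT)//=; apply: eq_bigr => al _.
  rewrite mulr_suml big_mkcond; apply: eq_bigr => f _; rewrite /bb.
  case: ifP => [/andP[ft /eqP <-]|_]; last by rewrite !mul0r.
  rewrite big_split /= mon_total// mul1r; congr (_ * _).
  rewrite /chr /count.
  under [RHS]eq_bigr do rewrite big_distrr /= -prodrXr.
  rewrite exchange_big /=; apply: eq_bigr => j _.
  rewrite (bigD1 (f j))//= eqxx muln1 big1 ?mulr1// => a /negPf fa.
  by rewrite eq_sym fa muln0 expr0.
pose x i := cabs (z i).
have x0 i : 0 <= x i by apply: cabs_ge0.
have xr0 i : 0 <= x i `^ r by apply: powR_ge0.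
apply: (le_trans (cabs_sum _ _ _ _)).
apply: (@le_trans _ _ (\sum_al (T al * mon (fun i => x i `^ r) al) `^ r^-1 *
   (cabs (C al w) ^+ 2 / T al) `^ (1 - r^-1))).
  apply: ler_sum => al _; rewrite cabsM cabs_mon -/x.
  rewrite powRM ?mon_ge0// powR_mon//.
  have -> : mon (fun i => (x i `^ r) `^ r^-1) al = mon x al.
    by apply: eq_bigr => i _; rewrite -powRrM divff ?gt_eqF// powRr1.
  rewrite mulrAC; apply: ler_wpM2r; first exact: mon_ge0.
  set c := cabs _; have c0 : 0 <= c by apply: cabs_ge0.
  have [->|cn] := eqVneq c 0; first by rewrite mulr_ge0 ?powR_ge0.
  have cp : 0 < c by rewrite lt_def cn.
  have Tp : 0 < T al by apply: lt_le_trans cp (CT al w).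
  rewrite expr2 -mulrA powRM ?divr_ge0 ?(ltW Tp)//.
  apply: (@le_trans _ _ (T al `^ r^-1 * (c `^ (1 - r^-1) * (c / T al) `^ r^-1))).
    rewrite mulrCA -powRM ?divr_ge0 ?(ltW Tp)// [T al * _]mulrCA divff ?gt_eqF// mulr1.
    rewrite -powRD; last by rewrite cn implybT.
    by rewrite subrK powRr1.
  apply: ler_wpM2l; first exact: powR_ge0.
  apply: ler_wpM2l; first exact: powR_ge0.
  apply: ger_powR => //; rewrite divr_gt0//= ler_pdivrMr// mul1r; exact: CT.
have TA al : 0 <= T al * mon (fun i => x i `^ r) al by rewrite mulr_ge0 ?mon_ge0.
have TB al : 0 <= cabs (C al w) ^+ 2 / T al by rewrite divr_ge0 ?exprn_ge0 ?cabs_ge0.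
apply: (le_trans (holder_sum _ _ _ _ TA TB ri)).
apply: ler_pM; rewrite ?powR_ge0//.
  apply: ge0_ler_powR; rewrite ?nnegrE ?sumr_ge0 ?exprn_ge0//.
    by case/andP: ri.
  rewrite sum_T; apply: lerXn2r; rewrite ?nnegrE ?exprn_ge0//.
    by apply: sumr_ge0 => a _; apply: mon_ge0.
  by apply: sum_tet_le.
apply: ge0_ler_powR; rewrite ?nnegrE ?sumr_ge0 ?exprn_ge0 ?H0//.
by rewrite subr_ge0; case/andP: ri.
Qed.

End RandomPolynomial.
Section Lower.
Context {R : realType} {r s : R}.
Hypotheses (s1 : 1 <= s) (sr : s <= r) (r2 : r <= 2).
Context {n m : nat}.
Hypotheses (m0 : (0 < m)%N) (mn : (m <= n)%N).
Let n0 : (0 < n)%N. Proof. exact: leq_trans mn. Qed.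
Let r1 : 1 <= r. Proof. exact: le_trans sr. Qed.
Let r0 : 0 < r. Proof. exact: lt_le_trans r1. Qed.
Let m0' : 0 < m%:R :> R. Proof. by rewrite ltr0n. Qed.
Let n0' : 0 < n%:R :> R. Proof. by rewrite ltr0n. Qed.
Let ri : 0 <= r^-1 <= 1. Proof. by rewrite invr_ge0 (ltW r0) invf_le1. Qed.
Let ri' : 0 <= 1 - r^-1 <= 1. Proof. by move: ri => ?; lra. Qed.
Let nu : R := n%:R / m%:R.
Let nu0 : 0 < nu. Proof. exact: divr_gt0. Qed.
Let nu1 : 1 <= nu. Proof. by rewrite ler_pdivlMr// mul1r ler_nat. Qed.
Let t := nu `^ (1 - r^-1).
Let t1 : 1 <= t.
Proof. by rewrite -(powRr0 nu); apply: ler_powR => //; case/andP: ri'. Qed.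
Let rho : R := ball_const (r := r) n.
Let rho0 : 0 < rho. Proof. exact: ball_const_gt0. Qed.
Let E : R := (expR 1 / m%:R) ^+ m.
Let E0 : 0 < E. Proof. by rewrite exprn_gt0// divr_gt0 ?expR_gt0. Qed.
Let e1 : 1 <= expR (1 : R). Proof. by rewrite ltW// expR_gt1. Qed.

Lemma ball_const_scaling : nu * rho = t * m%:R `^ (- r^-1) / 3.
Proof.
rewrite /rho /ball_const mulrA; congr (_ / _).
rewrite /t powRB ?(gt_eqF nu0) ?implybT// powRr1 ?(ltW nu0)// -mulrA; congr (_ * _).
rewrite -powRN -powRM ?(ltW nu0) ?(ltW m0')//.
by rewrite /nu divfK// gt_eqF.
Qed.

Lemma tet_sum_root : E `^ r^-1 <= (expR 1 * m%:R `^ (- r^-1)) ^+ m.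
Proof.
have em0 : 0 <= expR 1 / m%:R :> R by rewrite divr_ge0 ?expR_ge0 ?(ltW m0').
rewrite /E (exprn_powR _ _ _ em0); apply: lerXn2r; rewrite ?nnegrE ?powR_ge0 ?mulr_ge0 ?expR_ge0 ?powR_ge0//.
rewrite powRM ?expR_ge0 ?invr_ge0 ?(ltW m0')// (invr_powR _ _ (ltW m0')).
apply: ler_wpM2r; first exact: powR_ge0.
by apply: ler1_powR => //; case/andP: ri.
Qed.

Definition tet_poly (u : mi n m -> R[i]) : coefs R n m :=
  [ffun a => if tet m a then u a else 0].

Lemma peval_tet_poly u z :
  peval (tet_poly u) z = \sum_(a : mi n m | tet m a) u a * mon z a.
Proof.
rewrite pevalE [RHS]big_mkcond; apply: eq_bigr => a _; rewrite ffunE.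
by case: ifP => // _; rewrite mul0r.
Qed.

Lemma inPJ_tet_poly J u : tetra m `<=` J -> inPJ J (tet_poly u).
Proof. by move=> tJ a nJ; rewrite ffunE; case: ifP => // /tet_tetra /tJ. Qed.

Lemma chi_mon_lower J : tetra m `<=` J ->
  ((24 * expR 1) ^+ m)^-1 * t ^+ m.-1 <= chi_mon r s n m J.
Proof.
move=> tJ; have [eps eps1 hP] := small_unimodular_tet (R := R) m0 mn.
set k := (n %/ m)%N in hP.
set D := E `^ r^-1 * (k%:R * 8 ^+ m) `^ (1 - r^-1) in hP *.
have kn : k%:R <= nu by rewrite ler_pdivlMr// -natrM ler_nat leq_divM.
have k0 : 0 < k%:R :> R by rewrite ltr0n divn_gt0.
have Dt : D * t ^+ m.-1 <= (24 * expR 1) ^+ m * (nu * rho) ^+ m.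
  rewrite ball_const_scaling -exprMn.
  have -> : 24 * expR 1 * (t * m%:R `^ (- r^-1) / 3) =
      (expR 1 * m%:R `^ (- r^-1)) * (t * 8) by field.
  rewrite exprMn -mulrA; apply: ler_pM; [exact: powR_ge0 | | exact: tet_sum_root |].
    by apply: mulr_ge0; [exact: powR_ge0 | apply/exprn_ge0/powR_ge0].
  rewrite powRM ?exprn_ge0 ?ler0n//.
  have -> : (t * 8) ^+ m = t * 8 ^+ m * t ^+ m.-1.
    by rewrite exprMn -{1}(prednK m0) exprS; ring.
  apply: ler_wpM2r; first by rewrite exprn_ge0 ?powR_ge0.
  apply: ler_pM; rewrite ?powR_ge0//.
    by apply: ge0_ler_powR; rewrite ?nnegrE ?(ltW nu0) ?ler0n//; case/andP: ri'.
  apply: ler1_powR; last by case/andP: ri'.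
  by rewrite exprn_ege1// ler1n.
apply: lb_le_inf.
  have [M M0 HM] := coef_bound_ex s1 sr r2 (d := m) n0.
  exists (\sum_(a : mi n m) M); split; first by rewrite sumr_ge0// => _ _; exact: ltW.
  move=> c e _ e_1; apply: (pnorm_le s1 sr r2 n0) => z zB.
  apply: (le_trans (cabs_peval_le s1 sr _ _ zB)); rewrite mulr_suml; apply: ler_sum => a _.
  by rewrite ffunE cabsM e_1 mul1r.
move=> K [K0 HK].
have := HK (tet_poly eps) [ffun a => (eps a)^-1] (inPJ_tet_poly J eps tJ) _.
have -> : [ffun a => [ffun a0 => (eps a0)^-1] a * tet_poly eps a] = tet_poly (fun=> 1).
  apply/ffunP => a; rewrite !ffunE; case: ifP => _; last by rewrite mulr0.
  by rewrite mulVf// -cabs_eq0 eps1 oner_eq0.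
move=> /(_ _)/le_trans h.
have PD : pnorm r s (tet_poly eps) <= D.
  apply: (pnorm_le s1 sr r2 n0) => z zB; rewrite peval_tet_poly.
  by apply: hP => //; apply: (lorentz_ball_lr s1 sr).
have KD : (nu * rho) ^+ m <= K * D.
  apply: le_trans (h _ _ (ler_wpM2l K0 PD)); last first.
    by move=> a; rewrite ffunE cabsV eps1 invr1.
  apply: le_trans (cabs_peval_le_pnorm s1 sr _ _ (ball_constP s1 sr r2 n n0)).
  rewrite peval_tet_poly.
  under eq_bigr do rewrite mul1r mon_const -rmorphXn.
  rewrite (eq_bigr (fun=> (rho ^+ m)%:C%C)); last by move=> a /andP[_ /eqP ->].
  rewrite sumr_const -[X in cabs X]mulr_natl cabsM cabs_nat cabs_real.
  rewrite ger0_norm ?exprn_ge0 ?(ltW rho0)// exprMn; apply: ler_wpM2r.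
    by rewrite exprn_ge0// ltW.
  exact: card_tet.
have D0 : 0 < D.
  by rewrite mulr_gt0 ?powR_gt0 ?E0// mulr_gt0// exprn_gt0 ?ltr0n.
have c0 : 0 < (24 * expR 1) ^+ m :> R by rewrite exprn_gt0// mulr_gt0 ?expR_gt0 ?ltr0n.
rewrite mulrC ler_pdivrMr// -(ler_pM2l D0).
apply: (le_trans Dt).
have -> : D * (K * (24 * expR 1) ^+ m) = (24 * expR 1) ^+ m * (K * D) by ring.
by apply: ler_wpM2l => //; exact: ltW.
Qed.

Definition ball_type := {z : 'I_n -> R[i] | lorentz_ball r s z}.

Let peval_bounded (c : coefs R n m) :
  (fun z : ball_type => peval c (sval z)) \in fbounded.
Proof.
apply/fboundedP; exists (\sum_a cabs (c a)) => -[z zB] /=.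
exact: (cabs_peval_le s1 sr).
Qed.

Definition restrict_ball (c : coefs R n m) : bfun R ball_type := BFun _ (peval_bounded c).

Let restrict_ballE c z : restrict_ball c z = peval c (sval z).
Proof. by []. Qed.

Lemma restrict_ball_linear (b : R[i]) (x y : coefs R n m) :
  restrict_ball (b *: x + y) = b *: restrict_ball x + restrict_ball y.
Proof.
apply: bfunP => z; rewrite bfunDE bfunZE !restrict_ballE !pevalE mulr_sumr -big_split.
by apply: eq_bigr => a _; rewrite !ffunE /= mulrDl mulrA.
Qed.

Lemma restrict_ball_norm c : bnorm (restrict_ball c) = pnorm r s c.
Proof.
apply/le_anti/andP; split.
  apply: bnorm_le; first exact: (pnorm_ge0 s1 sr r2 n0).
  by move=> [z zB]; apply: (cabs_peval_le_pnorm s1 sr).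
apply: (pnorm_le s1 sr r2 n0) => z zB.
exact: (bnorm_ge (restrict_ball c) (exist _ z zB)).
Qed.

Lemma restrict_ball_inj : injective restrict_ball.
Proof.
move=> c c' cc'.
have [M M0 HM] := coef_bound_ex s1 sr r2 (d := m) n0.
have e0 : restrict_ball (c - c') = 0.
  by rewrite -[c - c']addrC -scaleN1r restrict_ball_linear cc' scaleN1r addNr.
have p0 : pnorm r s (c - c') = 0.
  rewrite -restrict_ball_norm e0; apply/le_anti; rewrite bnorm_ge0 andbT.
  by apply: bnorm_le => // z; rewrite cabs0.
apply/ffunP => a; apply/eqP; rewrite -subr_eq0 -cabs_eq0 eq_le cabs_ge0 andbT.
by have := HM (c - c') a; rewrite p0 mulr0 !ffunE.
Qed.

End Lower.
(* Counting pairs of exponents with a given sum compares the L4- and L2-norms on the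
   torus; interpolation then brings in the L1-norm. *)
Section Hypercontractive.
Context {R : realType} {n m : nat}.

Lemma sum_cube_le {I : finType} (a : I -> R) : (forall i, 0 <= a i) ->
  (\sum_i a i ^+ 2) ^+ 3 <= (\sum_i a i) ^+ 2 * \sum_i a i ^+ 4.
Proof.
move=> a0; pose u : R := 2 / 3.
have u01 : 0 <= u <= 1 by rewrite /u; lra.
have u1 : 1 - u = 3^-1 by rewrite /u; lra.
have a4 i : 0 <= a i ^+ 4 by apply: exprn_ge0.
have := holder_sum xpredT a (fun i => a i ^+ 4) u a0 a4 u01.
have -> : \sum_i a i `^ u * (a i ^+ 4) `^ (1 - u) = \sum_i a i ^+ 2.
  apply: eq_bigr => i _; rewrite -(@powR_mulrn _ _ 4 (a0 i)) -powRrM u1.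
  have [->|ai] := eqVneq (a i) 0.
    by rewrite powR0 ?mul0r ?expr0n// /u mulf_neq0// ?invr_eq0 pnatr_eq0.
  rewrite -powRD ?ai ?implybT// -(@powR_mulrn _ _ 2 (a0 i)); congr (_ `^ _).
  by rewrite /u; field.
set X := \sum_i a i; set Z := \sum_i a i ^+ 4; set Y := \sum_i a i ^+ 2 => h.
have X0 : 0 <= X by apply: sumr_ge0.
have Z0 : 0 <= Z by apply: sumr_ge0.
have Y0 : 0 <= Y by apply: sumr_ge0 => i _; apply: exprn_ge0.
have := lerXn2r 3 Y0 (mulr_ge0 (powR_ge0 X u) (powR_ge0 Z (1 - u))) h.
rewrite exprMn u1 -!(@powR_mulrn _ _ 3) ?powR_ge0// -!powRrM mulVf ?pnatr_eq0// powRr1//.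
by rewrite /u divfK ?pnatr_eq0// !powR_mulrn.
Qed.

Lemma sum_leq_ord K g : (\sum_(j < K) (j <= g) <= 2 ^ g)%N.
Proof.
have -> : (\sum_(j < K) (j <= g))%N = minn K g.+1.
  elim: K => [|K IH]; first by rewrite big_ord0 min0n.
  by rewrite big_ord_recr /= IH; case: (leqP K g) => /=; lia.
apply: leq_trans (geq_minr _ _) _; exact: ltn_expl.
Qed.

Lemma card_pairs_le (x : mi n m * mi n m) : (mdeg x.1 <= m)%N -> (mdeg x.2 <= m)%N ->
  (#|[pred y : mi n m * mi n m | [forall i, y.1 i + y.2 i == x.1 i + x.2 i]]| <= 4 ^ m)%N.
Proof.
move=> x1 x2; set A := [pred y : mi n m * mi n m | _].
have AE (y : mi n m * mi n m) : y \in A -> forall i, (y.1 i + y.2 i = x.1 i + x.2 i)%N.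
  by rewrite inE => /forallP h i; apply/eqP.
have fst_inj : {in A &, injective (fun y : mi n m * mi n m => y.1)}.
  move=> [a b] [a' b'] /AE /= h /AE /= h' e; rewrite e; congr pair.
  apply/ffunP => i; apply/val_inj => /=; have := h i; rewrite e -(h' i).
  by move/addnI.
rewrite -(card_in_imset fst_inj).
apply: (@leq_trans (\sum_(a : mi n m) \prod_i (a i <= x.1 i + x.2 i))%N).
  rewrite -sum1_card big_mkcond; apply: leq_sum => a _.
  case: ifP => // /imsetP[y /AE yA ->]; rewrite big1// => i _.
  by rewrite -(yA i) leq_addr.
rewrite -(bigA_distr_bigA (fun i (j : 'I_m.+1) => (j <= x.1 i + x.2 i) : nat)).
apply: (@leq_trans (\prod_(i < n) 2 ^ (x.1 i + x.2 i))%N).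
  by apply: leq_prod => i _; apply: sum_leq_ord.
rewrite -expn_sum big_split /= (_ : 4 = 2 ^ 2)%N// -expnM leq_exp2l// mul2n -addnn.
exact: leq_add.
Qed.

Context {N : nat} {zeta : R[i]}.
Hypotheses (zetaP : N.-primitive_root zeta) (mN : (2 * m < N)%N).
Let W := {ffun 'I_n -> 'I_N}.
Variable f : coefs R n m.
Hypothesis fm : forall a, (m < mdeg a)%N -> f a = 0.
Let F (w : W) := \sum_a f a * chr zeta w (fun i => a i).

Lemma l2_le_l1 :
  #|W|%:R ^+ 2 * \sum_a cabs (f a) ^+ 2 <= 4 ^+ m * (\sum_w cabs (F w)) ^+ 2.
Proof.
have W0 : 0 < #|W|%:R :> R by rewrite ltr0n (card_torus_gt0 zeta zetaP).
have aN (a : mi n m) i : (a i < N)%N.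
  by apply: leq_ltn_trans mN; rewrite mul2n -addnn (leq_trans _ (leq_addr _ _))// -ltnS.
set S2 := \sum_a _; set L := \sum_w cabs (F w).
have S2_0 : 0 <= S2 by apply: sumr_ge0 => a _; rewrite exprn_ge0 ?cabs_ge0.
have A2 : \sum_w cabs (F w) ^+ 2 = #|W|%:R * S2.
  apply: (torus_parseval_inj zeta zetaP (fun (a : mi n m) i => a i) f aN) => a b ab.
  by apply/ffunP => i; apply/val_inj/ab.
have A4 : \sum_w cabs (F w) ^+ 4 <= #|W|%:R * (4 ^+ m * S2 ^+ 2).
  pose e (x : mi n m * mi n m) i := (x.1 i + x.2 i)%N.
  pose b (x : mi n m * mi n m) := f x.1 * f x.2.
  have eN x i : (e x i < N)%N.
    apply: leq_ltn_trans mN; rewrite /e mul2n -addnn leq_add// -ltnS //.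
  have := torus_parseval_le zeta zetaP e b eN (4 ^ m) _.
  have -> : \sum_x cabs (b x) ^+ 2 = S2 ^+ 2.
    rewrite [in RHS]expr2 /S2 mulr_suml.
    under [RHS]eq_bigr do rewrite mulr_sumr.
    by rewrite pair_bigA; apply: eq_bigr => x _; rewrite cabsM exprMn.
  rewrite natrX => H; apply: le_trans (H _); last first.
    move=> x bx; apply: card_pairs_le; rewrite leqNgt; apply: contra bx => /fm fx;
      by rewrite /b fx ?mul0r ?mulr0.
  rewrite le_eqVlt; apply/orP; left; apply/eqP; apply: eq_bigr => w _.
  rewrite (exprM _ 2 2) -cabsX; congr (cabs _ ^+ 2).
  rewrite expr2 /F big_distrlr /= pair_bigA; apply: eq_bigr => x _.
  by rewrite /b /e chrD mulrACA.
have := sum_cube_le (fun w => cabs (F w)) (fun w => cabs_ge0 _).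
rewrite A2 -/L => h.
have [->|S2n] := eqVneq S2 0; first by rewrite mulr0 mulr_ge0 ?sqr_ge0 ?exprn_ge0.
have S2p : 0 < S2 by rewrite lt_def S2n.
have := le_trans h (ler_wpM2l (sqr_ge0 L) A4).
have -> : (#|W|%:R * S2) ^+ 3 = (#|W|%:R * S2 ^+ 2) * (#|W|%:R ^+ 2 * S2) by ring.
have -> : L ^+ 2 * (#|W|%:R * (4 ^+ m * S2 ^+ 2)) = (#|W|%:R * S2 ^+ 2) * (4 ^+ m * L ^+ 2).
  by ring.
by rewrite ler_pM2l// mulr_gt0 ?exprn_gt0.
Qed.

End Hypercontractive.
Section LinearSums.
Context {K : pzRingType} {U V : lmodType K} (g : U -> V).
Hypothesis gL : forall (a : K) x y, g (a *: x + y) = a *: g x + g y.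

Lemma lin_fun0 : g 0 = 0.
Proof. by have := gL (-1) 0 0; rewrite scaler0 addr0 scaleN1r addNr. Qed.

Lemma lin_funZ (a : K) x : g (a *: x) = a *: g x.
Proof. by rewrite -[a *: x]addr0 gL lin_fun0 addr0. Qed.

Lemma lin_fun_sum {I : finType} (a : I -> K) (x : I -> U) :
  g (\sum_i a i *: x i) = \sum_i a i *: g (x i).
Proof.
by elim/big_rec2: _ => [|i u v _ <-]; [exact: lin_fun0 | exact: gL].
Qed.

End LinearSums.

Lemma bfun_sumE {R : realType} {S : Type} {I : finType} (f : I -> bfun R S) x :
  (\sum_i f i) x = \sum_i f i x.
Proof. by elim/big_rec2: _ => [|i u v _ <-]. Qed.

Section ProjectionLower.
Context {R : realType} {r s : R}.
Hypotheses (s1 : 1 <= s) (sr : s <= r) (r2 : r <= 2).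
Context {n m : nat}.
Hypotheses (m0 : (0 < m)%N) (mn : (m <= n)%N).
Let n0 : (0 < n)%N. Proof. exact: leq_trans mn. Qed.
Let r1 : 1 <= r. Proof. exact: le_trans sr. Qed.
Let r0 : 0 < r. Proof. exact: lt_le_trans r1. Qed.
Let m0' : 0 < m%:R :> R. Proof. by rewrite ltr0n. Qed.
Let rho : R := ball_const (r := r) n.
Let rho0 : 0 < rho. Proof. exact: ball_const_gt0. Qed.
Let E : R := (expR 1 / m%:R) ^+ m.
Let E0 : 0 < E. Proof. by rewrite exprn_gt0// divr_gt0 ?expR_gt0. Qed.
Let N := (2 * m).+1.
Let zeta : R[i] := sval (prim_root_exists N (ltn0Sn _)).
Let zetaP : N.-primitive_root zeta. Proof. by rewrite /zeta; case: prim_root_exists. Qed.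
Let W := {ffun 'I_n -> 'I_N}.
Let nW : R := #|{: W}|%:R.
Let nW0 : 0 < nW. Proof. by rewrite ltr0n (card_torus_gt0 zeta zetaP). Qed.
Let chrm (w : W) (a : mi n m) : R[i] := chr zeta w (fun i => a i).
Let D : R := rho ^- m * 2 ^+ m * E `^ r^-1.
Let D0 : 0 <= D.
Proof.
by rewrite /D mulr_ge0 ?powR_ge0// mulr_ge0 ?exprn_ge0// invr_ge0 exprn_ge0// ltW.
Qed.

Let tet_functional (z : 'I_n -> R[i]) (f : coefs R n m) : R[i] :=
  \sum_(a : mi n m | tet m a) f a * ((rho ^- m)%:C%C * mon z a).

Let sqr_root (x : R) : 0 <= x -> (x ^+ 2) `^ 2^-1 = x.
Proof.
by move=> x0; rewrite -(@powR_mulrn _ x 2 x0) -powRrM divff ?powRr1// pnatr_eq0.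
Qed.

Let tet_square_sum (x : 'I_n -> R) : (forall i, 0 <= x i) -> \sum_i x i `^ r <= 1 ->
  \sum_(a : mi n m | tet m a) mon x a ^+ 2 <= E `^ (2 / r).
Proof.
move=> x0 xr; pose y (a : mi n m) := mon (fun i => x i `^ r) a.
have xr0 i : 0 <= x i `^ r by apply: powR_ge0.
have y0 a : 0 <= y a by apply: mon_ge0.
have yE : \sum_(a | tet m a) y a <= E by apply: sum_tet_le.
have q0 : 0 <= 2 / r - 1 by rewrite subr_ge0 ler_pdivlMr// mul1r.
have q1 : 1 + (2 / r - 1) = 2 / r by rewrite addrC subrK.
have qn : (1 + (2 / r - 1) == 0) = false by rewrite q1 gt_eqF// divr_gt0.
apply: (@le_trans _ _ (\sum_(a | tet m a) y a * E `^ (2 / r - 1))).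
  apply: ler_sum => a ta.
  have -> : mon x a ^+ 2 = y a * y a `^ (2 / r - 1).
    rewrite -{1}(powRr1 (y0 a)) -powRD ?qn// q1 /y -powR_mon// -powRrM.
    by rewrite mulrCA divff ?gt_eqF// mulr1 powR_mulrn// mon_ge0.
  apply: ler_wpM2l => //; apply: ge0_ler_powR; rewrite ?nnegrE ?(ltW E0)//.
  by apply: le_trans yE; rewrite (bigD1 a)//= lerDl sumr_ge0.
rewrite -mulr_suml; apply: (le_trans (ler_wpM2r (powR_ge0 _ _) yE)).
by rewrite -{1}(powRr1 (ltW E0)) -powRD ?qn// q1.
Qed.

Let tet_functional_le z (f : coefs R n m) : lorentz_ball r s z ->
  (forall a, (m < mdeg a)%N -> f a = 0) ->
  cabs (tet_functional z f) <= D / nW * \sum_(w : W) cabs (\sum_a f a * chrm w a).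
Proof.
move=> zB fm; set L := \sum_w _.
have L0 : 0 <= L by apply: sumr_ge0 => w _; apply: cabs_ge0.
pose x i := cabs (z i); have x0 i : 0 <= x i by apply: cabs_ge0.
apply: (@le_trans _ _ (rho ^- m * \sum_(a | tet m a) cabs (f a) * mon x a)).
  apply: (le_trans (cabs_sum _ _ _ _)); rewrite mulr_sumr; apply: ler_sum => a _.
  rewrite !cabsM cabs_mon cabs_real mulrCA ger0_norm//.
  by rewrite invr_ge0 exprn_ge0// ltW.
have -> : D / nW * L = rho ^- m * ((2 ^+ m * L / nW) * E `^ r^-1) by rewrite /D; ring.
apply: ler_wpM2l; first by rewrite invr_ge0 exprn_ge0// ltW.
have A0 a : 0 <= cabs (f a) ^+ 2 by apply: exprn_ge0; apply: cabs_ge0.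
have B0 (a : mi n m) : 0 <= mon x a ^+ 2 by apply: exprn_ge0; apply: mon_ge0.
have h2 : 1 - 2^-1 = 2^-1 :> R by lra.
have h01 : 0 <= (2^-1 : R) <= 1 by rewrite invr_ge0 ler0n invf_le1 ?ler1n.
have := holder_sum (fun a : mi n m => tet m a) _ _ 2^-1 A0 B0 h01.
rewrite h2; under eq_bigr do rewrite sqr_root ?cabs_ge0// sqr_root ?mon_ge0//.
move=> /le_trans; apply; apply: ler_pM; rewrite ?powR_ge0//.
  rewrite -[X in _ <= X]sqr_root; last by rewrite divr_ge0 ?mulr_ge0 ?exprn_ge0 ?(ltW nW0).
  apply: ge0_ler_powR; rewrite ?nnegrE ?sumr_ge0 ?exprn_ge0 ?divr_ge0 ?mulr_ge0 ?exprn_ge0 ?(ltW nW0)//.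
  apply: (@le_trans _ _ (\sum_a cabs (f a) ^+ 2)).
    by rewrite big_mkcond; apply: ler_sum => a _; case: ifP.
  have := l2_le_l1 (zeta := zeta) zetaP (ltnSn _) f fm.
  rewrite -/nW -/L => h; rewrite expr_div_n ler_pdivlMr ?exprn_gt0// mulrC.
  apply: (le_trans h); rewrite exprMn -exprM mulnC exprM (_ : 2 ^+ 2 = 4)//.
  by ring.
have -> : E `^ r^-1 = (E `^ (2 / r)) `^ 2^-1.
  by rewrite -powRrM; congr (_ `^ _); field; rewrite gt_eqF.
apply: ge0_ler_powR; rewrite ?nnegrE ?sumr_ge0 ?powR_ge0//.
by apply: tet_square_sum => //; apply: (lorentz_ball_lr s1 sr).
Qed.

Let V : coefs R n m -> bfun R (ball_type (r := r) (s := s) (n := n)) :=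
  restrict_ball s1 sr.

Let dirac (b : mi n m) : coefs R n m := [ffun a => (a == b)%:R].

Let kernel_exists (z : ball_type (r := r) (s := s) (n := n)) :
  exists g : W -> R[i], (forall w, cabs (g w) <= D / nW) /\
    forall b : mi n m, (mdeg b <= m)%N ->
      \sum_w chrm w b * g w = (tet m b)%:R * ((rho ^- m)%:C%C * mon (sval z) b).
Proof.
pose X := {ffun W -> R[i]}.
pose p (h : X) : R := D / nW * \sum_w cabs (h w).
have c0 : 0 <= D / nW by rewrite divr_ge0// ltW.
pose iota (f : coefs R n m) : X := [ffun w => \sum_a f a * chrm w a].
pose G (f : coefs R n m) := forall a, (m < mdeg a)%N -> f a = 0.
have [||||||| g [gL gi gp]] := @hahn_banach R X p _ _ _ G iota (tet_functional (sval z)).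
- move=> x y; rewrite -mulrDr; apply: ler_wpM2l => //; rewrite -big_split.
  by apply: ler_sum => w _; rewrite ffunE; apply: cabsD.
- move=> a x; rewrite mulrCA; congr (_ * _); rewrite mulr_sumr.
  by apply: eq_bigr => w _; rewrite ffunE cabsM.
- by move=> a _; rewrite ffunE.
- by move=> a x y Gx Gy b bm; rewrite !ffunE Gx// Gy// scaler0 addr0.
- move=> a x y; apply/ffunP => w; rewrite !ffunE scaler_sumr -big_split.
  by apply: eq_bigr => b _; rewrite !ffunE /= mulrDl scalerAl.
- move=> a x y; rewrite /tet_functional mulr_sumr -big_split.
  by apply: eq_bigr => b _; rewrite !ffunE /= mulrDl -scalerAl.
- move=> f Gf; rewrite /p; under eq_bigr do rewrite ffunE.
  by apply: tet_functional_le => //; case: (z).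
pose del (w : W) : X := [ffun w' => (w' == w)%:R].
exists (fun w => g (del w)); split=> [w|b bm].
  apply: (le_trans (gp _)); rewrite /p (bigD1 w)//= ffunE eqxx cabs1 big1 ?addr0 ?mulr1//.
  by move=> w' /negPf ww'; rewrite ffunE ww' cabs0.
have Gb : G (dirac b).
  by move=> a am; rewrite ffunE; case: eqP am => // ->; rewrite ltnNge bm.
have -> : \sum_w chrm w b * g (del w) = g (\sum_w chrm w b *: del w).
  by rewrite (lin_fun_sum (V := R[i]^o) g gL).
have -> : \sum_w chrm w b *: del w = iota (dirac b).
  apply/ffunP => w; rewrite sum_ffunE ffunE (bigD1 w)//= big1; last first.
    by move=> w' /negPf ww'; rewrite !ffunE eq_sym ww' scaler0.
  rewrite !ffunE eqxx (bigD1 b)//= big1 => [|a /negPf ab]; last by rewrite ffunE ab mul0r.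
  by rewrite ffunE eqxx !addr0 mul1r [LHS]mulr1.
rewrite gi// /tet_functional; have [tb|tb] := boolP (tet m b).
  rewrite mulr1n mul1r (bigD1 b)//= ffunE eqxx mul1r big1 ?addr0// => a /andP[_ /negPf ab].
  by rewrite ffunE ab mul0r.
rewrite mulr0n mul0r big1// => a ta; rewrite ffunE; case: eqP ta => [->|_ _]; last by rewrite mul0r.
by rewrite (negPf tb).
Qed.

Lemma projection_norm_lower (J : set (nat -> nat)) (K : R)
    (Q : bfun R (ball_type (r := r) (s := s) (n := n)) ->
         bfun R (ball_type (r := r) (s := s) (n := n))) :
  index_set_deg_le J m -> tetra m `<=` J -> 0 <= K ->
  (forall (a : R[i]) x y, Q (a *: x + y) = a *: Q x + Q y) ->
  (forall y, exists2 c, inPJ J c & Q y = V c) ->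
  (forall c, inPJ J c -> Q (V c) = V c) ->
  (forall y, `|Q y| <= (K%:C)%C * `|y|) ->
  #|[pred a : mi n m | tet m a]|%:R <= K * D.
Proof.
move=> Jm tJ K0 QL QV Qid QK.
pose g z := sval (cid (kernel_exists z)).
have gP z : (forall w, cabs (g z w) <= D / nW) /\
    forall b : mi n m, (mdeg b <= m)%N ->
      \sum_w chrm w b * g z w = (tet m b)%:R * ((rho ^- m)%:C%C * mon (sval z) b).
  by rewrite /g; case: (cid (kernel_exists z)).
have gb w z : cabs (nW%:C%C * g z w) <= D.
  rewrite cabsM cabs_real ger0_norm ?(ltW nW0)// mulrC -ler_pdivlMr//.
  by have [h _] := gP z.
have gbd w : (fun z => nW%:C%C * g z w) \in fbounded by apply/fboundedP; exists D.
pose y w : bfun R (ball_type (r := r) (s := s) (n := n)) := BFun _ (gbd w).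
have yn w : bnorm (y w) <= D by apply: bnorm_le => // z; apply: gb.
have [c cJ cQ] : exists2 c : W -> coefs R n m, forall w, inPJ J (c w) &
    forall w, Q (y w) = V (c w).
  have H w : {c : coefs R n m | inPJ J c & Q (y w) = V c} by apply: cid2.
  by exists (fun w => s2val (H w)) => w; case: (H w).
pose kap (b : mi n m) : R[i] := nW%:C%C * ((tet m b)%:R * (rho ^- m)%:C%C).
have VL := restrict_ball_linear (n := n) (m := m) s1 sr.
have ysum b : (mdeg b <= m)%N -> \sum_w chrm w b *: y w = kap b *: V (dirac b).
  move=> bm; apply: bfunP => z; rewrite bfun_sumE bfunZE.
  have -> : V (dirac b) z = mon (sval z) b.
    rewrite /V /= pevalE (bigD1 b)//= ffunE eqxx mul1r big1 ?addr0// => a /negPf ab.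
    by rewrite ffunE ab mul0r.
  have [_ /(_ b bm) h] := gP z.
  rewrite /kap -!mulrA -h mulr_sumr; apply: eq_bigr => w _.
  by rewrite bfunZE /= mulrCA.
have csum b : (mdeg b <= m)%N -> \sum_w chrm w b * c w b = kap b.
  move=> bm.
  have : V (\sum_w chrm w b *: c w) = V (kap b *: dirac b).
    rewrite (lin_fun_sum V VL) (lin_funZ V VL).
    under eq_bigr do rewrite -cQ.
    rewrite -(lin_fun_sum Q QL) ysum// (lin_funZ Q QL).
    have [tb|tb] := boolP (tet m b); last by rewrite /kap (negPf tb) mul0r mulr0 !scale0r.
    rewrite Qid// => a nJ; rewrite ffunE; case: eqP => // ab.
    by case: nJ; rewrite ab; apply/tJ/tet_tetra.
  move=> /(restrict_ball_inj s1 sr r2 m0 mn) /ffunP /(_ b).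
  rewrite sum_ffunE !ffunE eqxx => h.
  rewrite -[RHS]mulr1 -[RHS]h; apply: eq_bigr => w _; by rewrite ffunE.
have cz w b : (m < mdeg b)%N -> c w b = 0.
  by move=> bm; apply: cJ => /Jm /ext_deg_le; rewrite leqNgt bm.
pose pt (w : W) i : R[i] := rho%:C%C * zeta ^+ w i.
have ptB w : lorentz_ball r s (pt w).
  apply: (lorentz_ball_mono s1 sr) (ball_constP s1 sr r2 n n0) => i.
  by rewrite cabsM cabsX (cabs_prim_root _ _ zetaP) expr1n mulr1.
have main : \sum_w peval (c w) (pt w) = nW%:C%C * #|[pred a : mi n m | tet m a]|%:R.
  transitivity (\sum_b (rho%:C%C : R[i]) ^+ mdeg b * \sum_w chrm w b * c w b).
    under [RHS]eq_bigr do rewrite mulr_sumr.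
    rewrite [RHS]exchange_big; apply: eq_bigr => w _; rewrite pevalE.
    apply: eq_bigr => b _; rewrite monM mon_const /chrm chrE.
    by rewrite mulrC mulrA.
  rewrite mulr_natr -sumr_const [RHS]big_mkcond; apply: eq_bigr => b _.
  rewrite inE; have [bm|bm] := leqP (mdeg b) m; last first.
    rewrite big1 ?mulr0; last by move=> w _; rewrite cz// mulr0.
    by case: ifP => // /andP[_ /eqP be]; rewrite be ltnn in bm.
  rewrite csum// /kap; case: ifP => [/andP[_ /eqP ->]|_]; last by rewrite mul0r !mulr0.
  rewrite mul1r mulrCA -rmorphXn -rmorphM mulfV ?rmorph1 ?mulr1//.
  by rewrite gt_eqF// exprn_gt0.
have : cabs (\sum_w peval (c w) (pt w)) <= nW * (K * D).
  apply: (le_trans (cabs_sum _ _ _ _)).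
  rewrite /nW [X in _ <= X]mulr_natl -sumr_const; apply: ler_sum => w _.
  apply: (le_trans (cabs_peval_le_pnorm s1 sr _ _ (ptB w))).
  rewrite -(restrict_ball_norm s1 sr r2 m0 mn) -/V -cQ.
  apply: (@le_trans _ _ (K * bnorm (y w))); last by apply: ler_wpM2l.
  by have := QK (y w); rewrite !bfun_normE -rmorphM lecR.
rewrite main cabsM cabs_real cabs_nat ger0_norm ?(ltW nW0)//.
by rewrite ler_pM2l.
Qed.

Lemma projconst_lower (J : set (nat -> nat)) :
  index_set_deg_le J m -> tetra m `<=` J ->
  ((6 * expR 1) ^+ m)^-1 * ((n%:R / m%:R) `^ (1 - r^-1)) ^+ m <= projconst r s n m J.
Proof.
move=> Jm tJ; have VL := restrict_ball_linear (n := n) (m := m) s1 sr.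
have Vn c : `|V c| = ((pnorm r s c)%:C)%C.
  by rewrite bfun_normE (restrict_ball_norm s1 sr r2 m0 mn).
have [K0 K00 HK] := relproj_le_crude s1 sr r2 (d := m) n0 J.
apply: (@le_trans _ _ (relproj J V)); last first.
  apply: ub_le_sup.
    by exists K0 => _ [Y [V' [V'L [V'n ->]]]]; have [] := HK Y V' V'L V'n.
  exists (bfun R (ball_type (r := r) (s := s) (n := n))), V.
  split; [exact: VL | split=> // c _; exact: Vn].
have [_ exP] := HK _ V VL (fun c _ => Vn c).
apply: lb_le_inf; first by exists K0.
move=> K [Kp [Q [QL [QV [Qid QK]]]]].
have h := projection_norm_lower J K Q Jm tJ Kp QL QV Qid QK.
have := le_trans (card_tet (R := R) m0 mn) h.
set t := _ `^ _; set nu := _ / _; rewrite /D => hK.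
have rm0 : 0 < rho ^+ m by rewrite exprn_gt0.
have e0 : 0 < expR (1 : R) by apply: expR_gt0.
have mr0 : 0 < m%:R `^ (- r^-1) :> R by apply: powR_gt0.
pose v : R := m%:R `^ (- r^-1).
have c6 : 0 < (6 * expR 1) ^+ m :> R by rewrite exprn_gt0// mulr_gt0.
have key : (t * v / 3) ^+ m <= K * (2 ^+ m * (expR 1 * v) ^+ m).
  rewrite -(ball_const_scaling m0 mn) exprMn -ler_pdivlMr//.
  apply: (le_trans hK).
  have -> : K * (rho ^- m * 2 ^+ m * E `^ r^-1) = K * (2 ^+ m * E `^ r^-1) / rho ^+ m by ring.
  apply: ler_wpM2r; first by rewrite invr_ge0 ltW.
  apply: ler_wpM2l => //; apply: ler_wpM2l; first exact: exprn_ge0.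
  exact: (tet_sum_root s1 sr m0).
have q0 : 0 < (v / 3) ^+ m by rewrite exprn_gt0// divr_gt0.
rewrite mulrC ler_pdivrMr// -(ler_pM2r q0) -exprMn mulrA.
apply: (le_trans key).
rewrite -mulrA -!exprMn le_eqVlt; apply/orP; left; apply/eqP; congr (_ * _ ^+ _).
by field.
Qed.

End ProjectionLower.
(** * The logarithmic condition *)

Section Conditions.
Context {R : realType} {r s : R}.
Hypotheses (s1 : 1 <= s) (sr : s <= r) (r2 : r <= 2).
Let r1 : 1 <= r. Proof. exact: le_trans sr. Qed.
Let r0 : 0 < r. Proof. exact: lt_le_trans r1. Qed.
Let s0 : 0 < s. Proof. exact: lt_le_trans s1. Qed.
Let kappa := s^-1 - r^-1.
Let kappa0 : 0 <= kappa. Proof. by rewrite subr_ge0 lef_pV2. Qed.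
Let kappa1 : kappa <= 1.
Proof.
rewrite lerBlDr; apply: (@le_trans _ _ 1); first by rewrite invf_le1.
by rewrite lerDl invr_ge0 ltW.
Qed.
Let a := 1 - r^-1.
Let a0 : 0 <= a. Proof. by rewrite subr_ge0 invf_le1. Qed.

Lemma logfactor_le_of_log m n : (0 < m)%N -> (m <= n)%N ->
  (ln (m%:R : R)) `^ (r * kappa) <= (r - 1) * (ln (n%:R : R) - ln (m%:R : R)) ->
  logfactor r s m <= 6 * (n%:R / m%:R) `^ a.
Proof.
move=> m0 mn; have m0' : 0 < m%:R :> R by rewrite ltr0n.
have n0' : 0 < n%:R :> R by rewrite ltr0n (leq_trans m0).
set nu : R := n%:R / m%:R; have nu0 : 0 < nu by apply: divr_gt0.
have nu1 : 1 <= nu by rewrite ler_pdivlMr// mul1r ler_nat.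
rewrite -ln_div ?posrE// -/nu; set l := ln nu; set L := ln _.
have L0 : 0 <= L by rewrite ln_ge0// ler1n.
have l0 : 0 <= l by rewrite ln_ge0.
have t_ge : 1 + a * l <= nu `^ a.
  by rewrite /powR gt_eqF// expR_ge1Dx.
have al0 : 0 <= a * l by apply: mulr_ge0.
move=> h; rewrite /logfactor -/L -/kappa; have [L1|L1] := leP L 1.
  apply: (@le_trans _ _ (2 + L)); first by apply: ler1_powR => //; lra.
  by lra.
set X := (r - 1) * l in h.
have X0 : 0 <= X by rewrite mulr_ge0// subr_ge0.
have Xa : X <= 2 * (a * l).
  have -> : X = r * (a * l) by rewrite /X /a; field; rewrite gt_eqF.
  exact: ler_wpM2r.
have ri0 : 0 <= r^-1 by rewrite invr_ge0 ltW.
have Xr : X `^ r^-1 <= 1 + X.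
  have [X1|/ltW X1] := leP X 1.
    by apply: (le_trans (powR_le1 _ _ X0 ri0 X1)); rewrite lerDl.
  apply: (@le_trans _ _ X); last by rewrite lerDr.
  by apply: ler1_powR => //; rewrite invf_le1.
have Lk : L `^ kappa <= 1 + X.
  apply: le_trans Xr; have -> : L `^ kappa = (L `^ (r * kappa)) `^ r^-1.
    by rewrite -powRrM; congr (_ `^ _); field; rewrite gt_eqF.
  by apply: ge0_ler_powR; rewrite ?nnegrE ?powR_ge0.
apply: (@le_trans _ _ (3 * L `^ kappa)); last by lra.
apply: (@le_trans _ _ ((3 * L) `^ kappa)).
  apply: ge0_ler_powR; rewrite ?nnegrE//; [lra | by apply: mulr_ge0 | lra].
rewrite powRM//; apply: ler_wpM2r; first exact: powR_ge0.
by apply: ler1_powR => //; lra.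
Qed.

Lemma logfactor_le_of_power delta D : 0 < delta -> 0 < D -> exists2 A : R, 1 <= A &
  forall m n : nat, (0 < m)%N -> (m <= n)%N -> (m%:R : R) `^ (1 + delta) <= D * n%:R ->
  logfactor r s m <= A * (n%:R / m%:R) `^ a.
Proof.
move=> d0 D0; have [r_1|r_n1] := eqVneq r 1.
  exists 1 => // m n m0 mn _.
  have sE : s = r by apply/le_anti; rewrite sr r_1 s1.
  rewrite /logfactor sE subrr powRr0 mul1r /a r_1 invr1 subrr powRr0 //.
have ap : 0 < a.
  by rewrite subr_gt0 invf_lt1// lt_neqAle eq_sym r_n1.
pose eps := delta * a; have eps0 : 0 < eps by apply: mulr_gt0.
exists (1 + (2 + eps^-1) * D `^ a).
  by rewrite lerDl mulr_ge0 ?powR_ge0// addr_ge0// invr_ge0 ltW.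
move=> m n m0 mn h; have m0' : 0 < m%:R :> R by rewrite ltr0n.
have m1 : 1 <= m%:R :> R by rewrite ler1n.
have L0 : 0 <= ln (m%:R : R) by rewrite ln_ge0.
set nu : R := n%:R / m%:R.
have nu0 : 0 <= nu by rewrite divr_ge0.
have md : m%:R `^ delta <= D * nu.
  rewrite mulrA ler_pdivlMr//; apply: le_trans h.
  rewrite powRD; last by rewrite (gt_eqF m0') implybT.
  by rewrite powRr1 ?(ltW m0')// mulrC.
have me : m%:R `^ eps <= D `^ a * nu `^ a.
  rewrite /eps powRrM -powRM ?(ltW D0)//.
  by apply: ge0_ler_powR; rewrite ?nnegrE ?powR_ge0 ?mulr_ge0 ?(ltW D0).
have me1 : 1 <= m%:R `^ eps :> R.
  by have := ler_powR m1 (ltW eps0); rewrite powRr0.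
apply: (@le_trans _ _ (2 + ln m%:R)).
  by apply: ler1_powR => //; lra.
have lnm : ln (m%:R : R) <= eps^-1 * m%:R `^ eps.
  rewrite mulrC ler_pdivlMr// mulrC -ln_powR.
  by apply/ltW/ln_sublinear; apply: powR_gt0.
apply: (@le_trans _ _ ((2 + eps^-1) * m%:R `^ eps)).
  by rewrite mulrDl; apply: lerD => //; rewrite -[X in X <= _]mulr1; apply: ler_wpM2l.
have e0 : 0 <= 2 + eps^-1 by rewrite addr_ge0// invr_ge0 ltW.
apply: (le_trans (ler_wpM2l e0 me)).
by rewrite mulrA; apply: ler_wpM2r; rewrite ?powR_ge0// lerDr.
Qed.

Lemma powR_natM (x : R) k : (x `^ a) ^+ k = x `^ (k%:R * a).
Proof. by rewrite mulrC powRrM powR_mulrn ?powR_ge0. Qed.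

Definition upper_const (A : R) : R := 800 * (A * (2 * expR 1 ^+ 2)).

Lemma upper_const_ge A : 1 <= A -> 24 * expR 1 <= upper_const A.
Proof.
move=> A1; have e1 : 1 <= expR (1 : R) by rewrite ltW// expR_gt1.
rewrite /upper_const; set e := expR 1 in e1 *; have e0 : 0 <= e by apply: le_trans e1.
have h1 : e <= e ^+ 2 by rewrite expr2 ler_peMl.
have h2 : 2 * e ^+ 2 <= A * (2 * e ^+ 2).
  by apply: ler_peMl => //; apply: mulr_ge0; [exact: ler0n | exact: sqr_ge0].
by lra.
Qed.

Lemma upper_const_gt0 A : 1 <= A -> 0 < upper_const A.
Proof.
move=> /upper_const_ge; apply: lt_le_trans.
by apply: mulr_gt0; [exact: ltr0n | exact: expR_gt0].
Qed.

Lemma upper_estimates A m n : 1 <= A -> (0 < m)%N -> (m <= n)%N ->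
  logfactor r s m <= A * (n%:R / m%:R) `^ a ->
  forall J : set (nat -> nat), index_set_deg_le J m ->
  chi_mon r s n m J <= upper_const A ^+ m * (n%:R / m%:R) `^ ((m.-1)%:R * a) /\
  projconst r s n m J <= upper_const A ^+ m * (n%:R / m%:R) `^ (m%:R * a).
Proof.
move=> A1 m0 mn hL J Jm; rewrite -!powR_natM.
set B := A * (2 * expR 1 ^+ 2).
have B0 : 0 <= B.
  apply: mulr_ge0; first exact: le_trans A1.
  by apply: mulr_ge0; [exact: ler0n | exact: sqr_ge0].
split.
  have := chi_mon_upper s1 sr r2 m0 mn A J A1 Jm hL.
  by rewrite -/B (_ : 2 * (400 * B) = upper_const A)// /upper_const -/B; ring.
apply: (le_trans (projconst_upper s1 sr r2 m0 mn A J A1 Jm hL)); rewrite -/B.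
apply: ler_wpM2r; first by apply: exprn_ge0; exact: powR_ge0.
apply: lerXn2r; rewrite ?nnegrE; [|exact/ltW/upper_const_gt0|].
  by apply: mulr_ge0; [exact: ler0n | exact: B0].
by apply: ler_wpM2r; [exact: B0 | rewrite ler_nat].
Qed.

Lemma lower_estimates A m n : 1 <= A -> (0 < m)%N -> (m <= n)%N ->
  forall J : set (nat -> nat), index_set_deg_le J m -> tetra m `<=` J ->
  (upper_const A ^+ m)^-1 * (n%:R / m%:R) `^ ((m.-1)%:R * a) <= chi_mon r s n m J /\
  (upper_const A ^+ m)^-1 * (n%:R / m%:R) `^ (m%:R * a) <= projconst r s n m J.
Proof.
move=> A1 m0 mn J Jm tJ; rewrite -!powR_natM.
have C0 := upper_const_gt0 A A1; have C24 := upper_const_ge A A1.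
have e0 : 0 < expR (1 : R) by apply: expR_gt0.
have inv_le (c : R) : 0 < c -> c <= upper_const A -> (upper_const A ^+ m)^-1 <= (c ^+ m)^-1.
  move=> c0 cC; rewrite lef_pV2 ?posrE ?exprn_gt0//.
  by apply: lerXn2r; rewrite ?nnegrE ?(ltW c0) ?(ltW C0).
split.
  apply: le_trans (chi_mon_lower s1 sr r2 m0 mn J tJ).
  apply: ler_wpM2r; first by apply: exprn_ge0; exact: powR_ge0.
  by apply: inv_le => //; apply: mulr_gt0 => //; exact: ltr0n.
apply: le_trans (projconst_lower s1 sr r2 m0 mn J Jm tJ).
apply: ler_wpM2r; first by apply: exprn_ge0; exact: powR_ge0.
apply: inv_le; first by apply: mulr_gt0 => //; exact: ltr0n.
by apply: le_trans C24; apply: ler_wpM2r; [exact: ltW | rewrite ler_nat].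
Qed.

End Conditions.
(* 1/r' is written (1 - r^-1); the exponent r(1/s - 1/r) is written r * (s^-1 - r^-1);
   the hypothesis  log m + (r'/r) (log m)^{r(1/s-1/r)} <= log n  is written, after
   multiplying by r - 1 = r/r' >= 0, as  (log m)^{r(1/s-1/r)} <= (r - 1)(log n - log m)
   (see NOTES.md). *)
Theorem theorem3p8 (R : realType) (r s : R) :
  1 <= s -> s <= r -> r <= 2 ->
  exists C : R, 0 < C /\
  (* upper estimates under the logarithmic condition *)
  (forall m n : nat, (1 <= m)%N -> (m <= n)%N ->
     (ln (m%:R : R)) `^ (r * (s^-1 - r^-1)) <= (r - 1) * (ln (n%:R : R) - ln (m%:R : R)) ->
     forall J : set (nat -> nat), index_set_deg_le J m ->
       chi_mon r s n m J <= C ^+ m * (n%:R / m%:R) `^ ((m.-1)%:R * (1 - r^-1)) /\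
       projconst r s n m J <= C ^+ m * (n%:R / m%:R) `^ (m%:R * (1 - r^-1))) /\
  (* optimality: reverse estimates for all n >= m whenever Lambda_T(m) is contained in J *)
  (forall m n : nat, (1 <= m)%N -> (m <= n)%N ->
     forall J : set (nat -> nat), index_set_deg_le J m -> tetra m `<=` J ->
       (C ^+ m)^-1 * (n%:R / m%:R) `^ ((m.-1)%:R * (1 - r^-1)) <= chi_mon r s n m J /\
       (C ^+ m)^-1 * (n%:R / m%:R) `^ (m%:R * (1 - r^-1)) <= projconst r s n m J) /\
  (* "in particular": the upper estimates hold (with a constant C') whenever
     m^{1+delta} <= D n, (r,s) <> (2,1) ... *)
  (~ (r = 2 /\ s = 1) ->
   forall delta D : R, 0 < delta -> 0 < D ->
   exists C' : R, 0 < C' /\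
   forall m n : nat, (1 <= m)%N -> (m <= n)%N ->
     (m%:R : R) `^ (1 + delta) <= D * n%:R ->
     forall J : set (nat -> nat), index_set_deg_le J m ->
       chi_mon r s n m J <= C' ^+ m * (n%:R / m%:R) `^ ((m.-1)%:R * (1 - r^-1)) /\
       projconst r s n m J <= C' ^+ m * (n%:R / m%:R) `^ (m%:R * (1 - r^-1))) /\
  (* ... or whenever m^2 <= D n in the case (r,s) = (2,1) *)
  (r = 2 -> s = 1 ->
   forall D : R, 0 < D ->
   exists C' : R, 0 < C' /\
   forall m n : nat, (1 <= m)%N -> (m <= n)%N ->
     (m%:R : R) ^+ 2 <= D * n%:R ->
     forall J : set (nat -> nat), index_set_deg_le J m ->
       chi_mon r s n m J <= C' ^+ m * (n%:R / m%:R) `^ ((m.-1)%:R * (1 - r^-1)) /\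
       projconst r s n m J <= C' ^+ m * (n%:R / m%:R) `^ (m%:R * (1 - r^-1))).
Proof.
move=> s1 sr r2; have A1 : 1 <= (6 : R) by rewrite ler1n.
have power_case delta D : 0 < delta -> 0 < D -> exists C' : R, 0 < C' /\
    forall m n : nat, (1 <= m)%N -> (m <= n)%N -> (m%:R : R) `^ (1 + delta) <= D * n%:R ->
    forall J : set (nat -> nat), index_set_deg_le J m ->
      chi_mon r s n m J <= C' ^+ m * (n%:R / m%:R) `^ ((m.-1)%:R * (1 - r^-1)) /\
      projconst r s n m J <= C' ^+ m * (n%:R / m%:R) `^ (m%:R * (1 - r^-1)).
  move=> d0 D0; have [A A_ge1 hA] := logfactor_le_of_power s1 sr delta D d0 D0.
  exists (upper_const A); split=> [|m n m0 mn h]; first exact: upper_const_gt0.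
  by apply: upper_estimates => //; apply: hA.
exists (upper_const 6); split; first exact: upper_const_gt0.
split; [|split; [|split]].
- move=> m n m0 mn h; apply: upper_estimates => //.
  exact: logfactor_le_of_log.
- by move=> m n m0 mn J Jm tJ; apply: lower_estimates.
- by move=> _; apply: power_case.
- move=> _ _ D D0; have [C' [C0 h]] := power_case 1 D ltr01 D0.
  exists C'; split=> // m n m0 mn hm; apply: h => //.
  by rewrite -[1 + 1]/(2%:R) powR_mulrn.
Qed.
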